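(* Let $G$ be a connected finite simple graph. If the complexified connected subgraph arrangement $\mathcal{A}_G$ is $K(\pi,1)$, then $\mathcal{A}_G$ is free, with the possible exception of $G=K_4$ (the complete graph on $4$ vertices).
   Context: Let $G=(N,E)$ be a finite simple graph with vertex set $N=[n]$; $H_I:=\ker(\sum_{i\in I}x_i)$ and $\mathcal{A}_G:=\{H_I\mid \varnothing\neq I\subseteq N,\ G[I]\text{ connected}\}$, a rational arrangement which is considered as a complex arrangement in $\mathbb{C}^n$ for topological questions. A complex arrangement is $K(\pi,1)$ (aspherical) if the complement $\mathbb{C}^n\setminus\bigcup_{H\in\mathcal{A}}H$ is aspherical, i.e. has contractible universal cover. An arrangement is free if its module of logarithmic derivations $D(\mathcal{A})=\{\theta\in\mathrm{Der}(S)\mid\theta(\alpha_H)\in\alpha_H S\ \forall H\in\mathcal{A}\}$ is a free module over the polynomial ring $S$. *)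

(* Defs.v *)
From HB Require Import structures.
From mathcomp Require Import all_boot all_order all_algebra.
(* mpoly must be imported before mathcomp-analysis (notation levels) *)
From mathcomp Require Import mpoly.
From mathcomp Require Import all_classical all_reals all_analysis.
From mathcomp Require Import Rstruct Rstruct_topology.
From Stdlib Require Rdefinitions.
Set Implicit Arguments. Unset Strict Implicit. Unset Printing Implicit Defensive.
Import Order.TTheory GRing.Theory Num.Theory.
Local Open Scope classical_set_scope.
Local Open Scope ring_scope.

Notation Rl := Rdefinitions.R.

Definition simple_graph n (e : rel 'I_n) : Prop :=
  ssrbool.symmetric e /\ ssrbool.irreflexive e.

Definition induced_connected n (e : rel 'I_n) (I : {set 'I_n}) : Prop :=
  forall x y, x \in I -> y \in I ->
    connect [rel u v | [&& e u v, u \in I & v \in I]] x y.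

Definition graph_connected n (e : rel 'I_n) : Prop :=
  (0 < n)%N /\ induced_connected e [set: 'I_n].

Definition arr_index n (e : rel 'I_n) (I : {set 'I_n}) : Prop :=
  I != finset.set0 /\ induced_connected e I.

Definition is_K4 n (e : rel 'I_n) : Prop :=
  n = 4%N /\ (forall x y : 'I_n, x != y -> e x y).

(* C^n is identified with R^n x R^n via z = x + i y.  Since the linear
   form sum_{i in I} z_i has real coefficients, it vanishes at z iff both
   sum_{i in I} x_i = 0 and sum_{i in I} y_i = 0. *)
Definition Cn n := ('rV[Rl]_n * 'rV[Rl]_n)%type.

Definition cplx_hyperplane n (I : {set 'I_n}) : set (Cn n) :=
  [set z : Cn n | \sum_(i in I) z.1 ord0 i = 0 /\ \sum_(i in I) z.2 ord0 i = 0].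

Definition complement n (e : rel 'I_n) : set (Cn n) :=
  [set z | forall I, arr_index e I -> ~ cplx_hyperplane I z].

Definition usphere k : set 'rV[Rl]_(k.+1) :=
  [set v : 'rV[Rl]_(k.+1) | \sum_i (v ord0 i) ^+ 2 = 1].
Definition udisk k : set 'rV[Rl]_(k.+1) :=
  [set v : 'rV[Rl]_(k.+1) | \sum_i (v ord0 i) ^+ 2 <= 1].
Arguments usphere k : clear implicits.
Arguments udisk k : clear implicits.

Definition pi_trivial (T : topologicalType) (X : set T) (k : nat) : Prop :=
  forall f : 'rV[Rl]_(k.+1) -> T,
    {within (usphere k), continuous f} -> f @` (usphere k) `<=` X ->
    exists g : 'rV[Rl]_(k.+1) -> T,
      [/\ {within (udisk k), continuous g}, g @` (udisk k) `<=` X &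
          forall v, usphere k v -> g v = f v].

(* K(pi,1): all higher homotopy groups vanish (the complement of a
   complex hyperplane arrangement is path-connected). *)
Definition aspherical (T : topologicalType) (X : set T) : Prop :=
  forall k, (2 <= k)%N -> pi_trivial X k.

Definition KPi1 n (e : rel 'I_n) : Prop := aspherical (complement e).

Definition Spoly n := mpoly.mpoly n rat.

(* a derivation theta = sum_i f_i d/dx_i of S = Q[x_1..x_n] *)
Definition derivation n := 'I_n -> Spoly n.

Definition alpha n (I : {set 'I_n}) : Spoly n :=
  \sum_(i in I) mpoly.mpolyX rat (mpoly.mnm1 i).

(* theta(alpha_I) = sum_{i in I} f_i *)
Definition der_apply n (th : derivation n) (I : {set 'I_n}) : Spoly n :=
  \sum_(i in I) th i.

Definition logder n (e : rel 'I_n) (th : derivation n) : Prop :=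
  forall I, arr_index e I -> exists g : Spoly n, der_apply th I = alpha I * g.

Definition arr_free n (e : rel 'I_n) : Prop :=
  exists m (B : 'I_m -> derivation n),
    [/\ forall j, logder e (B j),
        forall th, logder e th ->
          exists c : 'I_m -> Spoly n, forall i, th i = \sum_j c j * B j i &
        forall c : 'I_m -> Spoly n,
          (forall i, \sum_j c j * B j i = 0) -> forall j, c j = 0].

(* Main.v *)
(** The arrangement of a family of connected sets localizes to the arrangement
    spanned by unions of disjoint vertex blocks, and a localization of an
    aspherical arrangement is aspherical.  Five configurations of blocks produce
    either a generic arrangement of [l + 1] hyperplanes in [C^l], [l >= 3], or the
    arrangement [X_3]; neither is aspherical.  Indeed, identify the sphere with the
    boundary of the cube [[-1, 1]^l] and map [x] to the vector with coordinates
    [- rho(x_j) e^(i pi x_j)], where [rho] is [1] on [[-1/2, 1/2]] and large at [-1]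
    and [1]: the angles of a filling, lifted to the cube, contradict the
    Poincare-Miranda theorem.

    A connected graph other than [K_4] without these configurations consists of an
    induced path and one more vertex [z], adjacent to one vertex, to two
    consecutive vertices or to both ends of the path.  In the coordinates given by
    partial sums along the path the connected sets become the forms [T],
    [Y_i - Y_j] and, for [lam i <> lam j], [Y_i - Y_j - T], where [lam] is monotone.
    Modulo the Euler derivation a logarithmic derivation is [Y_i |-> Phi(Y_i)] for a
    polynomial [Phi] in one variable (Newton interpolation), and in terms of [E]
    with [Phi(x + T) - Phi(x) = T E(x)] the remaining conditions are
    divisibilities of the values of [E] at the nodes, which are solved by an
    explicit basis. *)

Require Import Defs.
From HB Require Import structures.
From Stdlib Require List.
From mathcomp Require Import all_boot all_order all_algebra.
From mathcomp Require Import ring lra zify.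
Set Implicit Arguments. Unset Strict Implicit. Unset Printing Implicit Defensive.
Import Order.TTheory GRing.Theory Num.Theory.

(** * Connected vertex sets and induced paths *)

(** Both non-asphericity proofs end in the same contradiction: numbers whose sum is a nonnegative
    real would all be negative reals at one point. For generic hyperplanes these are the coordinates
    times the conjugate of their sum [s], adding up to the square of the modulus of [s]; for [X_3]
    they are three logarithms adding up to 1. The radius rho is large at the ends so that the sum of
    the coordinates has positive real part on the whole boundary of the cube, which keeps the sphere
    off the last hyperplane. Poincare-Miranda is derived from a mod 2 cup product on a cubical grid,
    so neither degree nor homology theory enters.

    The exception [K_4] arises because it contains none of the five configurations: each of them has
    more than four blocks or requires some set of vertices to be disconnected.

    On the algebraic side cycles give [lam = id], the cone over the Shi arrangement of type A; a
    pendant vertex gives two layers and a triangle three. Layers make one basis construction serve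
    all three families. *)

Section Connectivity.
Variables (n : nat) (e : rel 'I_n).
Hypothesis e_sym : symmetric e.
Implicit Types (I J A : {set 'I_n}) (x y : 'I_n).
Notation conn := (induced_connected e).

Lemma conn1 x : conn [set x].
Proof. by move=> y z; rewrite !inE => /eqP-> /eqP->; exact: connect0. Qed.

Lemma connU I J x y : conn I -> conn J -> x \in I -> y \in J -> e x y -> conn (I :|: J).
Proof.
move=> cI cJ xI yJ exy.
pose E := [rel u v | [&& e u v, u \in I :|: J & v \in I :|: J]].
have mono (K : {set 'I_n}) : K \subset I :|: J -> conn K -> forall u v, u \in K -> v \in K -> connect E u v.
  move=> KS cK u v uK vK; apply: connect_sub (cK u v uK vK) => a b /and3P[eab aK bK].
  by apply: connect1; rewrite /= eab !(subsetP KS).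
have mI := mono I (subsetUl I J) cI; have mJ := mono J (subsetUr I J) cJ.
have Exy : connect E x y by apply: connect1; rewrite /= exy !inE xI yJ orbT.
have Eyx : connect E y x by apply: connect1; rewrite /= e_sym exy !inE xI yJ orbT.
move=> u v; rewrite !in_setU => /orP[uI|uJ] /orP[vI|vJ].
- exact: mI.
- exact: connect_trans (mI _ _ uI xI) (connect_trans Exy (mJ _ _ yJ vJ)).
- exact: connect_trans (mJ _ _ uJ yJ) (connect_trans Eyx (mI _ _ xI vI)).
- exact: mJ.
Qed.

Lemma conn_add I x y : conn I -> y \in I -> e x y -> conn (x |: I).
Proof. by move=> cI yI exy; exact: (connU (@conn1 x) cI (set11 _) yI exy). Qed.

(** Most later statements about connected sets use this induction principle, with a suitable [A],
    instead of explicit paths. *)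
Lemma conn_closed I A x y : conn I -> x \in I -> y \in I -> x \in A ->
  (forall u v, u \in I -> v \in I -> u \in A -> e u v -> v \in A) -> y \in A.
Proof.
move=> cI xI yI xA clA; have /connectP[p pth ->] := cI x y xI yI.
elim: p x xI xA pth => [//|z p IH] x xI xA /= /andP[/and3P[exz _ zI] pth].
exact: IH (clA _ _ xI zI xA exz) pth.
Qed.

Lemma disconn I A x y : x \in I -> y \in I -> x \in A -> y \notin A ->
  (forall u v, u \in I -> v \in I -> u \in A -> v \notin A -> e u v = false) -> ~ conn I.
Proof.
move=> xI yI xA /negP yA noe cI; apply: yA; apply: (conn_closed cI xI yI xA).
move=> u v uI vI uA euv; apply: contraT => vA.
by rewrite (noe u v) in euv.
Qed.

Lemma disconn_isolated I x y : x \in I -> y \in I -> y != x ->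
  (forall u, u \in I -> e x u = false) -> ~ conn I.
Proof.
move=> xI yI yx noe; apply: (@disconn I [set x] x y); rewrite ?inE //.
by move=> u v _ vI; rewrite inE => /eqP-> _; exact: noe.
Qed.
End Connectivity.

Definition block_of n (L : seq {set 'I_n}) m (j : 'I_m) : {set 'I_n} := nth set0 L j.

Lemma block_of_neq0 n (L : seq {set 'I_n}) m (j : 'I_m) :
  size L = m -> all (fun X => X != set0) L -> block_of L j != set0.
Proof. by move=> sL /allP; apply; rewrite mem_nth // sL. Qed.

Lemma block_of_inj n (L : seq {set 'I_n}) m (j j' : 'I_m) i :
  size L = m -> pairwise (fun X Y : {set 'I_n} => [disjoint X & Y]) L ->
  i \in block_of L j -> i \in block_of L j' -> j = j'.
Proof.
move=> sL dL ij ij'.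
have {}dL := elimT (pairwiseP set0) dL.
apply: ord_inj; apply/eqP; rewrite eqn_leq [in X in X && _]leqNgt [in X in _ && X]leqNgt.
have H (k k' : 'I_m) : i \in block_of L k -> i \in block_of L k' -> (k < k')%N = false.
  move=> ik ik'; apply/negP => kk'.
  have := dL k k'; rewrite !inE sL !ltn_ord => /(_ isT isT kk') /pred0P/(_ i) /=.
  by rewrite ik ik'.
by rewrite (H j j') // (H j' j).
Qed.

Definition disjoint_blocks n (L : seq {set 'I_n}) : bool :=
  all (fun X => X != set0) L && pairwise (fun X Y : {set 'I_n} => [disjoint X & Y]) L.

Lemma disjoint_points n (s : seq 'I_n) : uniq s -> disjoint_blocks [seq [set x] | x <- s].
Proof.
move=> us; apply/andP; split.
  by apply/allP => _ /mapP[x _ ->]; apply/set0Pn; exists x; rewrite inE.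
elim: s us => [//|x s IH] /= /andP[xs us]; rewrite IH // andbT.
apply/allP => _ /mapP[y ys ->]; rewrite disjoints1 inE.
by apply: contraNneq xs => ->.
Qed.

Definition padj (i j : nat) : bool := (i.+1 == j) || (j.+1 == i).

Section InducedPaths.
Variables (n : nat) (e : rel 'I_n) (x0 : 'I_n).
Hypothesis e_sym : symmetric e.
Hypothesis e_irr : irreflexive e.
Notation conn := (induced_connected e).
Implicit Types (s : seq 'I_n).

Definition induced_path s : Prop := uniq s /\ forall i j, (i < size s)%N -> (j < size s)%N ->
  e (nth x0 s i) (nth x0 s j) = padj i j.

Lemma induced_path_cat s1 s2 : induced_path s1 -> induced_path s2 ->
  (forall x, x \in s1 -> x \in s2 -> False) ->
  (forall i j, (i < size s1)%N -> (j < size s2)%N ->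
     e (nth x0 s1 i) (nth x0 s2 j) = (i.+1 == size s1) && (j == 0)) ->
  induced_path (s1 ++ s2).
Proof.
move=> [u1 h1] [u2 h2] d12 c12; split.
  rewrite cat_uniq u1 u2 andbT /=; apply/hasPn => x xs2; apply/negP => xs1; exact: d12 xs2.
move=> i j; rewrite size_cat !nth_cat => il jl.
case: (ltnP i (size s1)) => i1; case: (ltnP j (size s1)) => j1.
- exact: h1.
- by rewrite c12 //; [rewrite /padj; lia|lia].
- by rewrite e_sym c12 //; [rewrite /padj; lia|lia].
- by rewrite h2; [rewrite /padj; lia|lia|lia].
Qed.

Lemma induced_path_rev s : induced_path s -> induced_path (rev s).
Proof.
move=> [us hs]; split; first by rewrite rev_uniq.
move=> i j; rewrite size_rev => il jl; rewrite !nth_rev // hs; [rewrite /padj; lia|lia|lia].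
Qed.

Lemma induced_path1 x : induced_path [:: x].
Proof. by split=> // -[|i] [|j] //= _ _; rewrite e_irr. Qed.

(* P R a is an invariant forcing the first vertex a to have at most one
   neighbour in R and passing to (R \ a, a'). *)
Lemma leg_path (P : {set 'I_n} -> 'I_n -> Prop) :
  (forall R a x y, P R a -> a \in R -> x \in R -> y \in R -> e a x -> e a y -> x = y) ->
  (forall R a a', P R a -> a \in R -> a' \in R -> e a a' -> P (R :\ a) a') ->
  forall (R : {set 'I_n}) a, a \in R -> conn R -> P R a ->
  exists s, [/\ induced_path (a :: s), (a :: s) =i R & conn (R :\ a)].
Proof.
move=> P1 P2 R; move: {2}#|R| (erefl #|R|) => k.
elim: k R => [|k IH] R cR a aR cnR PR.
  by have := aR; rewrite (cards0_eq cR) inE.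
have cR' : #|R :\ a| = k by move: cR; rewrite (cardsD1 a) aR; case.
have [R0|/set0Pn[b bR]] := eqVneq (R :\ a) set0.
  exists [::]; split; first exact: induced_path1.
    by move=> x; rewrite -(setD1K aR) R0 !inE orbF.
  by rewrite R0 => x y; rewrite inE.
have [a' a'R ea] : exists2 a', a' \in R & e a a'.
  have [/exists_inP//|/exists_inPn h] := boolP [exists (a' | a' \in R), e a a'].
  have := bR; rewrite !inE => /andP[ba bR'].
  have : b \in [set a]; last by rewrite inE (negbTE ba).
  apply: (conn_closed cnR aR bR'); first by rewrite inE.
  move=> u v uR vR; rewrite !inE => /eqP-> eav.
  by have := h v vR; rewrite eav.
have aa' : a' != a by apply: contraTneq ea => ->; rewrite e_irr.
have a'R' : a' \in R :\ a by rewrite !inE aa' a'R.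
(* A walk in [R] that enters [a] has to come from [a'] and return to [a'], the only neighbour of [a]
   in [R]; the detour can be cut out. *)
have cn' : conn (R :\ a).
  pose E := [rel u v | [&& e u v, u \in R :\ a & v \in R :\ a]].
  have Esym : connect_sym E.
    by apply: sym_connect_sym => u v; rewrite /= e_sym; case: (u \in _); case: (v \in _); rewrite ?andbF.
  have H u : u \in R :\ a -> connect E a' u.
    rewrite !inE => /andP[ua uR].
    have : u \in a |: [set w | connect E a' w]; last by rewrite !inE (negbTE ua).
    apply: (conn_closed cnR aR uR); first by rewrite !inE eqxx.
    move=> w w' wR w'R; rewrite !inE.
    have [->|w'a] := eqVneq w' a => //=.
    case/orP => [/eqP-> eaw'|cw ww'].
      by rewrite (P1 _ _ _ _ PR aR w'R a'R eaw' ea) connect0.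
    have [wa|wa] := eqVneq w a.
      by rewrite wa in ww'; rewrite (P1 _ _ _ _ PR aR w'R a'R ww' ea) connect0.
    by apply: connect_trans cw (connect1 _); rewrite /= ww' !inE wa wR w'a w'R.
  by move=> u w uR wR; apply: connect_trans (H w wR); rewrite Esym H.
have [s [[us hs] sR _]] := IH _ cR' a' a'R' cn' (P2 _ _ _ PR aR a'R ea).
have Es x : x \in a' :: s -> e a x -> x = a'.
  by rewrite sR => xR eax; apply: P1 PR aR _ a'R eax ea; move: xR; rewrite !inE => /andP[].
exists (a' :: s); split=> //; last first.
  by move=> x; rewrite in_cons sR -(setD1K aR) !inE; case: (x == a).
split; first by rewrite cons_uniq us andbT sR !inE eqxx.
have eaE j : (j < size (a' :: s))%N -> e a (nth x0 (a' :: s) j) = (j == 0).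
  move=> js; apply/idP/eqP => [/Es|->]; last exact: ea.
  move=> /(_ (mem_nth _ js)) Ej; apply/eqP.
  by rewrite -(nth_uniq x0 js (ltn0Sn _) us) Ej.
move=> [|i] [|j] il jl; rewrite /padj.
- by rewrite /= e_irr.
- by rewrite -[nth _ _ j.+1]/(nth x0 (a' :: s) j) eaE; [case: j {jl}|].
- by rewrite e_sym -[nth _ _ i.+1]/(nth x0 (a' :: s) i) eaE; [case: i {il}|].
- by rewrite -[nth _ _ i.+1]/(nth x0 (a' :: s) i) -[nth _ _ j.+1]/(nth x0 (a' :: s) j) hs.
Qed.
End InducedPaths.

(** * Connected graphs without the five forbidden configurations *)

(** The three shapes are a path with a pendant vertex (a path itself when [k] is an end), a path
    with a triangle on one of its edges, and a cycle. The alternative [s = [::]] admits the graph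
    with a single vertex, where no position [k] exists. *)
Definition path_plus_vertex n (e : rel 'I_n) : Prop :=
  exists (z : 'I_n) (s : seq 'I_n), [/\ uniq (z :: s), forall x, x \in z :: s, induced_path e z s &
   [\/ exists k, (s = [::] \/ (k < size s)%N) /\
         (forall i, (i < size s)%N -> e z (nth z s i) = (i == k)),
       exists k, (k.+1 < size s)%N /\
         (forall i, (i < size s)%N -> e z (nth z s i) = (i == k) || (i == k.+1)) |
       (1 < size s)%N /\
         (forall i, (i < size s)%N -> e z (nth z s i) = (i == 0) || (i.+1 == size s))]].

Lemma rev_index_lt k i : (i < k)%N -> (k - i.+1 < k)%N.
Proof. lia. Qed.

Lemma rev_index_eq0 k i : (i < k)%N -> (k - i.+1 == 0)%N = (i.+1 == k).
Proof. lia. Qed.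

Lemma sub_eqS i k j : (i - k)%N = j.+1 -> (k < i)%N.
Proof. lia. Qed.

Ltac split_memberships := repeat case/orP; by [move=> ->; rewrite ?orbT|].

Section Classification.
Variables (n : nat) (e : rel 'I_n).
Hypothesis e_sym : symmetric e.
Hypothesis e_irr : irreflexive e.
Notation conn := (induced_connected e).
Hypothesis n0 : (0 < n)%N.
Hypothesis e_conn : conn [set: 'I_n].

Hypothesis no_star : forall a b c d m : {set 'I_n}, disjoint_blocks [:: a; b; c; d; m] ->
  conn (a :|: (b :|: m)) -> conn (a :|: (c :|: m)) ->
  conn (b :|: (d :|: m)) -> conn (c :|: (d :|: m)) -> False.
Hypothesis no_square : forall b c d m : {set 'I_n}, disjoint_blocks [:: b; c; d; m] ->
  conn (b :|: m) -> conn (c :|: m) ->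
  conn (b :|: (d :|: m)) -> conn (c :|: (d :|: m)) -> ~ conn d -> False.
Hypothesis no_diamond : forall a b c d : {set 'I_n}, disjoint_blocks [:: a; b; c; d] ->
  conn b -> conn c -> conn (b :|: c) -> conn (a :|: (c :|: d)) -> conn (a :|: (b :|: d)) ->
  conn (a :|: (b :|: (c :|: d))) -> ~ conn (a :|: d) -> False.
Hypothesis no_spider : forall m a1 a2 b1 b2 c1 c2, uniq [:: a2; a1; b2; b1; c2; c1; m] ->
  e m a1 -> e a1 a2 -> e m b1 -> e b1 b2 -> e m c1 -> e c1 c2 ->
  e a2 m = false -> e a2 b1 = false -> e a2 c1 = false ->
  e b2 m = false -> e b2 a1 = false -> e b2 c1 = false ->
  e c2 m = false -> e c2 a1 = false -> e c2 b1 = false -> False.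
Hypothesis no_net : forall x y z x' y' z', uniq [:: x'; y'; z'; x; y; z] ->
  e x y -> e y z -> e x z -> e x x' -> e y y' -> e z z' ->
  e z' y = false -> e y' z = false -> e x' z' = false -> e x' z = false -> False.
Hypothesis no_K4 : ~ is_K4 e.

Implicit Types (x y z v a b c : 'I_n) (M R Z : {set 'I_n}) (s : seq 'I_n).

Definition outer M x : bool := (x \notin M) && [exists u in M, e u x].

Lemma outerP M x : reflect (x \notin M /\ exists2 u, u \in M & e u x) (outer M x).
Proof.
apply: (iffP andP) => -[xM h]; split=> //; first by case/exists_inP: h => u; exists u.
by case: h => u uM eux; apply/exists_inP; exists u.
Qed.

Lemma conn_outer M N x : conn N -> M \subset N -> outer M x -> conn (x |: N).
Proof.
move=> cN MN /outerP[_ [u uM eux]].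
by apply: (conn_add e_sym cN (subsetP MN _ uM)); rewrite e_sym.
Qed.

Lemma disjoint1r x M : [disjoint [set x] & M] = (x \notin M).
Proof. by rewrite disjoints1. Qed.

Lemma disjoint1l x M : [disjoint M & [set x]] = (x \notin M).
Proof. by rewrite disjoint_sym disjoints1. Qed.

Lemma set1_neq0 x : [set x] != set0.
Proof. by apply/set0Pn; exists x; rewrite inE. Qed.

(** [M] serves as the centre of a star, since adding outer vertices to a connected set keeps it
    connected. For a single vertex [M] this bounds the degree by three. *)
Lemma at_most_three_outer M a b c d : conn M -> uniq [:: a; b; c; d] ->
  outer M a -> outer M b -> outer M c -> outer M d -> False.
Proof.
move=> cM us oa ob oc od.
have [[aM _] [bM _]] := (elimT (outerP M a) oa, elimT (outerP M b) ob).
have [[cM' _] [dM _]] := (elimT (outerP M c) oc, elimT (outerP M d) od).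
apply: (@no_star [set a] [set b] [set c] [set d] M).
- have M0 : M != set0 by case/outerP: oa => _ [u uM _]; apply/set0Pn; exists u.
  move: us; rewrite /disjoint_blocks /= !set1_neq0 M0 /= !disjoint1r !inE !negb_or.
  by rewrite aM bM cM' dM => /and4P[/and3P[-> -> ->] /andP[-> ->] -> _].
all: by apply: (@conn_outer M); rewrite ?subsetUr //; apply: (@conn_outer M).
Qed.

Definition three_neighbours v a b c := [/\ uniq [:: a; b; c], e v a, e v b & e v c].

Lemma three_neighbours_rot v a b c : three_neighbours v a b c -> three_neighbours v b c a.
Proof.
case=> us ea eb ec; split=> //; move: us; rewrite /= !inE !negb_or => /and3P[/andP[ab ac] bc _].
by rewrite bc eq_sym ab eq_sym ac.
Qed.

Lemma three_neighbours_swap v a b c : three_neighbours v a b c -> three_neighbours v b a c.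
Proof.
case=> us ea eb ec; split=> //; move: us; rewrite /= !inE !negb_or => /and3P[/andP[ab ac] bc _].
by rewrite eq_sym ab ac bc.
Qed.

Lemma three_neighbours_all v a b c x : three_neighbours v a b c -> e v x -> x \in [:: a; b; c].
Proof.
move=> [us ea eb ec] ex; apply: contraT => xn.
have o y : e v y -> outer [set v] y.
  move=> ey; apply/outerP; split; last by exists v; rewrite ?inE.
  by rewrite inE; apply: contraTneq ey => ->; rewrite e_irr.
case: (@at_most_three_outer [set v] x a b c); rewrite ?o //; first exact: conn1.
by rewrite cons_uniq xn.
Qed.

Lemma neq_edge x y : e x y -> x != y.
Proof. by apply: contraTneq => ->; rewrite e_irr. Qed.

(** This is [K_4] without the edge [x z]; the blocks are single vertices, the outer two being [x]
    and [z]. *)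
Lemma no_diamond_points v x y z : e v x -> e v y -> e v z -> e x y -> e y z -> x != z ->
  e x z = false -> False.
Proof.
move=> vx vy vz xy yz xz exz.
have [xv yv zv] : [/\ e x v, e y v & e z v] by split; rewrite e_sym.
have [yx zy] : e y x /\ e z y by split; rewrite e_sym.
have c1 u := @conn1 _ e u.
apply: (@no_diamond [set x] [set y] [set v] [set z]) => //.
- rewrite /disjoint_blocks /= !set1_neq0 /= !disjoint1r !inE.
  by rewrite xz !neq_edge.
- by apply: (conn_add e_sym (c1 v) _ yv); rewrite inE.
- apply: (conn_add e_sym _ _ xv); last by rewrite !inE eqxx.
  by apply: (conn_add e_sym (c1 z) _ vz); rewrite inE.
- apply: (conn_add e_sym _ _ xy); last by rewrite !inE eqxx.
  by apply: (conn_add e_sym (c1 z) _ yz); rewrite inE.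
- apply: (conn_add e_sym _ _ xy); last by rewrite !inE eqxx.
  apply: (conn_add e_sym _ _ yv); last by rewrite !inE eqxx.
  by apply: (conn_add e_sym (c1 z) _ vz); rewrite inE.
- apply: (@disconn_isolated _ e _ x z); rewrite ?inE ?eqxx ?orbT //; first by rewrite eq_sym.
  by move=> u; rewrite !inE => /orP[] /eqP->; rewrite ?e_irr.
Qed.

(** If the third edge [a c] is missing, the four vertices form [K_4] without an edge. Otherwise each
    of them already has three neighbours among the others, so by the degree bound and connectedness
    the graph is [K_4]. *)
Lemma triangle_edges v a b c : three_neighbours v a b c -> e a b -> e b c -> False.
Proof.
move=> N3 eab ebc; have [us ea eb ec] := N3.
have ac : a != c by move: us; rewrite /= !inE negb_or => /and3P[/andP[]].
case: (boolP (e a c)) => [eac|/negbTE eac]; last exact: (no_diamond_points ea eb ec eab ebc ac eac).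
have va : uniq [:: v; a; b; c].
  by rewrite cons_uniq us andbT !inE !negb_or !neq_edge.
have Na : three_neighbours a v b c.
  split=> //; last by rewrite e_sym.
  by rewrite /= !inE !negb_or !neq_edge.
have Nb : three_neighbours b v a c.
  split=> //; [|by rewrite e_sym|by rewrite e_sym].
  by rewrite /= !inE !negb_or !neq_edge.
have Nc : three_neighbours c v a b.
  split=> //; [|by rewrite e_sym|by rewrite e_sym|by rewrite e_sym].
  by rewrite /= !inE !negb_or !neq_edge.
have all4 x : x \in [:: v; a; b; c].
  have : x \in [set y in [:: v; a; b; c]]; last by rewrite inE.
  apply: (conn_closed e_conn (in_setT v) (in_setT x)); first by rewrite !inE eqxx.
  move=> u w _ _; rewrite !inE => /or4P[] /eqP-> euw.
  + by have := three_neighbours_all N3 euw; rewrite !inE => /or3P[] ->; rewrite ?orbT.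
  + by have := three_neighbours_all Na euw; rewrite !inE => /or3P[] ->; rewrite ?orbT.
  + by have := three_neighbours_all Nb euw; rewrite !inE => /or3P[] ->; rewrite ?orbT.
  + by have := three_neighbours_all Nc euw; rewrite !inE => /or3P[] ->; rewrite ?orbT.
apply: no_K4; split.
  have <- : #|[:: v; a; b; c]| = 4 by exact: (card_uniqP va).
  by rewrite -[LHS](card_ord n); apply: eq_card => x; rewrite all4.
move=> x y xy; move: (all4 x) (all4 y) xy; rewrite !inE => /or4P[] /eqP-> /or4P[] /eqP->;
  by rewrite ?eqxx // ?ea ?eb ?ec ?eab ?ebc ?eac // e_sym ?ea ?eb ?ec ?eab ?ebc ?eac.
Qed.

(* A connected set off the closed neighbourhood of v cannot see two of the
   three neighbours of v. *)
Lemma no_bridge v a b c Z z : three_neighbours v a b c -> conn Z ->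
  v \notin Z -> a \notin Z -> b \notin Z -> c \notin Z ->
  z \in Z -> e a z -> (exists2 z', z' \in Z & e b z') -> False.
Proof.
move=> N3 cZ vZ aZ bZ cZ' zZ eaz [z' z'Z ebz']; have [us ea eb ec] := N3.
have [ab ac bc] : [/\ a != b, a != c & b != c].
  by move: us; rewrite /= !inE !negb_or => /and3P[/andP[-> ->] -> _].
have Z0 : Z != set0 by apply/set0Pn; exists z.
have [av bv cv] : [/\ e a v, e b v & e c v] by split; rewrite e_sym.
have c1 u := @conn1 _ e u.
have [ez'b eza] : e z' b /\ e z a by split; rewrite e_sym.
(* If [c] does not see [Z], the disconnected set [c |: Z] is the block [d] of a square with centre
   [v] and corners [a], [b]. *)
case: (boolP [exists u in Z, e c u]) => [/exists_inP[w wZ ecw]|/exists_inP noc]; last first.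
  have [DL C5] : disjoint_blocks [:: [set a]; [set b]; c |: Z; [set v]] /\ ~ conn (c |: Z).
    split.
      rewrite /disjoint_blocks /= !set1_neq0 /= !disjoint1r !inE !negb_or /=.
      rewrite ab ac bc aZ bZ (neq_edge av) (neq_edge bv) !disjoint1l !inE !negb_or vZ.
      rewrite (eq_sym v) (neq_edge cv) !andbT /=.
      by apply/set0Pn; exists c; rewrite !inE eqxx.
    apply: (@disconn_isolated _ e _ c z); rewrite ?inE ?eqxx ?zZ ?orbT //.
      by apply: contraNneq cZ' => <-.
    move=> u; rewrite !inE => /orP[/eqP->|uZ]; first exact: e_irr.
    by apply/negbTE/negP => ecu; apply: noc; exists u.
  have cvZ x y : y \in Z -> e x y -> e x v -> x \notin Z -> conn ([set x] :|: ((c |: Z) :|: [set v])).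
    move=> yZ exy exv xZ.
    have -> : [set x] :|: ((c |: Z) :|: [set v]) = (c |: (v |: [set x])) :|: Z.
      by apply/setP => u; rewrite !inE; case: (u == x); case: (u == c); case: (u == v); case: (u \in Z).
    apply: (connU e_sym _ cZ _ yZ exy); last by rewrite !inE eqxx !orbT.
    apply: (conn_add e_sym _ _ cv); last by rewrite !inE eqxx.
    by apply: (conn_add e_sym (c1 x) _ _); rewrite ?inE // e_sym.
  apply: (no_square DL) => //.
  + by apply: (conn_add e_sym (c1 v) _ av); rewrite inE.
  + by apply: (conn_add e_sym (c1 v) _ bv); rewrite inE.
  + exact: cvZ zZ eaz av aZ.
  + exact: cvZ z'Z ebz' bv bZ.
(* If all three neighbours see [Z], the diamond with blocks [p], [r |: Z], [v], [q] forces [p] and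
   [q] to be adjacent. Two such edges contradict [triangle_edges]. *)
have key p q r zp zq zr : three_neighbours v p q r -> p \notin Z -> q \notin Z -> r \notin Z ->
    zp \in Z -> zq \in Z -> zr \in Z -> e p zp -> e q zq -> e r zr -> e p q.
  move=> [us' ep eq er] pZ qZ rZ zpZ zqZ zrZ epz eqz erz.
  have [pq pr qr] : [/\ p != q, p != r & q != r].
    by move: us'; rewrite /= !inE !negb_or => /and3P[/andP[-> ->] -> _].
  have [pv qv rv] : [/\ e p v, e q v & e r v] by split; rewrite e_sym.
  apply: contraT => npq; exfalso.
  have crZ : conn (r |: Z) by exact: (conn_add e_sym cZ zrZ erz).
  have cvq : conn ([set v] :|: [set q]) by apply: (conn_add e_sym (c1 q) _ eq); rewrite inE.
  have crZq : conn ((r |: Z) :|: [set q]).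
    apply: (connU e_sym crZ (c1 q) _ _ (_ : e zq q)); rewrite ?inE ?zqZ ?orbT //.
    by rewrite e_sym.
  apply: (@no_diamond [set p] (r |: Z) [set v] [set q]) => //.
  + rewrite /disjoint_blocks /= !set1_neq0 /= !disjoint1r !inE !negb_or.
    rewrite pr pq pZ (neq_edge pv) (neq_edge eq) !disjoint1l !inE !negb_or vZ qZ.
    rewrite (eq_sym v) (neq_edge rv) qr !andbT /=.
    by apply/set0Pn; exists r; rewrite !inE eqxx.
  + by apply: (connU e_sym crZ (c1 v) _ _ rv); rewrite !inE eqxx.
  + by apply: (conn_add e_sym cvq _ pv); rewrite !inE eqxx.
  + by apply: (conn_add e_sym crZq _ epz); rewrite !inE zpZ orbT.
  + apply: (conn_add e_sym _ _ epz); last by rewrite !inE zpZ !orbT.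
    by apply: (connU e_sym crZ cvq _ _ rv); rewrite !inE eqxx.
  + apply: (@disconn_isolated _ e _ p q); rewrite ?inE ?eqxx ?orbT //; first by rewrite eq_sym.
    by move=> u; rewrite !inE => /orP[] /eqP->; rewrite ?e_irr // (negbTE npq).
have eab := key _ _ _ _ _ _ N3 aZ bZ cZ' zZ z'Z wZ eaz ebz' ecw.
have ebc := key _ _ _ _ _ _ (three_neighbours_rot N3) bZ cZ' aZ z'Z wZ zZ ebz' ecw eaz.
exact: triangle_edges N3 eab ebc.
Qed.

(** The connected component of [a] in the graph with [N] deleted. *)
Lemma component (N : seq 'I_n) a : a \notin N -> exists R, [/\ a \in R,
  forall x, x \in R -> x \notin N,
  forall x w, x \in R -> e x w -> (w \in N) || (w \in R) & conn R].
Proof.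
move=> aN; pose E := [rel u w | [&& e u w, u \notin N & w \notin N]].
pose R := [set u | connect E a u]; exists R.
have RN x : x \in R -> x \notin N.
  rewrite inE => /connectP[p pth ->]; elim: p (a) aN pth => [//|y p IH] z zN /= /andP[/and3P[_ _ yN] pth].
  exact: IH yN pth.
split=> //; first by rewrite inE connect0.
  move=> x w xR exw; case: (boolP (w \in N)) => //= wN; move: (xR); rewrite !inE => cx.
  by apply: connect_trans cx (connect1 _); rewrite /= exw wN RN.
have Esym : connect_sym [rel u w | [&& e u w, u \in R & w \in R]].
  by apply: sym_connect_sym => u w; rewrite /= e_sym; case: (u \in R); case: (w \in R); rewrite ?andbF.
have H u : u \in R -> connect [rel u w | [&& e u w, u \in R & w \in R]] a u.
  rewrite inE => /connectP[p pth ->].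
  elim/last_ind: p pth => [|p y IH]; first by rewrite connect0.
  rewrite rcons_path last_rcons => /andP[pth ey].
  apply: connect_trans (IH pth) (connect1 _); case/and3P: (ey) => e1 _ _.
  rewrite /= e1 /=; have lR : last a p \in R by rewrite inE; apply/connectP; exists p.
  rewrite lR /=; move: (lR); rewrite !inE => /connect_trans; apply; exact: connect1.
by move=> u w uR wR; apply: connect_trans (H w wR); rewrite Esym H.
Qed.

(** The component of [a] off [v], [b], [c] is an induced path by [leg_path]. Its vertices other than
    [a] miss [v] because [v] has no fourth neighbour, and miss [b] and [c] by [no_bridge] applied to
    the component without [a]. *)
Lemma leg v a b c : three_neighbours v a b c -> exists s,
  [/\ induced_path e v (a :: s),
      forall x, x \in a :: s -> x \notin [:: v; b; c],
      forall x, x \in s -> [/\ e x v = false, e x b = false & e x c = false] &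
      forall x w, x \in a :: s -> e x w -> (w \in [:: v; b; c]) || (w \in a :: s)].
Proof.
move=> N3; have [us ea eb ec] := N3.
have [ab ac bc] : [/\ a != b, a != c & b != c].
  by move: us; rewrite /= !inE negb_or => /and3P[/andP[-> ->] -> _].
have [av bv cv] : [/\ e a v, e b v & e c v] by split; rewrite e_sym.
have aN : a \notin [:: v; b; c] by rewrite !inE !negb_or (neq_edge av) ab ac.
have [R [aR RN Rcl cR]] := component aN.
(* A connected [M] containing [a] has at most one outer vertex in [R]: two of them, together with
   [b] and [c], would be four outer vertices of [v |: M]. *)
pose P (R : {set 'I_n}) a := forall M x y, M \subset R -> a \in M -> conn M ->
  x \in R -> y \in R -> outer M x -> outer M y -> x = y.
have PR : P R a.
  move=> M x y MR aM cM xR yR /outerP[xM [u uM eux]] /outerP[yM [w wM ewy]].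
  apply/eqP; apply: contraT => xy; exfalso.
  have cvM : conn (v |: M) by exact: (conn_add e_sym cM aM ea).
  have oE t : t \in R -> t \notin M -> (exists2 u, u \in M & e u t) -> outer (v |: M) t.
    move=> tR tM [u' u'M eut]; apply/outerP; split; last by exists u'; rewrite // !inE u'M orbT.
    by have := RN t tR; rewrite !inE !negb_or => /and3P[-> _ _].
  have oV t : e v t -> t \notin R -> outer (v |: M) t.
    move=> evt tR; apply/outerP; split; last by exists v; rewrite // !inE eqxx.
    rewrite !inE negb_or eq_sym neq_edge //=.
    by apply: contraNN tR; exact: (subsetP MR).
  have bR : b \notin R by apply/negP => /RN; rewrite !inE eqxx orbT.
  have cR' : c \notin R by apply/negP => /RN; rewrite !inE eqxx !orbT.
  apply: (@at_most_three_outer (v |: M) x y b c) => //; last 4 first.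
  - by apply: oE => //; exists u.
  - by apply: oE => //; exists w.
  - exact: oV.
  - exact: oV.
  rewrite /= !inE !negb_or xy bc !andbT /=.
  by have := RN x xR; have := RN y yR; rewrite !inE !negb_or => /and3P[_ -> ->] /and3P[_ -> ->].
have [||s [ips sR cs]] := @leg_path n e v e_sym e_irr P _ _ R a aR cR PR.
- move=> R' a' x y PR' aR' xR yR eax eay.
  apply: (PR' [set a'] x y); rewrite ?sub1set ?inE ?eqxx //; first exact: conn1.
    by apply/outerP; rewrite inE eq_sym neq_edge //; split=> //; exists a'; rewrite ?inE.
  by apply/outerP; rewrite inE eq_sym neq_edge //; split=> //; exists a'; rewrite ?inE.
- move=> R' a' a'' PR' aR' a''R' ea' M x y MR aM cM xR yR ox oy.
  have [xR' yR'] : x \in R' /\ y \in R' by move: xR yR; rewrite !inE => /andP[_ ->] /andP[_ ->].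
  have xa : x != a' by move: xR; rewrite !inE => /andP[].
  have ya : y != a' by move: yR; rewrite !inE => /andP[].
  have oo t : t != a' -> outer M t -> outer (a' |: M) t.
    move=> ta /outerP[tM [u uM eut]]; apply/outerP; split; first by rewrite !inE negb_or ta.
    by exists u; rewrite // !inE uM orbT.
  apply: (PR' (a' |: M)); rewrite ?oo //.
  + rewrite subUset sub1set aR' /=; apply: subset_trans MR _; exact: subsetDl.
  + by rewrite !inE eqxx.
  + exact: (conn_add e_sym cM aM ea').
exists s; split=> //.
- by move=> x; rewrite sR; exact: RN.
- move=> x xs; have [ua _] := ips.
  have xa : x != a by move: ua => /= /andP[+ _]; apply: contraNneq => <-.
  have xR : x \in R by rewrite -sR inE xs orbT.
  have := RN x xR; rewrite !inE !negb_or => /and3P[xv xb xc].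
  have s0 : exists2 z, z \in R :\ a & e a z.
    case: s ips sR {cs ua} xs => [//|z s] ips sR _; exists z.
      by rewrite in_setD1 -sR !inE eqxx orbT andbT; case: ips => /= /andP[+ _ _]; rewrite inE negb_or eq_sym => /andP[].
    by have [_ /(_ 0 1 isT isT)] := ips.
  have [z zZ eaz] := s0.
  have xZ : x \in R :\ a by rewrite in_setD1 xa.
  have nb p q : three_neighbours v a p q -> p \in [:: v; b; c] -> q \in [:: v; b; c] -> e x p = false.
    move=> N3' pN qN; apply/negbTE/negP => exp.
    have aZ : a \notin R :\ a by rewrite in_setD1 eqxx.
    have nR t : t \in [:: v; b; c] -> t \notin R :\ a.
      by move=> tN; rewrite in_setD1 negb_and; apply/orP; right; apply/negP => /RN; rewrite tN.
    apply: (no_bridge N3' cs (nR v (mem_head _ _)) aZ (nR p pN) (nR q qN) zZ eaz).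
    by exists x; rewrite // e_sym.
  split.
  + apply/negbTE/negP; rewrite e_sym => /(three_neighbours_all N3).
    by rewrite !inE (negbTE xa) (negbTE xb) (negbTE xc).
  + by apply: (nb b c); rewrite ?inE ?eqxx ?orbT.
  + apply: (nb c b); rewrite ?inE ?eqxx ?orbT //.
    exact: (three_neighbours_swap (three_neighbours_rot (three_neighbours_rot N3))).
- by move=> x w; rewrite !sR; exact: Rcl.
Qed.

Lemma induced_path_default x0 x1 s : induced_path e x0 s -> induced_path e x1 s.
Proof.
move=> [us h]; split=> // i j il jl.
by rewrite (set_nth_default x0 x1 il) (set_nth_default x0 x1 jl) h.
Qed.

Lemma nth_head x0 x s j : uniq (x :: s) -> (j < size (x :: s))%N ->
  (nth x0 (x :: s) j == x) = (j == 0).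
Proof. by move=> us js; rewrite -(nth_uniq x0 js (ltn0Sn _) us). Qed.

Definition far x sx y sy := (forall u, u \in x :: sx -> u \in y :: sy -> False) /\
  (forall u w, u \in x :: sx -> w \in y :: sy -> e u w -> u = x /\ w = y).

Lemma far_sym x sx y sy : far x sx y sy -> far y sy x sx.
Proof.
move=> [h1 h2]; split=> [u u1 u2|u w u1 u2]; first exact: h1 u2 u1.
by rewrite e_sym => /(h2 _ _ u2 u1)[].
Qed.

Definition attached v x sx := [/\ induced_path e v (x :: sx), v \notin x :: sx, e v x &
  forall u, u \in x :: sx -> e v u -> u = x].

Definition three_legs v a sa b sb c sc :=
  [/\ attached v a sa, attached v b sb & attached v c sc] /\
  [/\ far a sa b sb, far b sb c sc & far c sc a sa] /\
  (forall x, x \in v :: ((a :: sa) ++ (b :: sb) ++ (c :: sc))).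

Lemma three_legs_rot v a sa b sb c sc :
  three_legs v a sa b sb c sc -> three_legs v b sb c sc a sa.
Proof.
move=> [[h1 h2 h3] [[f1 f2 f3] h]]; split; [|split] => // x.
by have := h x; rewrite !(in_cons, mem_cat); split_memberships.
Qed.

Lemma three_legs_swap v a sa b sb c sc :
  three_legs v a sa b sb c sc -> three_legs v b sb a sa c sc.
Proof.
move=> [[h1 h2 h3] [[f1 f2 f3] h]]; split; [|split] => //.
  by split; exact: far_sym.
by move=> x; have := h x; rewrite !(in_cons, mem_cat); split_memberships.
Qed.

Lemma three_legs_exist v a b c : three_neighbours v a b c ->
  exists sa sb sc, three_legs v a sa b sb c sc.
Proof.
move=> N3; have N3r := three_neighbours_rot N3; have N3rr := three_neighbours_rot N3r.
have [us ea eb ec] := N3.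
have [sa [ia na ta ca]] := leg N3; have [sb [ib nb tb cb]] := leg N3r.
have [sc [ic nc tc cc]] := leg N3rr.
have att x y z s : three_neighbours v x y z -> induced_path e v (x :: s) ->
    (forall u, u \in x :: s -> u \notin [:: v; y; z]) -> attached v x s.
  move=> N ip nx; split=> //.
  - by apply/negP => /nx; rewrite !inE eqxx.
  - by case: N.
  - move=> u us' /(three_neighbours_all N); rewrite !inE; have := nx u us'.
    by rewrite !inE !negb_or => /and3P[_ /negbTE-> /negbTE->]; rewrite !orbF => /eqP.
have farL x y z sx sy : three_neighbours v x y z ->
    (forall u, u \in x :: sx -> u \notin [:: v; y; z]) ->
    (forall u, u \in y :: sy -> u \notin [:: v; z; x]) ->
    (forall u, u \in sx -> [/\ e u v = false, e u y = false & e u z = false]) ->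
    (forall u w, u \in x :: sx -> e u w -> (w \in [:: v; y; z]) || (w \in x :: sx)) ->
    induced_path e v (y :: sy) -> far x sx y sy.
  move=> N nx ny tx cx [uy py].
  have tail u : u \in x :: sx -> u != x -> [/\ e u v = false, e u y = false & e u z = false].
    by rewrite inE => /orP[->//|/tx].
  (* The predecessor on the second leg of a common vertex lies on the first leg too, because [u]
     differs from [x] and so sees none of [v], [y], [z]. The descent ends at [y], which the first
     leg avoids. *)
  have dis u : u \in x :: sx -> u \in y :: sy -> False.
    move=> ux uy'.
    have [j jl uj] : exists2 j, (j < size (y :: sy))%N & nth v (y :: sy) j = u.
      by exists (index u (y :: sy)); rewrite ?index_mem ?nth_index.
    elim: j u jl uj ux {uy'} => [|j IH] u jl uj ux.
      by have := nx u ux; rewrite -uj /= !inE eqxx orbT.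
    have uy' : u \in y :: sy by rewrite -uj mem_nth.
    pose w := nth v (y :: sy) j.
    have wl : (j < size (y :: sy))%N by exact: ltnW.
    have euw : e u w by rewrite -uj py // /padj eqxx orbT.
    have ux' : u != x by have := ny u uy'; rewrite !inE !negb_or => /and3P[].
    have [h1 h2 h3] := tail u ux ux'.
    have := cx u w ux euw; rewrite !inE.
    case: eqP euw => [->|_] euw; first by rewrite h1 in euw.
    case: eqP euw => [->|_] euw; first by rewrite h2 in euw.
    case: eqP euw => [->|_] euw /=; first by rewrite h3 in euw.
    by move=> wx; apply: (IH w wl erefl); rewrite inE.
  split=> // u w ux wy euw.
  have wn := ny w wy; move: wn; rewrite !inE !negb_or => /and3P[wv wz wx].
  have wy' : w = y.
    have := cx u w ux euw; rewrite !inE (negbTE wv) (negbTE wz) orbF /=.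
    by case/orP => [/eqP//|wx']; case: (dis w); rewrite ?inE.
  split=> //; apply/eqP; apply: contraT => ux'.
  by have [_ h2 _] := tail u ux ux'; rewrite -wy' euw in h2.
exists sa, sb, sc; split; first by split; [exact: att N3 _ _|exact: att N3r _ _|exact: att N3rr _ _].
split; first by split; [exact: farL N3 _ _ _ _ _|exact: farL N3r _ _ _ _ _|exact: farL N3rr _ _ _ _ _].
pose A := [set u in v :: ((a :: sa) ++ (b :: sb) ++ (c :: sc))].
move=> x; suff : x \in A by rewrite inE.
apply: (conn_closed e_conn (in_setT v) (in_setT x)); first by rewrite !inE eqxx.
move=> u w _ _; rewrite !in_set in_cons !mem_cat => + euw.
case/orP => [/eqP uv|/or3P[uL|uL|uL]].
- rewrite uv in euw; have := three_neighbours_all N3 euw; rewrite !inE !mem_cat !inE.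
  by split_memberships.
- by have := ca u w uL euw; rewrite !inE !mem_cat !inE; split_memberships.
- by have := cb u w uL euw; rewrite !inE !mem_cat !inE; split_memberships.
- by have := cc u w uL euw; rewrite !inE !mem_cat !inE; split_memberships.
Qed.

(** The two other legs joined through [v] form the long path. The single vertex [z] of the third leg
    sees [v] and possibly [a], which precedes [v] on that path: a pendant vertex or a triangle. *)
Lemma three_legs_path v a sa b sb z : three_legs v a sa b sb z [::] ->
  e a b = false -> e b z = false -> path_plus_vertex e.
Proof.
move=> [[[ia va ea ha] [ib vb eb hb] [iz vz ez hz]] [[fab fbz fza] cov]] eab ebz.
have [ua pa] := ia; have [ub pb] := ib.
have ivb : induced_path e v ([:: v] ++ b :: sb).
  apply: (induced_path_cat e_sym (induced_path1 _ e_irr v) ib).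
    by move=> x; rewrite inE => /eqP->; apply/negP.
  move=> [|//] j _ jl /=; apply/idP/eqP => [/(hb _ (mem_nth _ jl)) h|->//].
  by apply/eqP; rewrite -(nth_head v ub jl) h.
pose s := rev (a :: sa) ++ ([:: v] ++ b :: sb).
have ips : induced_path e v s.
  apply: (induced_path_cat e_sym (induced_path_rev ia) ivb).
    move=> x; rewrite mem_rev mem_cat mem_seq1 => xa /orP[/eqP xv|xb]; first by rewrite xv in xa; rewrite xa in va.
    by case: fab => + _; apply; eassumption.
  move=> i j; rewrite size_rev => il jl; rewrite nth_rev //.
  have il' : (size (a :: sa) - i.+1 < size (a :: sa))%N by exact: rev_index_lt.
  case: j jl => [_|j jl] /=.
    rewrite andbT e_sym -[nth _ _ _]/(nth v (a :: sa) _); apply/idP/eqP.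
      by move=> /(ha _ (mem_nth _ il'))/eqP; rewrite nth_head // rev_index_eq0 // => /eqP.
    by move/eqP; rewrite -rev_index_eq0 // => /eqP ->.
  rewrite andbF; apply/negbTE/negP => h.
  have jl' : (j < size (b :: sb))%N by [].
  by have [h1 h2] := fab.2 _ _ (mem_nth v il') (mem_nth v jl') h; rewrite h1 h2 eab in h.
have zs : z \notin s.
  rewrite /s mem_cat mem_rev mem_cat mem_seq1; apply/negP => /or3P[h|/eqP h|h].
  - exact: fza.1 (mem_head _ _) h.
  - by have := vz; rewrite -h mem_head.
  - exact: fbz.1 h (mem_head _ _).
have ss : size s = ((size sa).+1 + (size sb).+2)%N by rewrite !size_cat size_rev.
have ezs i : (i < size s)%N -> e z (nth z s i) = (i == (size sa).+1) || (e z a && (i == size sa)).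
  rewrite ss => il; rewrite nth_cat size_rev /=; case: ltnP => i1.
    have ia1 : (i < size (a :: sa))%N by [].
    rewrite nth_rev //; have il' := rev_index_lt ia1.
    rewrite (ltn_eqF ia1) /=.
    apply/idP/andP => [h|[eza /eqP ->]]; last by rewrite /= subnn.
    have [_ h2] := fza.2 _ _ (mem_head _ _) (mem_nth z il') h.
    split; first by rewrite -h2.
    by move/eqP: h2; rewrite nth_head // rev_index_eq0.
  case E: (i - (size sa).+1)%N => [|j] /=.
    have -> : i = (size sa).+1 by apply/eqP; rewrite eqn_leq i1 andbT -subn_eq0 E.
    by rewrite eqxx e_sym ez.
  have i2 := sub_eqS E.
  rewrite (gtn_eqF i2) (gtn_eqF (ltnW i2)) ?andbF /=.
  have jl : (j < size (b :: sb))%N by move: il E; clear; rewrite /=; lia.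
  apply/negbTE/negP; rewrite e_sym => h.
  by have [h1 _] := fbz.2 _ _ (mem_nth z jl) (mem_head _ _) h; rewrite -h1 in ebz; rewrite ebz in h.
exists z, s; split; last first.
- case: (boolP (e z a)) => eza.
    constructor 2; exists (size sa); split; first by rewrite ss; clear; lia.
    by move=> i /ezs ->; rewrite eza orbC.
  constructor 1; exists (size sa).+1; split; first by right; rewrite ss; clear; lia.
  by move=> i /ezs ->; rewrite (negbTE eza) orbF.
- exact: induced_path_default ips.
- by move=> x; have := cov x; rewrite /s !(in_cons, mem_cat, mem_rev, in_nil); split_memberships.
- by rewrite cons_uniq zs; case: ips.
Qed.

(** A leg of one vertex reduces to [three_legs_path]. If [a b] is an edge and both legs there go on,
    the triangle [v], [a], [b] with [c] and the two second vertices is a net; three longer legs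
    without such an edge contain a spider. *)
Lemma three_legs_classify v a sa b sb c sc : three_legs v a sa b sb c sc ->
  e b c = false -> e a c = false -> path_plus_vertex e.
Proof.
move=> L ebc eac; have Lr := three_legs_rot L; have Lrr := three_legs_rot Lr.
have [ecb eca] : e c b = false /\ e c a = false by split; rewrite e_sym.
case: sa L Lr Lrr => [|a2 sa] L Lr Lrr.
  exact: three_legs_path Lr ebc eca.
case: sb L Lr Lrr => [|b2 sb] L Lr Lrr.
  by apply: three_legs_path (three_legs_swap Lrr) _ _; rewrite // e_sym.
case: (boolP (e a b)) => eab.
  exfalso; case: L => [[[ia va ea ha] [ib vb eb hb] [ic vc ec hc]] [[fab fbc fca] _]].
  have [ua pa] := ia; have [ub pb] := ib.
  have ma : a2 \in a :: a2 :: sa by rewrite !inE eqxx orbT.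
  have mb : b2 \in b :: b2 :: sb by rewrite !inE eqxx orbT.
  have aa2 : a2 != a by move: ua => /= /andP[+ _]; rewrite inE negb_or eq_sym => /andP[].
  have bb2 : b2 != b by move: ub => /= /andP[+ _]; rewrite inE negb_or eq_sym => /andP[].
  have ne x sx y sy p q : far x sx y sy -> p \in x :: sx -> q \in y :: sy -> p != q.
    by move=> [h _] px qy; apply: contraTneq px => ->; apply/negP => qx; exact: h qx qy.
  apply: (@no_net v a b c a2 b2) => //.
  - rewrite /= !inE !negb_or.
    have nv x s u : attached v x s -> u \in x :: s -> u != v.
      by move=> [_ vs _ _] us'; apply: contraNneq vs => <-.
    rewrite (ne _ _ _ _ _ _ fca (mem_head _ _) ma) (ne _ _ _ _ _ _ fca (mem_head _ _) (mem_head _ _)).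
    rewrite ![c == b2]eq_sym ![c == b]eq_sym (ne _ _ _ _ _ _ fbc mb (mem_head _ _)).
    rewrite (ne _ _ _ _ _ _ fbc (mem_head _ _) (mem_head _ _)) (ne _ _ _ _ _ _ fab ma mb).
    rewrite (ne _ _ _ _ _ _ fab ma (mem_head _ _)) aa2 bb2 ![b2 == a]eq_sym.
    rewrite (ne _ _ _ _ _ _ fab (mem_head _ _) mb) (ne _ _ _ _ _ _ fab (mem_head _ _) (mem_head _ _)).
    by rewrite !(eq_sym v) (eq_sym c v) !(eq_sym _ v) !(neq_edge ea) !(neq_edge eb) !(neq_edge ec)
       ?(eq_sym v) ?(nv _ _ _ _ ma) ?(nv _ _ _ _ mb).
  - by have := pa 0 1 isT isT.
  - by have := pb 0 1 isT isT.
  - apply/negbTE/negP => h; have [h1 _] := (far_sym fab).2 _ _ mb (mem_head _ _) h.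
    by rewrite h1 eqxx in bb2.
  - apply/negbTE/negP => h; have [h1 _] := fab.2 _ _ ma (mem_head _ _) h.
    by rewrite h1 eqxx in aa2.
  - apply/negbTE/negP => h; have [_ h1] := (far_sym fbc).2 _ _ (mem_head _ _) mb h.
    by rewrite h1 eqxx in bb2.
case: sc L Lr Lrr => [|c2 sc] L Lr Lrr.
  by apply: three_legs_path L _ _; rewrite // (negbTE eab).
exfalso; case: L => [[aa ab ac] [[fab fbc fca] _]].
have fac := far_sym fca.
have [[ia va ea ha] [ib vb eb hb] [ic vc ec hc]] := And3 aa ab ac.
have [[ua pa] [ub pb] [uc pc]] := And3 ia ib ic.
have second x y s : uniq (x :: y :: s) -> y != x.
  by move=> /= /andP[+ _]; rewrite inE negb_or eq_sym => /andP[].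
have ma : a2 \in a :: a2 :: sa by rewrite !inE eqxx orbT.
have mb : b2 \in b :: b2 :: sb by rewrite !inE eqxx orbT.
have mc : c2 \in c :: c2 :: sc by rewrite !inE eqxx orbT.
have [ma0 mb0 mc0] := And3 (mem_head a (a2 :: sa)) (mem_head b (b2 :: sb)) (mem_head c (c2 :: sc)).
have [aa2 bb2 cc2] := And3 (second _ _ _ ua) (second _ _ _ ub) (second _ _ _ uc).
have ne x sx y sy p q : far x sx y sy -> p \in x :: sx -> q \in y :: sy -> p != q.
  by move=> [h _] px qy; apply: contraTneq px => ->; apply/negP => qx; exact: h qx qy.
have nv x s u : attached v x s -> u \in x :: s -> u != v.
  by move=> [_ vs _ _] us'; apply: contraNneq vs => <-.
have nadj x sx y sy p : far x sx y sy -> p \in x :: sx -> p != x -> e p y = false.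
  move=> [_ h] px pnx; apply/negbTE/negP => epy.
  by have [h1 _] := h _ _ px (mem_head _ _) epy; rewrite h1 eqxx in pnx.
have nadjv x sx p : attached v x sx -> p \in x :: sx -> p != x -> e p v = false.
  move=> [_ _ _ h] px pnx; apply/negbTE/negP; rewrite e_sym => epv.
  by rewrite (h _ px epv) eqxx in pnx.
apply: (@no_spider v a a2 b b2 c c2) => //.
- by rewrite /= !inE !negb_or aa2 (ne _ _ _ _ _ _ fab ma mb) (ne _ _ _ _ _ _ fab ma mb0) (ne _ _ _ _ _ _ fac ma mc) (ne _ _ _ _ _ _ fac ma mc0) (nv _ _ _ aa ma) (ne _ _ _ _ _ _ fab ma0 mb) (ne _ _ _ _ _ _ fab ma0 mb0) (ne _ _ _ _ _ _ fac ma0 mc) (ne _ _ _ _ _ _ fac ma0 mc0) (nv _ _ _ aa ma0) bb2 (ne _ _ _ _ _ _ fbc mb mc) (ne _ _ _ _ _ _ fbc mb mc0) (nv _ _ _ ab mb) (ne _ _ _ _ _ _ fbc mb0 mc) (ne _ _ _ _ _ _ fbc mb0 mc0) (nv _ _ _ ab mb0) cc2 (nv _ _ _ ac mc) (nv _ _ _ ac mc0).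
- by have := pa 0 1 isT isT.
- by have := pb 0 1 isT isT.
- by have := pc 0 1 isT isT.
- exact: nadjv aa ma aa2.
- exact: nadj fab ma aa2.
- exact: nadj fac ma aa2.
- exact: nadjv ab mb bb2.
- exact: nadj (far_sym fab) mb bb2.
- exact: nadj fbc mb bb2.
- exact: nadjv ac mc cc2.
- exact: nadj fca mc cc2.
- exact: nadj (far_sym fbc) mc cc2.
Qed.

Lemma degree_three v a b c : three_neighbours v a b c -> path_plus_vertex e.
Proof.
move=> N3; have [sa [sb [sc L]]] := three_legs_exist N3.
have Nr := three_neighbours_rot N3; have Nrr := three_neighbours_rot Nr.
case: (boolP (e a b)) => [eab|/negbTE eab].
  have ebc : e b c = false by apply/negbTE/negP => ebc; exact: triangle_edges N3 eab ebc.
  have eac : e a c = false.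
    by apply/negbTE/negP => eac; apply: (triangle_edges Nrr _ eab); rewrite e_sym.
  exact: three_legs_classify L ebc eac.
case: (boolP (e b c)) => [ebc|/negbTE ebc].
  have eca : e c a = false by apply/negbTE/negP => eca; exact: triangle_edges Nr ebc eca.
  by apply: (three_legs_classify (three_legs_rot L) eca); rewrite e_sym.
by apply: (three_legs_classify (three_legs_rot (three_legs_rot L)) eab); rewrite e_sym.
Qed.

(** A vertex with at most one neighbour starts a path through the whole graph. Otherwise all degrees
    are two: deleting [v] leaves a path from [a] whose last vertex [r] needs a second neighbour, and
    only [v] is left. *)
Lemma degree_two : (forall v a b c, ~ three_neighbours v a b c) -> path_plus_vertex e.
Proof.
move=> no3.
have no3' v x y w : e v x -> e v y -> e v w -> x != y -> (w == x) || (w == y).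
  move=> vx vy vw xy; apply: contraT; rewrite negb_or => /andP[wx wy].
  by case: (no3 v w x y); split=> //; rewrite /= !inE !negb_or wx wy xy.
pose P (R : {set 'I_n}) a := forall x y, x \in R -> y \in R -> e a x -> e a y -> x = y.
have P1 R a x y : P R a -> a \in R -> x \in R -> y \in R -> e a x -> e a y -> x = y.
  by move=> h _; exact: h.
have P2 R a a' : P R a -> a \in R -> a' \in R -> e a a' -> P (R :\ a) a'.
  move=> _ aR a'R eaa' x y; rewrite !inE => /andP[xa xR] /andP[ya yR] ex ey.
  have ea'a : e a' a by rewrite e_sym.
  have := no3' a' a x y ea'a ex ey; rewrite eq_sym xa (negbTE ya) /= => /(_ isT)/eqP->.
  by [].
have [/existsP[v /forallP Hv]|v2] :=
    boolP [exists v, [forall x, [forall y, e v x ==> e v y ==> (x == y)]]].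
  have PT : P [set: 'I_n] v.
    by move=> x y _ _ ex ey; have /forallP/(_ y) := Hv x; rewrite ex ey => /eqP.
  have [s [ips sT _]] := leg_path v e_sym e_irr P1 P2 (in_setT v) e_conn PT.
  have [us hs] := ips.
  exists v, s; split=> //; first by move=> x; rewrite sT inE.
    split; first by case/andP: us.
    by move=> i j il jl; have := hs i.+1 j.+1 il jl.
  constructor 1; exists 0; split; first by case: (s); [left|right].
  by move=> i il; have := hs 0 i.+1 isT il; rewrite /padj orbF eqSS eq_sym.
have two v : exists a b, [/\ a != b, e v a & e v b].
  have := v2; rewrite negb_exists => /forallP/(_ v); rewrite negb_forall => /existsP[x].
  rewrite negb_forall => /existsP[y]; rewrite !negb_imply => /and3P[h1 h2 h3].
  by exists x, y.
pose v := Ordinal n0; have [a [b [ab va vb]]] := two v.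
have av : e a v by rewrite e_sym.
have aN : a \notin [:: v] by rewrite inE neq_edge.
have [R [aR RN Rcl cR]] := component aN.
have PR : P R a.
  move=> x y xR yR ex ey; have := RN x xR; have := RN y yR; rewrite !inE => yv xv.
  have := no3' a v x y av ex ey; rewrite eq_sym xv (negbTE yv) /= => /(_ isT)/eqP->.
  by [].
have [s [ips sR _]] := leg_path v e_sym e_irr P1 P2 aR cR PR.
have [us hs] := ips.
pose r := nth v (a :: s) (size s).
have sl : (size s < size (a :: s))%N by [].
have rR : r \in R by rewrite -sR mem_nth.
have rn w : e r w -> w != v -> exists2 j, j.+1 = size s & w = nth v (a :: s) j.
  move=> erw wv; have := Rcl r w rR erw; rewrite inE (negbTE wv) /= -sR => wR.
  have jl : (index w (a :: s) < size (a :: s))%N by rewrite index_mem.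
  have := hs _ _ sl jl; rewrite -/r nth_index // erw /padj => /esym/orP[/eqP E|/eqP E].
    by move: jl; rewrite -E ltnn.
  by exists (index w (a :: s)); rewrite ?nth_index.
have erv : e r v.
  have [p [q [pq rp rq]]] := two r.
  have [<-//|pv] := eqVneq p v; have [<-//|qv] := eqVneq q v.
  have [j ej pj] := rn p rp pv; have [j' ej' qj] := rn q rq qv.
  by move: pq; rewrite pj qj; move: ej; rewrite -ej' => -[->]; rewrite eqxx.
have s0 : (0 < size s)%N.
  rewrite lt0n; apply/eqP => s0; have [p [q [pq rp rq]]] := two r.
  have nov w : e r w -> w = v.
    by move=> rw; apply/eqP; apply: contraT => wv; have [j] := rn w rw wv; rewrite s0.
  by rewrite (nov p rp) (nov q rq) eqxx in pq.
have ra : a != r by rewrite eq_sym /r (nth_head v us sl) -lt0n.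
have vr : e v r by rewrite e_sym.
have vn w : e v w -> (w == a) || (w == r) by move=> vw; exact: no3' va vr vw ra.
exists v, (a :: s); split.
- by rewrite cons_uniq us andbT; apply/negP; rewrite sR => /RN; rewrite inE eqxx.
- move=> x; suff : x \in v |: R by rewrite !inE -sR inE.
  apply: (conn_closed e_conn (in_setT v) (in_setT x)); first by rewrite !inE eqxx.
  move=> u w _ _; rewrite !in_setU1 => /orP[/eqP->|uR] euw.
    by case/orP: (vn w euw) => /eqP->; rewrite ?aR ?rR orbT.
  by have := Rcl u w uR euw; rewrite inE.
- exact: ips.
constructor 3; split; first by [].
move=> i il; apply/idP/orP => [/vn/orP[|]|[|]].
- by rewrite nth_head //; left.
- by rewrite /r nth_uniq // => h; right; rewrite eqSS.
- by move/eqP->.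
- by rewrite eqSS => /eqP->.
Qed.

Theorem classification : path_plus_vertex e.
Proof.
have [/existsP[v /existsP[a /existsP[b /existsP[c /and4P[us ea eb ec]]]]]|h] :=
  boolP [exists v, exists a, exists b, exists c, [&& uniq [:: a; b; c], e v a, e v b & e v c]].
  by apply: (@degree_three v a b c).
apply: degree_two => v a b c [us ea eb ec]; case/negP: h.
by apply/existsP; exists v; apply/existsP; exists a; apply/existsP; exists b;
  apply/existsP; exists c; apply/and4P.
Qed.
End Classification.

(** * Connected subsets of a path with one extra vertex *)

Lemma maximal_run (A : pred nat) M t : (t < M)%N -> A t -> exists a b,
  [/\ (a <= t < b)%N, (b <= M)%N, forall j, (a <= j < b)%N -> A j,
      (0 < a)%N -> ~~ A a.-1 & (b < M)%N -> ~~ A b].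
Proof.
move=> tM At.
have [a [at_ Aa a0]] : exists a, [/\ (a <= t)%N, forall j, (a <= j <= t)%N -> A j & (0 < a)%N -> ~~ A a.-1].
  clear tM; elim: t At => [|t IH] At.
    by exists 0%N; split=> // j; rewrite leqn0 => /eqP->.
  have [At'|At'] := boolP (A t).
    have [a [at_ Aa a0]] := IH At'; exists a; split=> //; first exact: leq_trans at_ _.
    by move=> j ajt; have [->//|jt] := eqVneq j t.+1; apply: Aa; lia.
  exists t.+1; split=> // j /andP[h1 h2].
  by have -> : j = t.+1 by lia.
have [b [tb bM Ab b0]] : exists b, [/\ (t < b)%N, (b <= M)%N, forall j, (t <= j < b)%N -> A j & (b < M)%N -> ~~ A b].
  move: {2}(M - t.+1)%N (erefl (M - t.+1)%N) => d; elim: d t tM At {at_ Aa} => [|d IH] t tM At ed.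
    exists t.+1; split=> //; last by lia.
    by move=> j h; have -> : j = t by lia.
  have [At'|At'] := boolP (A t.+1).
    have [||b [tb bM Ab b0]] := IH t.+1 _ At'; [lia|lia|exists b; split=> //; first by lia].
    move=> j h; have [->//|jt] := eqVneq j t; apply: Ab; lia.
  exists t.+1; split=> // j h; have -> : j = t by lia.
  by [].
exists a, b; split=> //; first by rewrite at_.
by move=> j /andP[h1 h2]; case: (leqP j t) => h; [apply: Aa|apply: Ab]; rewrite ?h1 ?h2 ?h ?(ltnW h).
Qed.

Section PathPlusVertex.
Variables (n : nat) (e : rel 'I_n) (z : 'I_n) (s : seq 'I_n).
Hypothesis e_sym : symmetric e.
Hypothesis e_irr : irreflexive e.
Hypothesis zs_uniq : uniq (z :: s).
Hypothesis zs_cover : forall x, x \in z :: s.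
Hypothesis s_path : induced_path e z s.
Notation conn := (induced_connected e).
Notation M := (size s).
Implicit Types (I : {set 'I_n}) (x : 'I_n) (a b t i j k : nat).

Definition segment a b : {set 'I_n} := [set x | (x \in s) && (a <= index x s < b)%N].

Let s_uniq : uniq s. Proof. by case/andP: zs_uniq. Qed.
Let zNs : z \notin s. Proof. by case/andP: zs_uniq. Qed.

Lemma mem_nth_interval a b t : (t < M)%N -> (nth z s t \in segment a b) = (a <= t < b)%N.
Proof. by move=> tM; rewrite inE mem_nth // index_uniq. Qed.

Lemma z_notin_interval a b : z \notin segment a b.
Proof. by rewrite inE (negbTE zNs). Qed.

Lemma vertexP x : x = z \/ exists2 t, (t < M)%N & x = nth z s t.
Proof.
have := zs_cover x; rewrite inE => /orP[/eqP|xs]; [by left|right].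
by exists (index x s); rewrite ?index_mem // nth_index.
Qed.

Lemma nth_neq_z t : (t < M)%N -> (nth z s t == z) = false.
Proof. by move=> tM; apply: contraNF zNs => /eqP <-; rewrite mem_nth. Qed.

Lemma interval0 a : segment a a = set0.
Proof. by apply/setP => x; rewrite !inE; case: (x \in s) => //=; clear; lia. Qed.

Lemma interval_recr a b : (a <= b < M)%N -> segment a b.+1 = nth z s b |: segment a b.
Proof.
move=> /andP[ab bM]; apply/setP => x; case: (vertexP x) => [->|[t tM ->]].
  by rewrite in_setU1 !(negbTE (z_notin_interval _ _)) eq_sym nth_neq_z.
by rewrite in_setU1 !mem_nth_interval // nth_uniq //; lia.
Qed.

Lemma conn_interval a b : (a <= b <= M)%N -> conn (segment a b).
Proof.
elim: b => [|b IH] /andP[]; rewrite leq_eqVlt => /orP[/eqP<- _|//].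
  by rewrite interval0 => x y; rewrite inE.
- by rewrite interval0 => x y; rewrite inE.
rewrite ltnS => ab bM; rewrite interval_recr ?ab //.
have [->|ab'] := eqVneq a b; first by rewrite interval0 setU0; exact: conn1.
apply: (@conn_add _ e e_sym _ _ (nth z s b.-1)).
- by apply: IH; rewrite ab ltnW.
- by rewrite mem_nth_interval; lia.
by rewrite s_path.2 /padj; lia.
Qed.

Lemma conn_interval_z a b t : (a <= t < b)%N -> (b <= M)%N -> e z (nth z s t) ->
  conn (z |: segment a b).
Proof.
move=> tab bM ezt; apply: (conn_add e_sym _ _ ezt).
  by apply: conn_interval; lia.
by rewrite mem_nth_interval //; lia.
Qed.

Lemma conn_interval_z2 a b : (a <= b <= M)%N -> (0 < M)%N -> e z (nth z s 0) -> e z (nth z s M.-1) ->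
  conn (z |: (segment 0 a :|: segment b M)).
Proof.
move=> ab M0 e0 e1; have c0 : conn (z |: segment 0 a).
  case: (posnP a) => [->|a0]; first by rewrite interval0 setU0; exact: conn1.
  by apply: (conn_interval_z (t := 0%N)) => //; lia.
have [->|bM] := eqVneq b M; first by rewrite interval0 setU0.
rewrite setUA; apply: (connU e_sym c0 _ (setU11 _ _) _ e1); first by apply: conn_interval; lia.
by rewrite mem_nth_interval; lia.
Qed.

Lemma arr_index_interval a b : (a < b <= M)%N -> arr_index e (segment a b).
Proof.
move=> ab; split; last by apply: conn_interval; lia.
by apply/set0Pn; exists (nth z s a); rewrite mem_nth_interval; lia.
Qed.

Lemma arr_index_z I : conn (z |: I) -> arr_index e (z |: I).
Proof. by split=> //; apply/set0Pn; exists z; rewrite setU11. Qed.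

(* no edge of I leaves a maximal run of its path vertices except towards z *)
Lemma run_closed I a b t x : (b <= M)%N ->
  ((0 < a)%N -> nth z s a.-1 \notin I) -> ((b < M)%N -> nth z s b \notin I) ->
  (a <= t < b)%N -> x \in I -> e (nth z s t) x -> x != z -> x \in segment a b.
Proof.
move=> bM ha hb tab xI; case: (vertexP x) xI => [->|[j jM ->]]; first by rewrite eqxx.
move=> jI; rewrite s_path.2 //; last by lia.
move=> adj _; rewrite mem_nth_interval //.
have ja : (0 < a)%N -> j != a.-1 by move=> /ha; apply: contraNneq => <-.
have jb : (b < M)%N -> j != b by move=> /hb; apply: contraNneq => <-.
move: adj ja jb; rewrite /padj; clear -tab jM bM; lia.
Qed.

Lemma conn_shape I : arr_index e I -> z \notin I ->
  exists a b, (a < b <= M)%N /\ I = segment a b.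
Proof.
move=> [/set0Pn[x xI] cI] zI; case: (vertexP x) (xI) => [xz|[t tM ->] tI].
  by rewrite -xz xI in zI.
have [a [b [tab bM Aab ha hb]]] := maximal_run (A := fun j => nth z s j \in I) tM tI.
exists a, b; split; first by lia.
have Nz y : y \in I -> y != z by apply: contraTneq => ->.
apply/eqP; rewrite eqEsubset; apply/andP; split; apply/subsetP => y yI.
  apply: (conn_closed cI tI yI); first by rewrite mem_nth_interval.
  move=> u v uI vI; case: (vertexP u) uI => [->|[j jM ->] uI]; first by rewrite (negbTE zI).
  by rewrite mem_nth_interval // => jab euv; apply: (run_closed bM ha hb jab vI euv (Nz v vI)).
case: (vertexP y) yI => [->|[j jM ->]]; first by rewrite (negbTE (z_notin_interval _ _)).
by rewrite mem_nth_interval //; exact: Aab.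
Qed.

Lemma conn_shape_z I : arr_index e I -> z \in I ->
  (forall i j, (i < M)%N -> (j < M)%N -> e z (nth z s i) -> e z (nth z s j) -> (i <= j.+1)%N) ->
  I = z |: segment 0 0 \/
  exists a b t, [/\ (a <= t < b)%N, (b <= M)%N, e z (nth z s t) & I = z |: segment a b].
Proof.
move=> [_ cI] zI att.
have [/exists_inP[x xI ezx]|/exists_inPn noe] := boolP [exists x in I, e z x]; last first.
  left; rewrite interval0 setU0; apply/eqP; rewrite eqEsubset sub1set zI andbT.
  apply/subsetP => y yI; apply: (conn_closed cI zI yI (set11 z)).
  by move=> u v _ vI; rewrite inE => /eqP->; rewrite (negbTE (noe v vI)).
case: (vertexP x) xI ezx => [->|[t tM ->] tI ezt]; first by rewrite e_irr.
have [a [b [tab bM Aab ha hb]]] := maximal_run (A := fun j => nth z s j \in I) tM tI.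
right; exists a, b, t; split=> //.
apply/eqP; rewrite eqEsubset; apply/andP; split; apply/subsetP => y yI.
  apply: (conn_closed cI zI yI (setU11 _ _)) => u v _ vI; rewrite !in_setU1.
  have [//|vz] := eqVneq v z.
  case: (vertexP u) => [->|[j jM ->]]; last first.
    by rewrite nth_neq_z //= mem_nth_interval // => jab euv; apply: (run_closed bM ha hb jab vI euv).
  move=> _; case: (vertexP v) vI vz => [->|[j jM ->] jI _ ezj]; first by rewrite eqxx.
  have jt := att _ _ jM tM ezj ezt; have tj := att _ _ tM jM ezt ezj.
  have [->|jt'] := eqVneq j t; first by rewrite mem_nth_interval.
  apply: (run_closed bM ha hb tab jI _ _); last by rewrite nth_neq_z.
  by rewrite s_path.2 // /padj; lia.
case: (vertexP y) yI => [->//|[j jM ->]].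
by rewrite in_setU1 nth_neq_z //= mem_nth_interval //; exact: Aab.
Qed.

(** On a cycle the complement of a connected set containing [z] is an interval; [a] is its first
    missing position and [b] the one after its last. *)
Lemma conn_shape_z2 I : arr_index e I -> z \in I ->
  (forall i, (i < M)%N -> e z (nth z s i) -> (i == 0) || (i.+1 == M)) ->
  exists a b, (a <= b <= M)%N /\ I = z |: (segment 0 a :|: segment b M).
Proof.
move=> [_ cI] zI att.
have [/forallP allI|] := boolP [forall x, x \in I].
  exists M, M; split; first by rewrite leqnn.
  apply/setP => x; rewrite allI !inE; case: (vertexP x) => [->|[t tM ->]]; first by rewrite eqxx.
  by rewrite mem_nth // index_uniq //=; lia.
rewrite negb_forall => /existsP[x]; case: (vertexP x) => [->|[t tM ->] tI]; first by rewrite zI.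
pose A := fun j => (nth z s j \notin I) && (j < M)%N.
have exA : exists j, A j by exists t; rewrite /A tI tM.
have Ab j : A j -> (j <= M)%N by move=> /andP[_ /ltnW].
case: (ex_minnP exA) => a /andP[aI aM] amin.
case: (ex_maxnP exA Ab) => b /andP[bI bM] bmax.
have ab : (a <= b)%N by apply: amin; rewrite /A bI.
exists a, b.+1; split; first by lia.
have mem j : (j < M)%N -> (nth z s j \in z |: (segment 0 a :|: segment b.+1 M)) = (j < a)%N || (b < j)%N.
  by move=> jM; rewrite in_setU1 in_setU nth_neq_z // !mem_nth_interval //; lia.
apply/eqP; rewrite eqEsubset; apply/andP; split; apply/subsetP => y yI.
  apply: (conn_closed cI zI yI (setU11 _ _)) => u v uI vI.
  case: (vertexP v) vI => [->|[j jM ->] jI]; first by rewrite setU11.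
  have ja : j != a by apply: contraTneq jI => ->.
  have jb : j != b by apply: contraTneq jI => ->.
  case: (vertexP u) uI => [->|[i iM ->] iI].
    move=> _ _ ezj; have h := att j jM ezj; rewrite mem //; clear -h ja jb aM bM ab jM; lia.
  rewrite !mem // s_path.2 // /padj => h1 h2.
  clear -h1 h2 ja jb ab; lia.
case: (vertexP y) yI => [->//|[j jM ->]].
rewrite mem // => h; apply: contraT => jI; have Aj : A j by rewrite /A jI.
by have := amin _ Aj; have := bmax _ Aj; lia.
Qed.
End PathPlusVertex.

Local Open Scope ring_scope.

(** * Layered Shi arrangements over an integral domain *)

Section Divisibility.
Variable S : idomainType.
Implicit Types (p q x y : S) (E : {poly S}).

Definition divides p x : Prop := exists y, x = p * y.
Definition prime_elt p : Prop := p != 0 /\ forall x y, divides p (x * y) -> divides p x \/ divides p y.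

Lemma dividesD p x y : divides p x -> divides p y -> divides p (x + y).
Proof. by move=> [a ->] [b ->]; exists (a + b); rewrite mulrDr. Qed.

Lemma dividesN p x : divides p x -> divides p (- x).
Proof. by move=> [a ->]; exists (- a); rewrite mulrN. Qed.

Lemma dividesB p x y : divides p x -> divides p y -> divides p (x - y).
Proof. by move=> px py; apply: dividesD => //; exact: dividesN. Qed.

Lemma divides_mulr p x y : divides p x -> divides p (x * y).
Proof. by move=> [a ->]; exists (a * y); rewrite mulrA. Qed.

Lemma divides_mull p x y : divides p y -> divides p (x * y).
Proof. by rewrite mulrC; exact: divides_mulr. Qed.

Lemma divides0 p : divides p 0.
Proof. by exists 0; rewrite mulr0. Qed.

Lemma divides_refl p : divides p p.
Proof. by exists 1; rewrite mulr1. Qed.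

Lemma divides_horner E x y : divides (x - y) (E.[x] - E.[y]).
Proof.
have [q Eq] : exists q : {poly S}, E - E.[y]%:P = q * ('X - y%:P).
  by apply/factor_theorem; rewrite /root !hornerE subrr.
exists q.[x]; have := congr1 (horner^~ x) Eq.
by rewrite !hornerE mulrC.
Qed.

(** Takes the place of unique factorization: once [q k] is cancelled, the other primes still divide
    the cofactor because none of them divides [q k]. *)
Lemma divides_prod (q : nat -> S) (s : seq nat) x : uniq s ->
  (forall k, k \in s -> prime_elt (q k) /\ divides (q k) x) ->
  (forall k k', k \in s -> k' \in s -> k != k' -> ~ divides (q k) (q k')) ->
  divides (\prod_(k <- s) q k) x.
Proof.
elim: s x => [|k s IH] x /=; first by exists x; rewrite big_nil mul1r.
move=> /andP[ks us] H1 H2.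
have [_ [y xy]] := H1 k (mem_head _ _).
have [||y' Ey] := IH y us; last by exists y'; rewrite big_cons xy Ey; ring.
  move=> k' k's; have k'in : k' \in k :: s by rewrite inE k's orbT.
  have [[p0 p'] d'] := H1 k' k'in; split=> //; move: d'; rewrite xy => /p'[d|//].
  by case: (H2 k' k k'in (mem_head _ _)) => //; apply: contraNneq ks => <-.
by move=> a b a_s b_s; apply: H2; rewrite inE ?a_s ?b_s orbT.
Qed.
End Divisibility.

Section LayeredShi.
Variables (S : idomainType) (v : nat -> S) (lam : nat -> nat) (T : S) (N : nat).
Implicit Types (E : {poly S}) (i k a m : nat).

Let u i := v i - T.
Let p i k := u i - v k.

Hypothesis lam_mono : forall i k, (i <= k)%N -> (lam i <= lam k)%N.
Hypothesis p_prime : forall i k, (i < k < N)%N -> lam i != lam k -> prime_elt (p i k).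
Hypothesis p_coprime : forall i k j l, (i < k < N)%N -> lam i != lam k -> (j < l < N)%N -> lam j != lam l ->
  (i, k) != (j, l) -> ~ divides (p i k) (p j l).

(** Modulo [v i - T - v k] the node [v i] becomes [v k + T], so [Phi(v i) - Phi(v k)] becomes
    [T E(v k)]. This is what remains to be imposed on [E], here for the nodes
    [a, ..., a + m - 1]. *)
Definition shi_condition a m E : Prop :=
  forall i k, (a <= i < k)%N -> (k < a + m)%N -> lam i != lam k -> divides (p i k) E.[v k].

(** Roots settle the nodes from [a.+2] on; at [a.+1] a scalar replaces the root, which keeps the
    degree at most [m]. The value at [u a] is the product of the primes [p a k], and this product
    divides the value at [u a] of every [E] satisfying the conditions. *)
Definition shi_first a m : {poly S} :=
  (\prod_(k <- index_iota a.+2 (a + m.+2) | lam a != lam k) ('X - (v k)%:P)) *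
    (if lam a != lam a.+1 then p a a.+1 else 1)%:P.

(** At [v k] the factor ['X - u a] takes the value [- p a k], so it settles all conditions with
    [i = a] and leaves those of the nodes from [a.+1] on. There is one element fewer than there are
    nodes. *)
Fixpoint shi_basis a m : seq {poly S} :=
  if m is m'.+1 then
    (if m' is m''.+1 then shi_first a m'' :: [seq ('X - (u a)%:P) * D | D <- shi_basis a.+1 m']
     else [::])
  else [::].

Lemma size_shi_basis a m : size (shi_basis a m) = m.-1.
Proof. by elim: m a => [//|[//|m] IH] a; rewrite [LHS]/= size_map IH. Qed.

Lemma shi_first_u a m : (a + m.+2 <= N)%N ->
  (shi_first a m).[u a] = \prod_(k <- index_iota a.+1 (a + m.+2) | lam a != lam k) p a k.
Proof.
move=> aN; rewrite /shi_first hornerM hornerC horner_prod.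
rewrite [RHS]big_ltn_cond; last by rewrite !addnS !ltnS leq_addr.
have -> : \prod_(k <- index_iota a.+2 (a + m.+2) | lam a != lam k) ('X - (v k)%:P).[u a] =
   \prod_(k <- index_iota a.+2 (a + m.+2) | lam a != lam k) p a k.
  by apply: eq_bigr => k _; rewrite !hornerE.
by case: ifP => _; rewrite ?mulr1 // mulrC.
Qed.

Lemma size_shi_first a m : (size (shi_first a m) <= m.+1)%N.
Proof.
rewrite /shi_first mulrC mul_polyC; apply: leq_trans (size_scale_leq _ _) _.
rewrite -big_filter size_prod_XsubC ltnS size_filter.
by apply: leq_trans (count_size _ _) _; rewrite size_iota !addnS !subSS addKn.
Qed.

Lemma shi_basis_condition a m D : (a + m <= N)%N -> D \in shi_basis a m ->
  (size D <= m.-1)%N /\ shi_condition a m D.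
Proof.
elim: m a D => [//|[//|m] IH] a D aN; rewrite inE => /orP[/eqP ->|].
  split; first exact: size_shi_first.
  move=> i k /andP[ai ik] ka lik; rewrite /shi_first hornerM hornerC.
  have lak : lam a != lam k.
    by apply: contra_neq lik => e; apply/eqP; rewrite eqn_leq lam_mono ?(ltnW ik) // -e lam_mono.
  have [ak|ak] := ltnP a.+1 k.
    rewrite horner_prod -big_filter (bigD1_seq k) /=; first by rewrite !hornerE subrr mul0r mul0r; exact: divides0.
      by rewrite mem_filter lak mem_index_iota ak.
    by rewrite filter_uniq ?iota_uniq.
  have ia : i = a by apply/eqP; rewrite eqn_leq ai andbT -ltnS; exact: leq_trans ik ak.
  have {ak}ek : k = a.+1 by apply/eqP; rewrite eqn_leq ak -ia.
  by rewrite -ek lak ia; apply: divides_mull; exact: divides_refl.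
case/mapP => D' D'in ->; have [sD cD] := IH a.+1 D' (leq_trans (eq_leq (addSnnS _ _)) aN) D'in.
split.
  apply: leq_trans (size_polyMleq _ _) _; rewrite size_XsubC /=.
  exact: leq_ltn_trans sD _.
move=> i k /andP[ai ik] ka lik; rewrite hornerM !hornerE.
have [ea|na] := eqVneq i a.
  by apply: divides_mulr; rewrite ea -opprB; apply: dividesN; exact: divides_refl.
apply: divides_mull; apply: cD => //; last by rewrite addSnnS.
by rewrite ik andbT ltn_neqAle eq_sym na.
Qed.

Lemma nth_shi_basisS a m j : (j < m)%N ->
  (shi_basis a m.+2)`_j.+1 = ('X - (u a)%:P) * (shi_basis a.+1 m.+1)`_j.
Proof.
move=> jm; have js : (j < size (shi_basis a.+1 m.+1))%N by rewrite size_shi_basis.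
exact: (nth_map 0 0 (fun D => ('X - (u a)%:P) * D) js).
Qed.

(** A multiple of [shi_first] removes the value at [u a]; dividing by ['X - u a] then lowers both
    the degree and the number of nodes. *)
Lemma shi_basis_span a m E : (a + m <= N)%N -> (size E <= m.-1)%N -> shi_condition a m E ->
  exists c : nat -> S, E = \sum_(j < m.-1) c j *: (shi_basis a m)`_j.
Proof.
elim: m a E => [|[|m] IH] a E aN sE cE.
- by exists (fun=> 0); rewrite big_ord0; apply/eqP; rewrite -size_poly_leq0.
- by exists (fun=> 0); rewrite big_ord0; apply/eqP; rewrite -size_poly_leq0.
pose s := [seq k <- index_iota a.+1 (a + m.+2) | lam a != lam k].
have sP k : k \in s -> [/\ (a < k < N)%N, (k < a + m.+2)%N & lam a != lam k].
  rewrite mem_filter mem_index_iota => /and3P[lak ak kam]; split=> //.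
  by rewrite ak (leq_trans kam).
have [c Ec] : divides (shi_first a m).[u a] E.[u a].
  rewrite shi_first_u // -big_filter; apply: divides_prod; first by rewrite filter_uniq ?iota_uniq.
    move=> k /sP[ak kam lak]; split; first exact: p_prime.
    rewrite -(subrK E.[v k] E.[u a]); apply: dividesD; first exact: divides_horner.
    by apply: cE => //; case/andP: ak => -> _; rewrite leqnn.
  move=> k k' /sP[ak _ lak] /sP[ak' _ lak'] kk'; apply: p_coprime => //.
  by apply: contra_neq kk' => -[].
have [E' EE'] : exists E' : {poly S}, E - c *: shi_first a m = E' * ('X - (u a)%:P).
  by apply/factor_theorem; rewrite /root hornerD hornerN hornerZ Ec (mulrC c) subrr.
have sE' : (size E' <= m)%N.
  have [->|E'0] := eqVneq E' 0; first by rewrite size_poly0.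
  have : (size (E' * ('X - (u a)%:P))%R <= m.+1)%N.
    rewrite -EE'; apply: leq_trans (size_polyD _ _) _; rewrite size_polyN geq_max sE /=.
    by apply: leq_trans (size_scale_leq _ _) _; exact: size_shi_first.
  by rewrite size_Mmonic ?monicXsubC // size_XsubC addn2.
(* The conditions survive the division because the prime [p i k] does not divide the value [- p a k]
   of the divisor at [v k]. *)
have cE' : shi_condition a.+1 m.+1 E'.
  move=> i k /andP[ai ik] ka lik; rewrite addSnnS in ka.
  have ikN : (i < k < N)%N by rewrite ik (leq_trans ka).
  have akN : (a < k < N)%N by case/andP: ikN => _ ->; rewrite (ltn_trans ai ik).
  have : divides (p i k) (E' * ('X - (u a)%:P)).[v k].
    rewrite -EE' hornerD hornerN hornerZ; apply: dividesB; first by apply: cE => //; rewrite (ltnW ai).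
    apply: divides_mull.
    have [_ cF] := @shi_basis_condition a m.+2 (shi_first a m) aN (mem_head _ _).
    by apply: cF => //; rewrite (ltnW ai).
  rewrite !hornerE => /((p_prime ikN lik).2 _ _)[//|d].
  have lak : lam a != lam k.
    by apply: contra_neq lik => h; apply/eqP; rewrite eqn_leq lam_mono ?(ltnW ik) // -h lam_mono // ltnW.
  case: (@p_coprime i k a k ikN lik akN lak); first by apply/eqP => -[ia]; rewrite ia ltnn in ai.
  have -> : p a k = - (v k - u a) by rewrite opprB.
  exact: dividesN.
have [c' Ec'] := IH a.+1 E' (leq_trans (eq_leq (addSnnS _ _)) aN) sE' cE'.
exists (fun j => if j is j'.+1 then c' j' else c).
rewrite big_ord_recl -[LHS](subrK (c *: shi_first a m)) EE' addrC; congr (_ + _).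
rewrite {1}Ec' mulr_suml; apply: eq_bigr => j _.
by rewrite lift0 nth_shi_basisS // -scalerAl mulrC.
Qed.

(** The basis is triangular: at [u a] every element but the first vanishes. *)
Lemma shi_basis_indep a m (c : nat -> S) : (a + m <= N)%N ->
  \sum_(j < m.-1) c j *: (shi_basis a m)`_j = 0 -> forall j, (j < m.-1)%N -> c j = 0.
Proof.
elim: m a c => [//|[//|m] IH] a c aN; rewrite big_ord_recl.
have -> : \sum_(i < m) c (lift ord0 i) *: (shi_basis a m.+2)`_(lift ord0 i) =
  ('X - (u a)%:P) * \sum_(i < m) c i.+1 *: (shi_basis a.+1 m.+1)`_i.
  by rewrite mulr_sumr; apply: eq_bigr => i _; rewrite lift0 nth_shi_basisS // -scalerAr.
rewrite -[(shi_basis a m.+2)`_ord0]/(shi_first a m) => H.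
have c0 : c 0%N = 0.
  have := congr1 (horner^~ (u a)) H; rewrite hornerD hornerZ (hornerM ('X - _)) hornerXsubC subrr mul0r addr0 horner0 shi_first_u //.
  move/eqP; rewrite mulf_eq0 => /orP[/eqP//|]; rewrite -big_filter prodf_seq_eq0.
  case/hasP => k; rewrite mem_filter mem_index_iota => /and3P[lak ak kam] /= /eqP pk0.
  have akN : (a < k < N)%N by rewrite ak (leq_trans kam).
  by have [] := p_prime akN lak; rewrite pk0 eqxx.
move: H; rewrite c0 scale0r add0r => /eqP; rewrite mulf_eq0 polyXsubC_eq0 /= => /eqP H.
have {}IH := IH a.+1 (fun j => c j.+1) (leq_trans (eq_leq (addSnnS _ _)) aN) H.
by case=> [_|j jm]; [exact: c0|exact: IH].
Qed.
End LayeredShi.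

Section DivisibilitySign.
Variable S : idomainType.
Implicit Types (p x y : S).

Lemma divides_opp p x : divides (- p) x <-> divides p x.
Proof. by split=> -[y ->]; exists (- y); rewrite ?mulrN mulNr ?opprK. Qed.

Lemma dividesBC p x y : divides p (x - y) -> divides p (y - x).
Proof. by move=> h; rewrite -opprB; exact: dividesN. Qed.

Lemma prime_eltN p : prime_elt p -> prime_elt (- p).
Proof.
move=> [p0 pp]; split; first by rewrite oppr_eq0.
by move=> x y /divides_opp/pp[h|h]; [left|right]; apply/divides_opp.
Qed.
End DivisibilitySign.

(** * The difference equation [F(X + T) - F(X) = T E(X)] *)

Section Antidifference.
Variables (S : idomainType) (T : S).
Hypothesis T0 : T != 0.
Hypothesis natS : forall k, (k.+1%:R : S) \is a GRing.unit.
Implicit Types (E F : {poly S}).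

Let sh : {poly S} := 'X + T%:P.
(** The quotient of [(X + T)^d - X^d] by [T], a sum of [d] monic polynomials of degree [d - 1];
    hence its leading coefficient is [d]. *)
Let G (d : nat) : {poly S} := \sum_(j < d) sh ^+ (d.-1 - j) * 'X ^+ j.

Let shE d : sh ^+ d - 'X ^+ d = T *: G d.
Proof. by rewrite subrXX /sh addrC addKr mul_polyC. Qed.

Let G_term d (j : 'I_d.+1) : sh ^+ (d - j) * 'X ^+ j \is monic /\
  size (sh ^+ (d - j) * 'X ^+ j) = d.+1.
Proof.
have m1 : sh ^+ (d - j) \is monic by rewrite monic_exp // monicXaddC.
have m : sh ^+ (d - j) * 'X ^+ j \is monic by rewrite monicMl // monicXn.
split=> //; rewrite size_Mmonic ?monicXn ?monic_neq0 // size_polyXn addnS /=.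
have := size_exp sh (d - j); rewrite size_XaddC mul1n => e.
have s0 : (0 < size (sh ^+ (d - j)))%N by rewrite size_poly_gt0 monic_neq0.
by rewrite -(prednK s0) e addSn subnK // -ltnS.
Qed.

Let size_G d : (size (G d) <= d)%N.
Proof.
case: d => [|d]; first by rewrite /G big_ord0 size_poly0.
apply: leq_trans (size_sum _ _ _) _; apply/bigmax_leqP => j _.
by have [_ ->] := G_term j.
Qed.

Let coef_G d : (G d.+1)`_d = d.+1%:R.
Proof.
rewrite /G coef_sum (eq_bigr (fun=> 1)); first by rewrite sumr_const card_ord.
by move=> j _; have [/monicP + sz] := G_term j; rewrite /lead_coef sz.
Qed.

(** The leading term of [E] is removed by a multiple of ['X ^+ n.+1], whose difference divided by
    [T] has leading coefficient [n.+1], a unit. *)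
Lemma antidifference E : exists F, (size F <= (size E).+1)%N /\ F \Po sh - F = T *: E.
Proof.
move: {2 3}(size E) (leqnn (size E)) => n.
elim: n E => [|n IH] E sE.
  exists 0; rewrite size_poly0 comp_poly0 subrr; split=> //.
  by move: sE; rewrite size_poly_leq0 => /eqP ->; rewrite scaler0.
pose l := E`_n / n.+1%:R.
have [|F [sF eF]] := IH (E - l *: G n.+1).
  apply/leq_sizeP => j; rewrite leq_eqVlt => /orP[/eqP <-|nj].
    by rewrite coefB coefZ coef_G /l divrK ?natS // subrr.
  rewrite coefB coefZ !nth_default ?mulr0 ?subrr //; last exact: leq_trans sE nj.
  exact: leq_trans (size_G _) nj.
exists (F + l *: 'X ^+ n.+1); split.
  apply: leq_trans (size_polyD _ _) _; rewrite geq_max (leq_trans sF) //=.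
  by apply: leq_trans (size_scale_leq _ _) _; rewrite size_polyXn.
rewrite comp_polyD comp_polyZ comp_Xn_poly opprD addrACA eF -scalerBr shE.
by rewrite scalerBr !scalerA (mulrC T) subrK.
Qed.

(** The clause on coefficients shows that the degree drops by exactly one, which identifies the
    polynomials of difference zero as the constants. *)
Lemma difference F : exists E, (size E <= (size F).-1)%N /\ F \Po sh - F = T *: E /\
  (forall d, size F = d.+2 -> E`_d = lead_coef F * d.+1%:R).
Proof.
exists (\sum_(i < size F) F`_i *: G i); split.
  apply: leq_trans (size_sum _ _ _) _; apply/bigmax_leqP => i _.
  apply: leq_trans (size_scale_leq _ _) _; apply: leq_trans (size_G _) _.
  by rewrite -ltnS prednK // (leq_ltn_trans (leq0n i)).
split.
  rewrite comp_polyE -[X in _ - X]coefK poly_def -sumrB scaler_sumr.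
  apply: eq_bigr => i _; rewrite -scalerBr -[in LHS]/('X ^+ i) shE.
  by rewrite !scalerA mulrC.
move=> d sF; rewrite coef_sum sF big_ord_recr /= big1 ?add0r.
  by rewrite coefZ coef_G /lead_coef sF.
move=> i _; rewrite coefZ [X in _ * X]nth_default ?mulr0 //.
by apply: leq_trans (size_G _) _; rewrite -ltnS.
Qed.

Lemma difference_eq0 F : F \Po sh = F -> (size F <= 1)%N.
Proof.
move=> eF; have [E [_ [eE cE]]] := difference F.
have E0 : E = 0.
  by move/eqP: eE; rewrite eF subrr eq_sym scale_poly_eq0 (negbTE T0) /= => /eqP.
case sF : (size F) => [|[|d]] //.
have := cE d sF; rewrite E0 coef0 => /esym/eqP; rewrite mulf_eq0 lead_coef_eq0 -size_poly_eq0 sF /=.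
by move/eqP => h; have := natS d; rewrite h unitr0.
Qed.
End Antidifference.

(** * A basis of the logarithmic derivations of a layered Shi arrangement *)

Section LayeredShiModule.
Variables (S : idomainType) (v : nat -> S) (lam : nat -> nat) (T : S) (N : nat).
Hypothesis N0 : (0 < N)%N.
Hypothesis T0 : T != 0.
Hypothesis natS : forall k, (k.+1%:R : S) \is a GRing.unit.
Hypothesis lam_mono : forall i k, (i <= k)%N -> (lam i <= lam k)%N.
Hypothesis p_prime : forall i k, (i < k < N)%N -> lam i != lam k -> prime_elt (v i - T - v k).
Hypothesis p_coprime : forall i k j l, (i < k < N)%N -> lam i != lam k -> (j < l < N)%N -> lam j != lam l ->
  (i, k) != (j, l) -> ~ divides (v i - T - v k) (v j - T - v l).
Hypothesis d_prime : forall i k, (i < k < N)%N -> prime_elt (v i - v k).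
Hypothesis d_coprime : forall i j k, (i < k < N)%N -> (j < k < N)%N -> i != j ->
  ~ divides (v i - v k) (v j - v k).
Hypothesis pT_coprime : forall i k, (i < k < N)%N -> lam i != lam k -> ~ divides (v i - T - v k) T.

Definition shi_logarithmic (f : nat -> S) (g : S) : Prop :=
  [/\ divides T g, forall i k, (i < k < N)%N -> divides (v i - v k) (f i - f k) &
   forall i k, (i < k < N)%N -> lam i != lam k -> divides (v i - T - v k) (f i - g - f k)].

(** Each new node adds a multiple of the Newton polynomial of the earlier ones. Its coefficient lies
    in [S] because the defect at [v m] is divisible by every [v m - v i], and these are pairwise
    coprime primes. *)
Lemma newton_interpolation (f : nat -> S) :
  (forall i k, (i < k < N)%N -> divides (v i - v k) (f i - f k)) ->
  exists F : {poly S}, (size F <= N)%N /\ forall i, (i < N)%N -> F.[v i] = f i.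
Proof.
move=> Hf; suff : forall m, (m <= N)%N -> exists F : {poly S}, (size F <= m)%N /\
    forall i, (i < m)%N -> F.[v i] = f i by move=> /(_ N (leqnn N)).
elim=> [_|m IH mN]; first by exists 0; rewrite size_poly0.
have [F [sF eF]] := IH (ltnW mN).
have [c Ec] : divides (\prod_(i <- index_iota 0 m) (v m - v i)) (f m - F.[v m]).
  apply: divides_prod; first exact: iota_uniq.
    move=> i; rewrite mem_index_iota /= => im; have imN : (i < m < N)%N by rewrite im.
    rewrite -opprB; split; first exact/prime_eltN/d_prime.
    apply/divides_opp; rewrite -(subrK (f i) (f m)) -addrA; apply: dividesD.
      by apply: dividesBC; exact: Hf.
    by rewrite -(eF i im); exact: divides_horner.
  move=> i j; rewrite !mem_index_iota /= => im jm ij.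
  rewrite -(opprB (v i)) => /divides_opp/dividesBC.
  by apply: d_coprime; rewrite ?im ?jm.
exists (F + c *: \prod_(i <- index_iota 0 m) ('X - (v i)%:P)); split.
  apply: leq_trans (size_polyD _ _) _; rewrite geq_max (leq_trans sF) //=.
  apply: leq_trans (size_scale_leq _ _) _.
  by rewrite size_prod_XsubC size_iota subn0.
move=> i; rewrite ltnS leq_eqVlt hornerD hornerZ horner_prod => /orP[/eqP->|im].
  rewrite (eq_bigr (fun k => v m - v k)); last by move=> k _; rewrite !hornerE.
  by rewrite mulrC -Ec addrC subrK.
rewrite eF // (bigD1_seq i) /=; [|by rewrite mem_index_iota|exact: iota_uniq].
by rewrite hornerXsubC subrr mul0r mulr0 addr0.
Qed.

Let D := shi_basis v lam T 0 N.
Let sh : {poly S} := 'X + T%:P.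

(** All forms involve differences of the values [f i] only, so generation and independence are
    stated up to a common constant [k]. *)
Theorem shi_module_basis : exists (F : nat -> nat -> S) (G : nat -> S),
  [/\ forall j, (j < N)%N -> shi_logarithmic (F j) (G j),
      forall f g, shi_logarithmic f g -> exists (k : S) (c : nat -> S),
        (forall i, (i < N)%N -> f i = k + \sum_(j < N) c j * F j i) /\ g = \sum_(j < N) c j * G j &
      forall (c : nat -> S) (k : S), (forall i, (i < N)%N -> \sum_(j < N) c j * F j i = k) ->
        \sum_(j < N) c j * G j = 0 -> forall j, (j < N)%N -> c j = 0].
Proof.
have [Phi [sPhi HPhi]] : exists s : seq {poly S}, size s = size D /\ forall j, (j < size D)%N ->
    (size (s`_j)%R <= (size (D`_j)%R).+1)%N /\ s`_j \Po sh - s`_j = T *: D`_j.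
  elim: D => [|E s [s' [ss' Hs']]]; first by exists [::].
  have [F HF] := antidifference T natS E.
  by exists (F :: s'); rewrite /= ss'; split=> // -[|j] js //=; exact: Hs'.
have sD : size D = N.-1 by rewrite size_shi_basis.
have DN j : (j < N.-1)%N -> (size (D`_j)%R <= N.-1)%N /\ shi_condition v lam T 0 N D`_j.
  move=> jN; apply: (shi_basis_condition lam_mono (leqnn _)).
  by rewrite mem_nth // sD.
(* Index 0 is the Euler derivation, which sends [T] to [T]; the others are the antidifferences of
   the basis polynomials and send [T] to 0. *)
pose F j i := if j is j'.+1 then (Phi`_j').[v i] else v i.
pose G j := if j is _.+1 then 0 else T.
have sum_split (c h : nat -> S) : \sum_(j < N) c j * h j = c 0%N * h 0%N + \sum_(j < N.-1) c j.+1 * h j.+1.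
  by case: N N0 => [//|n _]; rewrite big_ord_recl.
exists F, G; split.
- case=> [_|j jN].
    split; first exact: divides_refl.
      by move=> i k _; exact: divides_refl.
    by move=> i k _ _; exact: divides_refl.
  have jN1 : (j < N.-1)%N by rewrite -ltnS prednK.
  have [|_ eP] := HPhi j; first by rewrite sD.
  have [_ cD] := DN j jN1.
  split; first exact: divides0.
    by move=> i k _; exact: divides_horner.
  move=> i k ikN lik; rewrite /= subr0.
  have e1 : (Phi`_j).[v k + T] - (Phi`_j).[v k] = T * (D`_j).[v k].
    by rewrite -hornerZ -eP !hornerE horner_comp !hornerE.
  rewrite (_ : (Phi`_j).[v i] - (Phi`_j).[v k] =
      ((Phi`_j).[v i] - (Phi`_j).[v k + T]) + T * (D`_j).[v k]); last by rewrite -e1; ring.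
  apply: dividesD.
    by rewrite (_ : v i - T - v k = v i - (v k + T)); [exact: divides_horner|ring].
  by apply: divides_mull; apply: cD => //; case/andP: ikN.
- move=> f g [[c0 eg] Hd Hp].
  (* Subtracting a multiple of the Euler derivation makes the value on [T] zero, and the remaining
     values are interpolated by one polynomial. *)
  pose f' i := f i - c0 * v i.
  have Hd' i k : (i < k < N)%N -> divides (v i - v k) (f' i - f' k).
    move=> ik; rewrite (_ : f' i - f' k = (f i - f k) - c0 * (v i - v k)); last by rewrite /f'; ring.
    by apply: dividesB; [exact: Hd|apply: divides_mull; exact: divides_refl].
  have [P [sP eP]] := newton_interpolation Hd'.
  have [E [sE [eE _]]] := difference T P.
  have sE' : (size E <= N.-1)%N.
    by apply: leq_trans sE _; rewrite -!subn1 leq_sub2r.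
  have cE : shi_condition v lam T 0 N E.
    move=> i k ik kN lik; rewrite add0n in kN; have ikN : (i < k < N)%N by case/andP: ik => _ ->.
    have iN : (i < N)%N by case/andP: ikN => /ltn_trans; apply.
    have : divides (v i - T - v k) (T * E.[v k]).
      rewrite -hornerZ -eE !hornerE horner_comp !hornerE.
      rewrite (_ : P.[v k + T] - P.[v k] = (P.[v k + T] - P.[v i]) + (P.[v i] - P.[v k])); last by ring.
      apply: dividesD.
        apply/divides_opp; rewrite (_ : - (v i - T - v k) = v k + T - v i); last by ring.
        exact: divides_horner.
      rewrite !eP // (_ : f' i - f' k = (f i - g - f k) - c0 * (v i - T - v k)); last by rewrite /f' eg; ring.
      by apply: dividesB; [exact: Hp|apply: divides_mull; exact: divides_refl].
    by case/(p_prime ikN lik).2 => // /(pT_coprime ikN lik).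
  have [c Ec] := shi_basis_span lam_mono p_prime p_coprime (leqnn N : (0 + N <= N)%N) sE' cE.
  (* [P] and the combination of the [Phi] have the same difference, so [Q] is a constant; it is the
     [k] of the statement. *)
  pose Q := P - \sum_(j < N.-1) c j *: Phi`_j.
  have Q1 : (size Q <= 1)%N.
    apply: (difference_eq0 T0 natS); rewrite -/sh /Q comp_polyB.
    apply/eqP; rewrite -subr_eq0 opprB addrACA addrC; apply/eqP.
    have -> : (\sum_(j < N.-1) c j *: Phi`_j) \Po sh = \sum_(j < N.-1) c j *: (Phi`_j + T *: D`_j).
      rewrite (raddf_sum (comp_poly sh)); apply: eq_bigr => j _; rewrite /= comp_polyZ.
      by have [|_ <-] := HPhi j; rewrite ?sD // addrC subrK.
    rewrite -(subrK P (P \Po sh)) eE Ec scaler_sumr.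
    have -> : \sum_(j < N.-1) c j *: (Phi`_j + T *: D`_j) =
       \sum_(j < N.-1) c j *: Phi`_j + \sum_(j < N.-1) T *: (c j *: D`_j).
      rewrite -big_split; apply: eq_bigr => j _ /=.
      by rewrite scalerDr !scalerA mulrC.
    move: (\sum_(_ < _) c _ *: _) (\sum_(_ < _) T *: _) => A B.
    by rewrite opprD; ring.
  have [k0 Qk] : exists k, Q = k%:P by exists Q`_0; exact: size1_polyC.
  pose cc j := if j is j'.+1 then c j' else c0.
  exists k0, cc; split.
    move=> i iN; rewrite [\sum_(j < N) _](sum_split cc (F^~ i)) /=.
    have -> : f i = f' i + c0 * v i by rewrite /f' subrK.
    rewrite -eP // -(subrK (\sum_(j < N.-1) c j *: Phi`_j) P) -/Q Qk hornerD hornerC horner_sum.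
    rewrite -!addrA; congr (_ + _); rewrite addrC; congr (_ + _).
    by apply: eq_bigr => j _; rewrite hornerZ.
  rewrite (sum_split cc G) /= eg big1 ?addr0; first by rewrite mulrC.
  by move=> j _; rewrite mulr0.
- move=> c k; rewrite (sum_split _ G) /= big1 ?addr0; last by move=> j _; rewrite mulr0.
  move=> Hk /eqP; rewrite mulf_eq0 (negbTE T0) orbF => /eqP c0.
  pose Q := \sum_(j < N.-1) c j.+1 *: Phi`_j - k%:P.
  have Qv i : (i < N)%N -> Q.[v i] = 0.
    move=> iN; rewrite /Q hornerD hornerN hornerC horner_sum -(Hk i iN) [\sum_(j < N) _](sum_split _ (F^~ i)) c0 mul0r add0r.
    by rewrite (eq_bigr (fun j : 'I_N.-1 => c j.+1 * (Phi`_j).[v i])) ?subrr // => j _; rewrite hornerZ.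
  have sQ : (size Q <= N)%N.
    apply: leq_trans (size_polyD _ _) _; rewrite geq_max size_polyN (leq_trans (size_polyC_leq1 _)) // andbT.
    apply: leq_trans (size_sum _ _ _) _; apply/bigmax_leqP => j _.
    apply: leq_trans (size_scale_leq _ _) _.
    have [|h _] := HPhi j; first by rewrite sD.
    apply: leq_trans h _; have [h' _] := DN j (ltn_ord j).
    by apply: leq_ltn_trans h' _; rewrite prednK.
  (* [Q] has degree less than [N] and vanishes at [N] distinct nodes. *)
  have Q0 : Q = 0.
    apply: (@roots_geq_poly_eq0 _ _ [seq v i | i <- iota 0 N]).
    - by apply/allP => x /mapP[i]; rewrite mem_iota /= => iN ->; apply/eqP/Qv.
    - rewrite map_inj_in_uniq ?iota_uniq // => i i'; rewrite !mem_iota /= => iN i'N e.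
      have H a b : (a < b < N)%N -> v a != v b by move=> /d_prime[+ _]; rewrite subr_eq0.
      case: (ltngtP i i') => // h.
        by have := H i i'; rewrite h i'N e eqxx => /(_ isT).
      by have := H i' i; rewrite h iN e eqxx => /(_ isT).
    - by rewrite size_map size_iota.
  have SD : \sum_(j < N.-1) c j.+1 *: D`_j = 0.
    have e1 : \sum_(j < N.-1) c j.+1 *: Phi`_j = k%:P by apply/eqP; rewrite -subr_eq0 -/Q Q0.
    suff : T *: (\sum_(j < N.-1) c j.+1 *: D`_j) = 0.
      by move/eqP; rewrite scale_poly_eq0 (negbTE T0) => /eqP.
    rewrite scaler_sumr.
    have := congr1 (fun P => P \Po sh - P) e1; rewrite /= comp_polyC subrr => e3; rewrite -[RHS]e3.
    rewrite (raddf_sum (comp_poly sh)) -sumrB; apply: eq_bigr => j _ /=.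
    have [|_ e2] := HPhi j; first by rewrite sD.
    by rewrite comp_polyZ -scalerBr e2 !scalerA mulrC.
  case=> [_|j jN]; first exact: c0.
  have jN1 : (j < N.-1)%N by rewrite -ltnS prednK.
  exact: (shi_basis_indep (c := fun j => c j.+1) p_prime (leqnn N : (0 + N <= N)%N) SD jN1).
Qed.
End LayeredShiModule.

(** * A mod 2 cup product on the cubical lattice *)

Section CubicalParity.
Variable l : nat.
Notation pt := {ffun 'I_l -> nat}.

Definition step (p : pt) (d : 'I_l) : pt := [ffun i => p i + (i == d)]%N.
Definition upd (p : pt) (d : 'I_l) (k : nat) : pt :=
  [ffun i => if i == d then k else p i].

(** For as many functions as directions, this is the value mod 2 of the cup product of their
    coboundaries on the cube with corner [p] and directions [D]: a sum over the monotone edge paths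
    of the cube, with one coboundary per edge. *)
Fixpoint cupsum (cs : seq (pt -> 'F_2)) (D : {set 'I_l}) (p : pt) : 'F_2 :=
  if cs is c :: cs' then
    \sum_(d in D) (c (step p d) + c p) * cupsum cs' (D :\ d) (step p d)
  else 1.

Lemma add22 (x : 'F_2) : x + x = 0.
Proof. by case: x => [[|[|?]]] //= i; apply/val_inj. Qed.

Lemma stepC p d d' : step (step p d) d' = step (step p d') d.
Proof. by apply/ffunP => i; rewrite !ffunE addnAC. Qed.

Lemma setD1C (D : {set 'I_l}) d d' : D :\ d :\ d' = D :\ d' :\ d.
Proof. by rewrite !setDDl setUC. Qed.

Lemma sum_sym0 (D : {set 'I_l}) (F : 'I_l -> 'I_l -> 'F_2) :
  (forall d d', F d d' = F d' d) ->
  \sum_(d in D) \sum_(d' in D :\ d) F d d' = 0.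
Proof.
move=> FC; elim: {D}#|D| {-2}D (erefl #|D|) => [|n IH] D cD.
  by move/eqP: cD; rewrite cards_eq0 => /eqP->; rewrite big_set0.
have [d0 d0D] : exists x, x \in D by apply/card_gt0P; rewrite cD.
rewrite (bigD1 d0) //=.
have -> : \sum_(i in D | i != d0) \sum_(d' in D :\ i) F i d' =
  \sum_(i in D :\ d0) (F i d0 + \sum_(d' in D :\ d0 :\ i) F i d').
  apply: eq_big => i; first by rewrite !inE andbC.
  move=> /andP[iD id0]; rewrite (bigD1 d0) /=; last by rewrite !inE d0D eq_sym id0.
  by congr (_ + _); apply: eq_bigl => j; rewrite !inE; case: (j == d0); case: (j == i); rewrite ?andbF ?andbT.
rewrite big_split /= IH; last by move: cD; rewrite (cardsD1 d0) d0D; case.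
by rewrite addr0 -big_split /=; apply: big1 => i _; rewrite (FC i) add22.
Qed.

(** A cup product of coboundaries is a cocycle: near and far faces of a cube contribute equally mod
    2. Terms symmetric in two directions cancel, and exchanging the two directions matches what
    remains. *)
Lemma cupsum_closed cs (D : {set 'I_l}) p :
  \sum_(d in D) cupsum cs (D :\ d) (step p d) = \sum_(d in D) cupsum cs (D :\ d) p.
Proof.
elim: cs D p => [//|c cs IH] D p /=.
transitivity (\sum_(d in D) c (step p d) *
    \sum_(d' in D :\ d) cupsum cs (D :\ d :\ d') (step p d)).
  transitivity (\sum_(d in D) (\sum_(d' in D :\ d)
     c (step (step p d) d') * cupsum cs (D :\ d :\ d') (step (step p d) d')
    + c (step p d) * \sum_(d' in D :\ d) cupsum cs (D :\ d :\ d') (step (step p d) d'))).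
    apply: eq_bigr => d _; rewrite big_distrr -big_split /=.
    by apply: eq_bigr => d' _; rewrite mulrDl.
  rewrite big_split /= sum_sym0 ?add0r; last by move=> d d'; rewrite stepC setD1C.
  by apply: eq_bigr => d dD; rewrite IH.
transitivity (\sum_(d in D) (\sum_(d' in D :\ d)
     c (step p d') * cupsum cs (D :\ d :\ d') (step p d')
    + c p * \sum_(d' in D :\ d) cupsum cs (D :\ d :\ d') (step p d'))); last first.
  apply: eq_bigr => d _; rewrite big_distrr -big_split /=.
  by apply: eq_bigr => d' _; rewrite mulrDl.
rewrite big_split /=.
have -> : \sum_(i in D) c p * \sum_(d' in D :\ i) cupsum cs (D :\ i :\ d') (step p d') = 0.
  rewrite -big_distrr /=.
  have -> : \sum_(i in D) \sum_(d' in D :\ i) cupsum cs (D :\ i :\ d') (step p d') =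
    \sum_(i in D) \sum_(d' in D :\ i) cupsum cs (D :\ i :\ d') p.
    by apply: eq_bigr => i _; rewrite IH.
  by rewrite sum_sym0 ?mulr0 // => d d'; rewrite setD1C.
rewrite addr0.
under eq_bigr do rewrite big_distrr /=.
under eq_bigr => d _ do under eq_bigl => d' do rewrite in_setD1 andbC.
under [RHS]eq_bigr => d _ do under eq_bigl => d' do rewrite in_setD1 andbC.
rewrite (exchange_big_dep (fun i => i \in D)) /=; last by move=> i j _ /andP[].
apply: eq_bigr => d' dD; apply: eq_big.
  by move=> i; rewrite dD /= eq_sym.
by move=> d _; rewrite setD1C.
Qed.

Variable N : nat.
Fixpoint boxsum (s : seq 'I_l) (G : pt -> 'F_2) (p : pt) : 'F_2 :=
  if s is d :: s' then \sum_(i < N) boxsum s' G (upd p d i) else G p.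

Lemma eq_boxsum s G G' p : G =1 G' -> boxsum s G p = boxsum s G' p.
Proof.
by move=> GG'; elim: s p => [|d s IH] p /=; [exact: GG'|apply: eq_bigr => i _; exact: IH].
Qed.

Lemma boxsum_sum s (D : {set 'I_l}) (G : 'I_l -> pt -> 'F_2) p :
  boxsum s (fun q => \sum_(d in D) G d q) p = \sum_(d in D) boxsum s (G d) p.
Proof.
elim: s p => [//|d s IH] p /=.
by rewrite exchange_big /=; apply: eq_bigr => i _; rewrite IH.
Qed.

Lemma boxsum0 s p : boxsum s (fun=> 0) p = 0.
Proof. by elim: s p => [//|d s IH] p /=; rewrite big1. Qed.

Lemma updC p d d' i j : d != d' -> upd (upd p d i) d' j = upd (upd p d' j) d i.
Proof.
move=> dd; apply/ffunP => k; rewrite !ffunE.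
by case: (altP (k =P d')) => [->|//]; rewrite eq_sym (negbTE dd).
Qed.

Lemma boxsum_upd s G p d k : d \notin s ->
  boxsum s (fun q => G (upd q d k)) p = boxsum s G (upd p d k).
Proof.
elim: s p => [//|d' s IH] p /=; rewrite inE negb_or => /andP[dd' ds].
by apply: eq_bigr => i _; rewrite IH // updC // eq_sym.
Qed.

Lemma boxsum_rem s G p d : uniq s -> d \in s ->
  boxsum s G p = \sum_(i < N) boxsum (rem d s) G (upd p d i).
Proof.
elim: s p => [//|d' s IH] p /= /andP[d's us]; rewrite inE.
case: (altP (d =P d')) => [-> _|dd' /= ds]; first by rewrite eqxx.
rewrite eq_sym (negbTE dd') /= exchange_big /=; apply: eq_bigr => i _.
rewrite IH //; apply: eq_bigr => j _; rewrite updC //.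
by rewrite eq_sym.
Qed.

Lemma telescope2 (g : nat -> 'F_2) : \sum_(i < N) (g i.+1 + g i) = g N + g 0%N.
Proof.
elim: N => [|m IH]; first by rewrite big_ord0 add22.
rewrite big_ord_recr /= IH addrACA [g m + _]addrC -!addrA.
by congr (_ + _); rewrite addrC -!addrA add22 addr0.
Qed.

(** Stokes in a single direction: the sum along [d] telescopes to the two opposite faces of the
    box. *)
Lemma boxsum_telescope s G p d : uniq s -> d \in s ->
  boxsum s (fun q => G (step q d) + G q) p =
  boxsum (rem d s) (fun q => G (upd q d N) + G (upd q d 0)) p.
Proof.
move=> us ds; rewrite (boxsum_rem _ _ us ds).
have dn : d \notin rem d s by rewrite mem_rem_uniq // inE eqxx.
transitivity (\sum_(i < N) boxsum (rem d s) (fun q => G (upd q d i.+1) + G (upd q d i)) p).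
  apply: eq_bigr => i _.
  rewrite -(@boxsum_upd (rem d s) (fun q => G (step q d) + G q)) //.
  apply: eq_boxsum => q; congr (G _ + _); apply/ffunP => k; rewrite !ffunE.
  by case: (k == d); rewrite ?addn1 ?addn0.
elim: (rem d s) p {dn} => [|d' t IH] p /=.
  exact: (telescope2 (fun i => G (upd p d i))).
by rewrite exchange_big /=; apply: eq_bigr => i _; rewrite IH.
Qed.

(** Paths with directions in [D] keep the coordinate [d], so a function that is constant on this
    slice has coboundary zero on each of their edges. *)
Lemma cupsum_const0 (cs : seq (pt -> 'F_2)) (D : {set 'I_l}) (q : pt) d k c :
  d \notin D -> q d = k ->
  List.In c cs -> (exists v, forall q' : pt, q' d = k -> c q' = v) -> cupsum cs D q = 0.
Proof.
move=> + + + [v cv]; elim: cs D q => [//|c' cs IH] D q dD qd /= [cc|cin].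
  rewrite big1 // => d' d'D; rewrite cc !cv ?add22 ?mul0r //.
  by rewrite ffunE qd (_ : d == d' = false) ?addn0 //; apply: contraNF dD => /eqP->.
rewrite big1 // => d' d'D; rewrite (IH (D :\ d')) ?mulr0 // ?inE ?(negbTE dD) ?andbF //.
by rewrite ffunE qd (_ : d == d' = false) ?addn0 //; apply: contraNF dD => /eqP->.
Qed.

(** The product is the coboundary of [c d] times the remaining product, hence it reduces to the
    faces of the box. On the faces in another direction [d'] the function [c d'] is constant and the
    product vanishes; on those in direction [d] the values 0 and 1 of [c d] leave the case of one
    direction fewer. *)
Lemma boxsum_cupsum (s : seq 'I_l) (c : 'I_l -> pt -> 'F_2) p :
  uniq s ->
  (forall d (q : pt), d \in s -> q d = 0%N -> c d q = 0) ->
  (forall d (q : pt), d \in s -> q d = N -> c d q = 1) ->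
  boxsum s (cupsum [seq c d | d <- s] [set d in s]) p = 1.
Proof.
elim: s p => [//|d s IH] p us c0 c1.
have /= /andP[ds us'] := us.
set D := [set x in d :: s].
transitivity (boxsum (d :: s) (fun q => \sum_(d' in D)
   (c d (step q d') * cupsum [seq c x | x <- s] (D :\ d') (step q d') +
    c d q * cupsum [seq c x | x <- s] (D :\ d') q)) p).
  apply: (@eq_boxsum (d :: s)) => q /=; rewrite [RHS]big_split /= -big_distrr /=.
  rewrite -cupsum_closed big_distrr /= -big_split /=.
  by apply: eq_bigr => d' _; rewrite mulrDl.
rewrite boxsum_sum (bigD1 d) /=; last by rewrite !inE eqxx.
rewrite -/(boxsum (d :: s) _ p).
rewrite (@boxsum_telescope (d :: s)
  (fun q => c d q * cupsum [seq c x | x <- s] (D :\ d) q) p d us); last by rewrite inE eqxx.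
rewrite /= eqxx big1 ?addr0.
  rewrite -(IH (upd p d N)) //; last 2 first.
  - by move=> d' q d's; apply: c0; rewrite inE d's orbT.
  - by move=> d' q d's; apply: c1; rewrite inE d's orbT.
  rewrite -(boxsum_upd (cupsum _ _)) //; apply: eq_boxsum => q.
  rewrite c1 ?inE ?eqxx ?ffunE ?eqxx // c0 ?inE ?eqxx ?ffunE ?eqxx //.
  rewrite mul0r mul1r addr0; congr cupsum.
  by apply/setP => x; rewrite !inE; case: eqP => [->|//]; rewrite (negbTE ds).
move=> d' /andP[]; rewrite inE in_cons => /orP[->//|d's] dd'.
rewrite -/(boxsum (d :: s) _ p).
have d'in : d' \in d :: s by rewrite inE d's orbT.
rewrite (@boxsum_telescope (d :: s)
  (fun q => c d q * cupsum [seq c x | x <- s] (D :\ d') q) p d' us) //.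
rewrite -[RHS](boxsum0 (rem d' (d :: s)) p); apply: eq_boxsum => q.
have cin : List.In (c d') [seq c x | x <- s].
  elim: s d's {IH us c0 c1 ds us' D d'in} => [//|x s IH]; rewrite inE => /orP[/eqP->|/IH]; first by left.
  by right.
rewrite (@cupsum_const0 _ (D :\ d') (upd q d' N) d' N (c d')) ?inE ?eqxx ?ffunE ?eqxx //; last first.
  by exists 1 => q' /c1; apply.
rewrite (@cupsum_const0 _ (D :\ d') (upd q d' 0) d' 0%N (c d')) ?inE ?eqxx ?ffunE ?eqxx //; last first.
  by exists 0 => q' /c0; apply.
by rewrite !mulr0 addr0.
Qed.

Lemma boxsum_neq0 s G p : boxsum s G p != 0 ->
  exists q : pt, [/\ forall i, i \in s -> (q i < N)%N,
     forall i, i \notin s -> q i = p i & G q != 0].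
Proof.
elim: s p => [|d s IH] p /=; first by exists p.
move=> H; have [i] : exists i : 'I_N, boxsum s G (upd p d i) != 0.
  apply/existsP; apply: contraNT H; rewrite negb_exists => /forallP H.
  by rewrite big1 // => i _; apply/eqP; move: (H i); rewrite negbK.
move=> /IH[q [q1 q2 q3]]; exists q; split=> // j; rewrite inE.
  case: (boolP (j \in s)) => [/q1//|js]; rewrite orbF => /eqP->.
  case: (boolP (d \in s)) => [/q1//|ds]; by rewrite q2 // ffunE eqxx.
by rewrite negb_or => /andP[jd js]; rewrite q2 // ffunE (negbTE jd).
Qed.

(* A nonzero cup product exhibits a monotone chain inside one unit cell along
   which every cochain changes its value. *)
Lemma cupsum_neq0 cs (D : {set 'I_l}) p c : cupsum cs D p != 0 -> List.In c cs ->
  exists q q' : pt, [/\ forall i, (p i <= q i <= p i + (i \in D))%N,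
   forall i, (p i <= q' i <= p i + (i \in D))%N & c q != c q'].
Proof.
elim: cs D p => [//|c' cs IH] D p /= H cin.
have [d dD H'] : exists2 d, d \in D &
   (c' (step p d) + c' p) * cupsum cs (D :\ d) (step p d) != 0.
  apply/exists_inP; apply: contraNT H; rewrite negb_exists => /forallP H.
  by rewrite big1 // => i iD; apply/eqP; move: (H i); rewrite iD /= negbK.
move: H'; rewrite mulf_eq0 negb_or => /andP[H1 H2].
case: cin => [<-|cin].
  exists (step p d), p; split.
  - by move=> i; rewrite ffunE leq_addr leq_add2l; case: eqP => [->|//]; rewrite dD.
  - by move=> i; rewrite leqnn leq_addr.
  - by apply: contraNN H1 => /eqP->; rewrite add22.
have [q [q' [h1 h2 h3]]] := IH _ _ H2 cin; exists q, q'; split=> // i.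
- move: (h1 i); rewrite ffunE !inE; case: eqP => [->|_] /=; rewrite ?addn0 ?dD //=.
  by rewrite addn1 => /andP[/ltnW-> /=].
- move: (h2 i); rewrite ffunE !inE; case: eqP => [->|_] /=; rewrite ?addn0 ?dD //=.
  by rewrite addn1 => /andP[/ltnW-> /=].
Qed.

(** A cubical Sperner lemma: the products over all cells add up to 1 mod 2, so some cell has a
    nonzero product, and inside it every colouring changes. *)
Lemma cubical_sperner (c : 'I_l -> pt -> bool) :
  (forall d (q : pt), q d = 0%N -> c d q = false) ->
  (forall d (q : pt), q d = N -> c d q = true) ->
  exists p : pt, (forall i, (p i < N)%N) /\
   forall d, exists q q' : pt, [/\ forall i, (p i <= q i <= (p i).+1)%N,
   forall i, (p i <= q' i <= (p i).+1)%N & c d q != c d q'].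
Proof.
move=> c0 c1; pose cc d q : 'F_2 := (c d q)%:R.
have H : boxsum (enum 'I_l) (cupsum [seq cc d | d <- enum 'I_l] [set d in enum 'I_l])
    [ffun=> 0%N] = 1.
  apply: (@boxsum_cupsum (enum 'I_l) cc); first exact: enum_uniq.
  - by move=> d q _ /c0; rewrite /cc => ->.
  - by move=> d q _ /c1; rewrite /cc => ->.
have /boxsum_neq0[p [p1 _ p3]] : boxsum (enum 'I_l)
   (cupsum [seq cc d | d <- enum 'I_l] [set d in enum 'I_l]) [ffun=> 0%N] != 0.
  by rewrite H oner_eq0.
exists p; split; first by move=> i; apply: p1; rewrite mem_enum.
move=> d; have cin : List.In (cc d) [seq cc d | d <- enum 'I_l].
  have : d \in enum 'I_l by rewrite mem_enum.
  elim: (enum 'I_l) => [//|x s IH]; rewrite inE.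
  by case/orP => [/eqP->|/IH]; [left|right].
have [q [q' [h1 h2 h3]]] := cupsum_neq0 p3 cin.
have D1 i : i \in [set d in enum 'I_l] by rewrite inE mem_enum.
exists q, q'; split.
- by move=> i; have := h1 i; rewrite D1 addn1.
- by move=> i; have := h2 i; rewrite D1 addn1.
- by apply: contraNN h3 => /eqP; rewrite /cc => ->.
Qed.
End CubicalParity.

From mathcomp Require Import mpoly.

(** * Freeness *)

Section LinearForms.
Variable n : nat.
Implicit Types (I J : {set 'I_n}) (p q x y : Spoly n) (i : 'I_n).

Lemma meval_alpha (w : 'I_n -> rat) I : meval w (alpha I) = \sum_(i in I) w i.
Proof. by rewrite /alpha raddf_sum; apply: eq_bigr => i _ /=; rewrite mevalXU. Qed.

Lemma alpha_neq0 I : I != set0 -> alpha I != 0.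
Proof.
case/set0Pn => i iI; apply/eqP => h.
have := meval_alpha (fun v => (v == i)%:R) I; rewrite h meval0 (bigD1 i iI) eqxx /=.
rewrite big1 ?addr0; first by move/esym/eqP; rewrite oner_eq0.
by move=> v /andP[_ /negbTE->].
Qed.

(** Modulo a linear form a polynomial ring is again one. This is expressed by a substitution that
    kills [alpha I] and changes every polynomial by a multiple of [alpha I]; a product killed by it
    has a factor killed by it. *)
Lemma alpha_prime I : I != set0 -> prime_elt (alpha I).
Proof.
move=> I0; split; first exact: alpha_neq0.
have [i0 iI] := set0Pn _ I0.
(* the substitution x_i0 |-> - sum of the other variables of I *)
pose lq : n.-tuple (Spoly n) := [tuple 'X_v - (if v == i0 then alpha I else 0) | v < n].
have sX v : 'X_v \mPo lq = 'X_v - (if v == i0 then alpha I else 0).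
  by rewrite comp_mpolyXU -tnth_nth tnth_mktuple.
have sM x y : (x * y) \mPo lq = (x \mPo lq) * (y \mPo lq) by exact: (rmorphM (comp_mpoly lq)).
have Dmul x y : divides (alpha I) (x - (x \mPo lq)) -> divides (alpha I) (y - (y \mPo lq)) ->
    divides (alpha I) (x * y - ((x * y) \mPo lq)).
  move=> hx hy; rewrite sM (_ : _ - _ = (x - (x \mPo lq)) * y + (x \mPo lq) * (y - (y \mPo lq))); last by ring.
  by apply: dividesD; [exact: divides_mulr|exact: divides_mull].
have D1 : divides (alpha I) (1 - ((1 : Spoly n) \mPo lq)) by rewrite comp_mpoly1 subrr; exact: divides0.
have D p : divides (alpha I) (p - (p \mPo lq)).
  rewrite (mpolyE p) (raddf_sum (comp_mpoly lq)) -sumrB; apply: (big_ind (divides (alpha I))).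
  - exact: divides0.
  - exact: dividesD.
  move=> m _; rewrite /= linearZ /= -scalerBr -mul_mpolyC; apply: divides_mull.
  rewrite mpolyXE_id; apply: (big_ind (fun x => divides (alpha I) (x - (x \mPo lq)))) => // v _.
  elim: (m v) => [|k IH]; first by rewrite expr0.
  rewrite exprS; apply: Dmul => //.
  rewrite sX opprB addrCA subrr addr0; case: eqP => _; [exact: divides_refl|exact: divides0].
have s0 : alpha I \mPo lq = 0.
  rewrite /alpha raddf_sum /= (eq_bigr (fun v => 'X_v - (if v == i0 then alpha I else 0))) => [|v _]; last exact: sX.
  rewrite sumrB -/(alpha I) -big_mkcondr /= (big_pred1 i0) ?subrr // => v /=.
  by case: eqP => [->|_]; rewrite ?andbT ?andbF.
move=> x y [h xy]; have := congr1 (comp_mpoly lq) xy; rewrite !sM s0 mul0r => /eqP.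
rewrite mulf_eq0 => /orP[]/eqP e; [left; have := D x|right; have := D y]; by rewrite e subr0.
Qed.

(** A point where [alpha I] vanishes and [alpha J] does not excludes divisibility: a unit vector at
    an element of [J] outside [I], or else the difference of unit vectors at a point of [J] and at a
    point of [I] outside [J]. *)
Lemma alpha_coprime I J : I != set0 -> J != set0 -> I != J -> ~ divides (alpha I) (alpha J).
Proof.
move=> I0 J0 IJ [h eJ].
have ev (w : 'I_n -> rat) : \sum_(i in J) w i = (\sum_(i in I) w i) * meval w h.
  by rewrite -!meval_alpha -mevalM eJ.
have dl (K : {set 'I_n}) (i : 'I_n) : \sum_(v in K) (v == i)%:R = (i \in K)%:R :> rat.
  case: (boolP (i \in K)) => iK.
    by rewrite (bigD1 i iK) eqxx /= big1 ?addr0 // => v /andP[_ /negbTE->].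
  rewrite big1 // => v vK; case: eqP => // vi; by rewrite -vi vK in iK.
have JI : J \subset I.
  apply/subsetP => j jJ; apply/negPn/negP => jI.
  have := ev (fun v => (v == j)%:R); rewrite !dl jJ (negbTE jI) mul0r => /eqP.
  by rewrite oner_eq0.
have /subsetPn[u uI uJ] : ~~ (I \subset J).
  by apply: contra IJ => IJ'; rewrite eqEsubset IJ'.
have [w wJ] := set0Pn _ J0.
have := ev (fun v => (v == w)%:R - (v == u)%:R); rewrite !sumrB !dl wJ (negbTE uJ) uI (subsetP JI w wJ).
by rewrite subr0 subrr mul0r => /eqP; rewrite oner_eq0.
Qed.
End LinearForms.

Lemma natS_unit n k : (k.+1%:R : Spoly n) \is a GRing.unit.
Proof.
apply/unitrP; exists (k.+1%:R^-1)%:MP; rewrite -(rmorph_nat (@mpolyC n rat)) -!rmorphM /=.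
by rewrite mulVf ?mulfV ?pnatr_eq0.
Qed.

(* [None] is the form g, [Some (b, i, k)] is f_i - b g - f_k. *)
Definition shi_form (S : zmodType) (w : option (bool * nat * nat)) (f : nat -> S) (g : S) : S :=
  if w is Some (b, i, k) then f i - (if b then g else 0) - f k else g.

Definition shi_index (lam : nat -> nat) (N : nat) (w : option (bool * nat * nat)) : Prop :=
  if w is Some (b, i, k) then (i < k < N)%N /\ (b -> lam i != lam k) else True.

Lemma shi_form_delta (S : nzRingType) b i k a :
  shi_form (Some (b, i, k)) (fun j => (j == a)%:R : S) 0 = (i == a)%:R - (k == a)%:R.
Proof. by rewrite /= if_same subr0. Qed.

Lemma shi_form_sum (S : idomainType) lam N w (f : nat -> S) g k c (F : nat -> nat -> S) (G : nat -> S) :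
  (forall i, (i < N)%N -> f i = k + \sum_(j < N) c j * F j i) -> g = \sum_(j < N) c j * G j ->
  shi_index lam N w -> shi_form w f g = \sum_(j < N) c j * shi_form w (F j) (G j).
Proof.
case: w => [[[b i] l]|] //= ef eg [/andP[il lN] _].
rewrite !ef ?(ltn_trans il) // eg; case: b.
  rewrite [RHS](eq_bigr (fun j : 'I_N => c j * F j i - c j * G j - c j * F j l)).
    by rewrite !sumrB; ring.
  by move=> j _; ring.
rewrite [RHS](eq_bigr (fun j : 'I_N => c j * F j i - c j * F j l)).
  by rewrite !sumrB; ring.
by move=> j _; ring.
Qed.

(** [psi] builds a derivation from its values [f] on the coordinates [Y_i] and [g] on [T]. The last
    two clauses match the connected sets, up to sign, with the forms of the layered Shi
    arrangement. *)
Definition shi_chart n (e : rel 'I_n) (lam : nat -> nat) (N : nat)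
    (psi : (nat -> Spoly n) -> Spoly n -> derivation n) : Prop :=
  [/\ forall h : derivation n, exists f g, forall x, h x = psi f g x,
      forall I, arr_index e I -> exists w (b : bool), shi_index lam N w /\
        forall f g, der_apply (psi f g) I = (-1) ^+ b * shi_form w f g &
      forall w, shi_index lam N w -> exists I (b : bool), arr_index e I /\
        forall f g, der_apply (psi f g) I = (-1) ^+ b * shi_form w f g].

Section ShiChart.
Variables (n : nat) (e : rel 'I_n) (lam : nat -> nat) (N : nat).
Variable psi : (nat -> Spoly n) -> Spoly n -> derivation n.
Hypothesis N0 : (0 < N)%N.
Hypothesis lam_mono : forall i k, (i <= k)%N -> (lam i <= lam k)%N.
Hypothesis psi_chart : shi_chart e lam N psi.
Notation S := (Spoly n).

Lemma shi_chart_free : arr_free e.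
Proof.
have [psi_surj psi_conn psi_form] := psi_chart.
(* The Euler derivation takes the value [alpha I] on [I]; its coordinates in the chart are therefore
   the nodes [v] and the shift [T] themselves. *)
have [v [T eX]] := psi_surj (fun x => mpoly.mpolyX rat (mpoly.mnm1 x)).
have al I : alpha I = der_apply (psi v T) I by apply: eq_bigr => x _; exact: eX.
have dsign (b : bool) (p x : S) : divides ((-1) ^+ b * p) x <-> divides p x.
  by case: b; [rewrite expr1 mulN1r; exact: divides_opp|rewrite expr0 mul1r].
have dsignr (b : bool) (p x : S) : divides p ((-1) ^+ b * x) <-> divides p x.
  split; last exact: divides_mull.
  by move/(divides_mull ((-1) ^+ b)); rewrite signrMK.
have psign (b : bool) (p : S) : prime_elt ((-1) ^+ b * p) -> prime_elt p.
  by case: b; [rewrite expr1 mulN1r => /prime_eltN; rewrite opprK|rewrite expr0 mul1r].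
have form_prime (w : option (bool * nat * nat)) : shi_index lam N w -> prime_elt (shi_form w v T).
  move=> /psi_form[I [b [[I0 _] eI]]]; apply: (psign b).
  by rewrite -eI -al; exact: alpha_prime.
(* Two forms separated by test values [f], [g] belong to different connected sets, hence to coprime
   linear forms. *)
have form_coprime (w w' : option (bool * nat * nat)) (f : nat -> S) (g : S) : shi_index lam N w -> shi_index lam N w' ->
    shi_form w f g = 0 -> shi_form w' f g != 0 -> ~ divides (shi_form w v T) (shi_form w' v T).
  move=> /psi_form[I [b [[I0 _] eI]]] /psi_form[J [c [[J0 _] eJ]]] w0 w'0.
  move=> /(dsign b)/(dsignr c); rewrite -eI -eJ -!al; apply: alpha_coprime => //.
  apply: contraNneq w'0 => IJ; have := eJ f g; rewrite -IJ eI w0 mulr0 => /esym/eqP.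
  by rewrite mulf_eq0 signr_eq0.
have form_log (f : nat -> S) (g : S) (w : option (bool * nat * nat)) : shi_index lam N w -> logder e (psi f g) -> divides (shi_form w v T) (shi_form w f g).
  move=> /psi_form[I [b [eI hI]]] /(_ I eI)[h eh]; apply/(dsign b)/(dsignr b).
  by rewrite -!hI -al eh; exists h.
have logP f g : logder e (psi f g) -> shi_logarithmic v lam T N f g.
  move=> L; split; first exact: (form_log f g None).
  - move=> i k ik; have := form_log f g (Some (false, i, k)); rewrite /= !subr0.
    by apply.
  - by move=> i k ik lik; exact: (form_log f g (Some (true, i, k))).
have Plog f g : shi_logarithmic v lam T N f g -> logder e (psi f g).
  move=> [Lg Ld Lp] I /psi_conn[w [b [Hw hI]]]; rewrite al !hI.
  suff : divides (shi_form w v T) (shi_form w f g) by move/(dsignr b)/(dsign b).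
  case: w Hw {hI} => [[[[] i] k]|] //= [ik lik]; first exact/Lp/lik.
  by rewrite !subr0; exact: Ld.
have [||||||||F [G [BL Bspan Bind]]] := @shi_module_basis S v lam T N N0.
- by have [] := form_prime None I.
- exact: natS_unit.
- exact: lam_mono.
- by move=> i k ik lik; exact: (form_prime (Some (true, i, k))).
- move=> i k j l ik lik jl ljl ne.
  (* The test function is the indicator of an index [a] outside [{i, k}] that is exactly one of [j]
     and [l]. *)
  have [a [ai ak aj]] : exists a, [/\ i != a, k != a & (j == a) != (l == a)].
    have ik' : (i < k)%N by case/andP: ik.
    have jl' : (j < l)%N by case/andP: jl.
    have [ij|ij] := eqVneq i j; last first.
      have [jk|jk] := eqVneq k j; last by exists j; rewrite ij jk eqxx (gtn_eqF jl').
      exists l; rewrite eqxx (ltn_eqF jl'); rewrite -jk in jl'.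
      by rewrite (ltn_eqF jl') (ltn_eqF (ltn_trans ik' jl')).
    have kl : k != l by apply: contra_neq ne => ->; rewrite ij.
    by exists l; rewrite ij (ltn_eqF jl') kl eqxx.
  apply: (form_coprime (Some (true, i, k)) (Some (true, j, l)) (fun j => (j == a)%:R) 0) => //.
    by rewrite shi_form_delta (negbTE ai) (negbTE ak) subrr.
  by rewrite shi_form_delta; case: (j == a) (l == a) aj => [] [] // _; rewrite ?subr0 ?sub0r ?oppr_eq0 ?mulr1n; apply: oner_neq0.
- by move=> i k ik; have := form_prime (Some (false, i, k)); rewrite /= subr0; apply.
- move=> i j k ik jk ij; have := @form_coprime (Some (false, i, k)) (Some (false, j, k)) (fun a => (a == j)%:R) 0.
  have kj : (k == j) = false by apply: gtn_eqF; case/andP: jk.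
  rewrite !shi_form_delta /= !subr0 (negbTE ij) eqxx kj subr0.
  by apply=> //; rewrite subr0; exact: oner_neq0.
- move=> i k ik lik; apply: (form_coprime (Some (true, i, k)) None (fun a => (a == i)%:R) 1) => //.
    by rewrite /= eqxx gtn_eqF ?subr0 ?subrr //; case/andP: ik.
  exact: oner_neq0.
have single x : arr_index e [set x] by split; [rewrite -card_gt0 cards1|exact: conn1].
have psi1 f g x : psi f g x = der_apply (psi f g) [set x] by rewrite /der_apply big_set1.
(* Singletons are connected, so each component of [psi f g] is, up to sign, one of the forms and
   depends linearly on [f] and [g]. *)
have psi_lin f g (c : nat -> S) k : (forall i, (i < N)%N -> f i = k + \sum_(j < N) c j * F j i) ->
    g = \sum_(j < N) c j * G j -> forall x, psi f g x = \sum_(j < N) c j * psi (F j) (G j) x.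
  move=> ef eg x; rewrite psi1; have [w [b [Hw hx]]] := psi_conn _ (single x).
  under eq_bigr => j _ do rewrite psi1 hx mulrCA.
  rewrite hx -mulr_sumr; congr (_ * _).
  exact: (shi_form_sum ef eg Hw).
exists N, (fun j x => psi (F j) (G j) x); split.
- by move=> j; apply: Plog; exact: BL.
- move=> th Lth; have [f [g eth]] := psi_surj th.
  have {}Lth : logder e (psi f g).
    by move=> I /Lth[h eh]; exists h; rewrite -eh; apply: eq_bigr => x _; rewrite eth.
  have [k [c [ef eg]]] := Bspan _ _ (logP _ _ Lth).
  by exists (fun j => c j) => x; rewrite eth (psi_lin f g c k).
- move=> c c0.
  pose c' j := if insub j is Some j' then c j' else 0.
  have cE (j : 'I_N) : c' j = c j by rewrite /c' valK.
  pose f i := \sum_(j < N) c' j * F j i; pose g := \sum_(j < N) c' j * G j.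
  have p0 x : psi f g x = 0.
    rewrite (psi_lin f g c' 0) // => [|i _]; last by rewrite add0r.
    by rewrite -[RHS](c0 x); apply: eq_bigr => j _; rewrite cE.
  have form0 w : shi_index lam N w -> shi_form w f g = 0.
    move=> /psi_form[I [b [_ hI]]]; have := hI f g.
    rewrite /der_apply big1 => [/esym/eqP|x _]; last exact: p0.
    by rewrite mulf_eq0 signr_eq0 => /eqP.
  move=> j; rewrite -cE; apply: (Bind c' (f 0%N)) => //; last exact: (form0 None).
  move=> i iN; rewrite -/(f i); case: i iN => [//|i] iN.
  have := form0 (Some (false, 0%N, i.+1)); rewrite /= subr0 => h.
  by apply/esym/eqP; rewrite -subr_eq0; apply/eqP/h.
Qed.
End ShiChart.

(** * Charts for a pendant vertex, a cycle and a triangle *)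

Section Charts.
Variables (n : nat) (e : rel 'I_n) (z : 'I_n) (s : seq 'I_n).
Hypothesis e_sym : ssrbool.symmetric e.
Hypothesis e_irr : irreflexive e.
Hypothesis zs_uniq : uniq (z :: s).
Hypothesis zs_cover : forall x, x \in z :: s.
Hypothesis s_path : induced_path e z s.
Notation M := (size s).
Notation S := (Spoly n).
Implicit Types (I : {set 'I_n}) (x : 'I_n) (a b t i j k : nat) (f p : nat -> S) (g q : S).

(** Since the component at position [t] is [p t - p t.+1], the sum over the segment from [a] to [b]
    telescopes to [p a - p b]. *)
Definition path_derivation p q : derivation n :=
  fun x => if x == z then q else p (index x s) - p (index x s).+1.

Lemma path_derivation_surj (h : derivation n) :
  exists p, forall q, q = h z -> forall x, h x = path_derivation p q x.
Proof.
exists (fun t => \sum_(t <= u < M) h (nth z s u)) => q -> x.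
rewrite /path_derivation; case: eqP => [->//|/eqP xz].
have xs : x \in s by have := zs_cover x; rewrite inE (negbTE xz).
by rewrite big_ltn ?index_mem // nth_index // addrK.
Qed.

Lemma der_interval p q a b : (a <= b <= M)%N ->
  der_apply (path_derivation p q) (segment s a b) = p a - p b.
Proof.
rewrite /der_apply; elim: b => [|b IH] /andP[]; rewrite leq_eqVlt => /orP[/eqP<- _|//].
- by rewrite interval0 // big_set0 subrr.
- by rewrite interval0 // big_set0 subrr.
rewrite ltnS => ab bM; rewrite (interval_recr zs_uniq zs_cover) ?ab //.
rewrite big_setU1 /=; last by rewrite (mem_nth_interval zs_uniq) // ltnn andbF.
rewrite IH ?ab 1?ltnW // /path_derivation (nth_neq_z zs_uniq) // index_uniq //; last by case/andP: zs_uniq.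
by ring.
Qed.

Lemma der_z_segment p q a b : (a <= b <= M)%N ->
  der_apply (path_derivation p q) (z |: segment s a b) = q + (p a - p b).
Proof.
move=> ab; rewrite /der_apply big_setU1 /=; last exact: z_notin_interval.
by rewrite -[\sum_(i in _) _]/(der_apply _ _) der_interval // /path_derivation eqxx.
Qed.

Lemma der_z_segment2 p q a b : (a <= b <= M)%N ->
  der_apply (path_derivation p q) (z |: (segment s 0 a :|: segment s b M)) =
    q + (p 0%N - p a) + (p b - p M).
Proof.
move=> ab; have ab' : (0 <= a <= M)%N /\ (b <= M <= M)%N by lia.
have zI : z \notin segment s 0 a :|: segment s b M.
  by rewrite in_setU !(negbTE (z_notin_interval zs_uniq _ _)).
rewrite /der_apply big_setU1 //= (eq_bigl [predU segment s 0 a & segment s b M]); last first.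
  by move=> x; rewrite /= in_setU.
rewrite bigU; last first.
  by apply/pred0P => x; rewrite /= !inE; case: (x \in s) => //=; lia.
rewrite -[\sum_(i in segment s 0 a) _]/(der_apply _ _) -[\sum_(i in segment s b M) _]/(der_apply _ _).
by rewrite !der_interval ?ab'.1 ?ab'.2 // /path_derivation eqxx addrA.
Qed.

Ltac solve_form := rewrite /= ?expr0 ?expr1; ring.

(** Here [T] is minus the variable of [z]. A segment from [a] to [b] can be joined to [z] exactly
    when [a <= k < b], that is, when its end nodes lie on different sides of [k]. *)
Lemma pendant_chart k : (s = [::] \/ (k < M)%N) ->
  (forall i, (i < M)%N -> e z (nth z s i) = (i == k)) ->
  shi_chart e (fun i => (k < i)%N) M.+1 (fun f g => path_derivation f (- g)).
Proof.
move=> kM ez; split.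
- move=> h; have [p hp] := path_derivation_surj h.
  by exists p, (- h z) => x; rewrite (hp (- - h z)) // opprK.
- move=> I aI; have [zI|zI] := boolP (z \in I); last first.
    have [a [b [ab ->]]] := conn_shape zs_uniq zs_cover s_path aI zI.
    exists (Some (false, a, b)), false; split; first by split=> //; lia.
    by move=> f g; rewrite der_interval; [solve_form|lia].
  have [|->|[a [b [t [tab bM ezt ->]]]]] := conn_shape_z e_irr zs_uniq zs_cover s_path aI zI.
    by move=> i j iM jM; rewrite !ez //; lia.
    exists None, true; split=> // f g; rewrite der_z_segment //; solve_form.
  rewrite ez in ezt; last by lia.
  exists (Some (true, a, b)), false; split; first by rewrite /=; lia.
  by move=> f g; rewrite der_z_segment; [solve_form|lia].
- case=> [[[b i] j] [ij lij]|_]; last first.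
    exists (z |: segment s 0 0), true; split; last first.
      by move=> f g; rewrite der_z_segment //; solve_form.
    by apply: arr_index_z; rewrite interval0 // setU0; exact: conn1.
  case: b lij => lij; last first.
    exists (segment s i j), false; split; first by apply: arr_index_interval => //; lia.
    by move=> f g; rewrite der_interval; [solve_form|lia].
  have {}lij := lij isT; exists (z |: segment s i j), false; split.
    apply: arr_index_z; apply: (@conn_interval_z _ e z s e_sym zs_uniq zs_cover s_path i j k) => //; [lia|lia|].
    by rewrite ez ?eqxx //; lia.
  by move=> f g; rewrite der_z_segment; [solve_form|lia].
Qed.

(** Here [T] is the sum of all variables. A connected set containing [z] is the complement of a
    segment, so its form is [T] minus [Y_a - Y_b]; all pairs occur, whence [lam = id]. *)
Lemma cycle_chart : (1 < M)%N ->
  (forall i, (i < M)%N -> e z (nth z s i) = (i == 0) || (i.+1 == M)) ->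
  shi_chart e id M.+1 (fun f g => path_derivation f (f M - f 0%N + g)).
Proof.
move=> M1 ez; split.
- move=> h; have [p hp] := path_derivation_surj h.
  by exists p, (h z - p M + p 0%N) => x; apply: hp; ring.
- move=> I aI; have [zI|zI] := boolP (z \in I); last first.
    have [a [b [ab ->]]] := conn_shape zs_uniq zs_cover s_path aI zI.
    exists (Some (false, a, b)), false; split; first by split=> //; lia.
    by move=> f g; rewrite der_interval; [solve_form|lia].
  have [|a [b [ab ->]]] := conn_shape_z2 zs_uniq zs_cover s_path aI zI.
    by move=> i iM; rewrite ez.
  have [eab|nab] := eqVneq a b.
    exists None, false; split=> // f g; rewrite der_z_segment2 // eab; solve_form.
  exists (Some (true, a, b)), true; split; first by rewrite /=; lia.
  by move=> f g; rewrite der_z_segment2 //; solve_form.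
have conn_ab a b : (a <= b <= M)%N -> arr_index e (z |: (segment s 0 a :|: segment s b M)).
  move=> ab; apply: arr_index_z; apply: (conn_interval_z2 e_sym zs_uniq zs_cover s_path ab); first by lia.
    by rewrite ez //; lia.
  by rewrite ez; lia.
case=> [[[b i] j] [ij lij]|_]; last first.
  exists (z |: (segment s 0 0 :|: segment s 0 M)), false; split; first exact: conn_ab.
  by move=> f g; rewrite der_z_segment2 //; solve_form.
case: b lij => lij; last first.
  exists (segment s i j), false; split; first by apply: arr_index_interval => //; lia.
  by move=> f g; rewrite der_interval; [solve_form|lia].
exists (z |: (segment s 0 i :|: segment s j M)), true; split; first by apply: conn_ab; lia.
by move=> f g; rewrite der_z_segment2; [solve_form|lia].
Qed.
Definition triangle_sums k f g t : S :=
  if (t <= k)%N then f t.+1 - g else if t == k.+1 then f 0%N - g else f t.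

Lemma triangle_chart k : (k.+1 < M)%N ->
  (forall i, (i < M)%N -> e z (nth z s i) = (i == k) || (i == k.+1)) ->
  shi_chart e (fun i => (0 < i) + (k.+1 < i))%N M.+1
    (fun f g => path_derivation (triangle_sums k f g) g).
Proof.
move=> kM ez; set P := triangle_sums k.
have Pl f g t : (t <= k)%N -> P f g t = f t.+1 - g by move=> tk; rewrite /P /triangle_sums tk.
have Pm f g : P f g k.+1 = f 0%N - g by rewrite /P /triangle_sums ltnn eqxx.
have Pr f g t : (k.+1 < t)%N -> P f g t = f t.
  by move=> kt; rewrite /P /triangle_sums leqNgt (ltnW kt) /= gtn_eqF.
have conn_ab a b : (a <= k.+1)%N -> (k < b)%N -> (a < b <= M)%N -> arr_index e (z |: segment s a b).
  move=> ak kb ab; apply: arr_index_z.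
  have [ek|ek] := eqVneq a k.+1.
    apply: (@conn_interval_z _ e z s e_sym zs_uniq zs_cover s_path a b k.+1) => //; [lia|lia|].
    by rewrite ez ?eqxx ?orbT.
  apply: (@conn_interval_z _ e z s e_sym zs_uniq zs_cover s_path a b k) => //; [lia|lia|].
  by rewrite ez ?eqxx //; lia.
split.
- move=> h; have [p hp] := path_derivation_surj h.
  exists (fun i => if i is i'.+1 then (if (i' <= k)%N then p i' + h z else p i) else p k.+1 + h z), (h z) => x.
  rewrite (hp (h z)) // /path_derivation; case: eqP => // _.
  suff E t : P (fun i => if i is i'.+1 then (if (i' <= k)%N then p i' + h z else p i) else p k.+1 + h z) (h z) t = p t.
    by rewrite !E.
  case: (ltngtP t k.+1) => tk; first by rewrite Pl // -ltnS tk addrK.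
    by rewrite Pr //; case: t tk => [//|t] tk; rewrite leqNgt -ltnS tk.
  by rewrite tk Pm addrK.
- move=> I aI; have [zI|zI] := boolP (z \in I); last first.
    have [a [b [ab ->]]] := conn_shape zs_uniq zs_cover s_path aI zI.
    have D f g : der_apply (path_derivation (P f g) g) (segment s a b) = P f g a - P f g b.
      by rewrite der_interval //; lia.
    case: (ltngtP a k.+1) => ak; case: (ltngtP b k.+1) => bk; try by exfalso; lia.
    + exists (Some (false, a.+1, b.+1)), false; split; first by split=> //; lia.
      by move=> f g; rewrite D !Pl //; solve_form.
    + exists (Some (true, a.+1, b)), false; split; first by split=> //; lia.
      by move=> f g; rewrite D Pl // Pr //; solve_form.
    + exists (Some (false, 0, a.+1)), true; split; first by split=> //; lia.
      by move=> f g; rewrite D bk Pl // Pm //; solve_form.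
    + exists (Some (false, a, b)), false; split; first by split=> //; lia.
      by move=> f g; rewrite D !Pr //; solve_form.
    + exists (Some (true, 0, b)), false; split; first by split=> //; lia.
      by move=> f g; rewrite D ak Pm Pr //; solve_form.
  have [|->|[a [b [t [tab bM ezt ->]]]]] := conn_shape_z e_irr zs_uniq zs_cover s_path aI zI.
  + by move=> i j iM jM; rewrite !ez //; lia.
  + by exists None, false; split=> // f g; rewrite der_z_segment //; solve_form.
  have tM : (t < M)%N by lia.
  have {ezt} tk : t = k \/ t = k.+1 by rewrite ez // in ezt; lia.
  have D f g : der_apply (path_derivation (P f g) g) (z |: segment s a b) = g + (P f g a - P f g b).
    by rewrite der_z_segment //; lia.
  case: (ltngtP a k.+1) => ak; case: (ltngtP b k.+1) => bk; try by exfalso; lia.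
  + exists (Some (false, a.+1, b)), false; split; first by split=> //; lia.
    by move=> f g; rewrite D Pl // Pr //; solve_form.
  + exists (Some (true, 0, a.+1)), true; split; first by split=> //; lia.
    by move=> f g; rewrite D bk Pl // Pm //; solve_form.
  + exists (Some (false, 0, b)), false; split; first by split=> //; lia.
    by move=> f g; rewrite D ak Pm Pr //; solve_form.
case=> [[[b i] j] [ij lij]|_]; last first.
  exists (z |: segment s 0 0), false; split; last first.
    by move=> f g; rewrite der_z_segment //; solve_form.
  by apply: arr_index_z; rewrite interval0 // setU0; exact: conn1.
case: j ij lij => [|j] ij lij; first by exfalso; lia.
case: b lij => lij.
  have {}lij := lij isT.
  case: i ij lij => [|i] ij lij; case: (leqP j k) => jk; try by exfalso; lia.
  - exists (z |: segment s j k.+1), true; split; first by apply: conn_ab; lia.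
    by move=> f g; rewrite der_z_segment ?Pm ?Pl //; [solve_form|lia].
  - exists (segment s k.+1 j.+1), false; split; first by apply: arr_index_interval => //; lia.
    by move=> f g; rewrite der_interval ?Pm ?Pr //; [solve_form|lia].
  - exists (segment s i j.+1), false; split; first by apply: arr_index_interval => //; lia.
    by move=> f g; rewrite der_interval ?(Pl f g i) ?(Pr f g j.+1) //; [solve_form|lia|lia].
case: i ij {lij} => [|i] ij; case: (leqP j k) => jk.
- exists (segment s j k.+1), true; split; first by apply: arr_index_interval => //; lia.
  by move=> f g; rewrite der_interval ?Pm ?Pl //; [solve_form|lia].
- exists (z |: segment s k.+1 j.+1), false; split; first by apply: conn_ab; lia.
  by move=> f g; rewrite der_z_segment ?Pm ?Pr //; [solve_form|lia].
- exists (segment s i j), false; split; first by apply: arr_index_interval => //; lia.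
  by move=> f g; rewrite der_interval ?Pl //; [solve_form|lia|lia].
have [ik|ik] := leqP i k.
  exists (z |: segment s i j.+1), false; split; first by apply: conn_ab; lia.
  by move=> f g; rewrite der_z_segment ?(Pl f g i) ?(Pr f g j.+1) //; [solve_form|lia].
exists (segment s i.+1 j.+1), false; split; first by apply: arr_index_interval => //; lia.
by move=> f g; rewrite der_interval ?Pr //; [solve_form|lia].
Qed.
End Charts.

Theorem path_plus_vertex_free n (e : rel 'I_n) :
  ssrbool.symmetric e -> irreflexive e -> path_plus_vertex e -> arr_free e.
Proof.
move=> e_sym e_irr [z [s [us cov sp [[k [kM ez]]|[k [kM ez]]|[M1 ez]]]]].
- apply: shi_chart_free (pendant_chart e_sym e_irr us cov sp kM ez) => // i j ij.
  by case: (ltnP k i) => // ki; rewrite (leq_trans ki).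
- apply: shi_chart_free (triangle_chart e_sym e_irr us cov sp kM ez) => // i j ij.
  by lia.
- exact: shi_chart_free (cycle_chart e_sym us cov sp M1 ez).
Qed.

From mathcomp Require Import all_classical all_reals all_analysis.
From mathcomp Require Import Rstruct Rstruct_topology.
Import numFieldNormedType.Exports.
Local Open Scope classical_set_scope.
Local Open Scope ring_scope.

(** * The Poincare-Miranda theorem *)

Lemma cont_comp_top (T U W : topologicalType) (f : T -> U) (g : U -> W) :
  continuous f -> continuous g -> continuous (fun x => g (f x)).
Proof. by move=> cf cg x; apply: continuous_comp; [exact: cf|exact: cg]. Qed.

Section RealContinuity.
Variables (R : realType) (T : topologicalType).
Implicit Types f g : T -> R.

Lemma contD f g : continuous f -> continuous g -> continuous (fun x => f x + g x).
Proof. by move=> cf cg x; apply: cvgD; [exact: cf|exact: cg]. Qed.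

Lemma contB f g : continuous f -> continuous g -> continuous (fun x => f x - g x).
Proof. by move=> cf cg x; apply: cvgB; [exact: cf|exact: cg]. Qed.

Lemma contN f : continuous f -> continuous (fun x => - f x).
Proof. by move=> cf x; apply: cvgN; exact: cf. Qed.

Lemma contM f g : continuous f -> continuous g -> continuous (fun x => f x * g x).
Proof. by move=> cf cg x; apply: cvgM; [exact: cf|exact: cg]. Qed.

Lemma contV f : (forall x, f x != 0) -> continuous f -> continuous (fun x => (f x)^-1).
Proof. by move=> f0 cf x; apply: cvgV => //; exact: cf. Qed.

Lemma contC (c : R) : continuous (fun _ : T => c).
Proof. by move=> x; exact: cvg_cst. Qed.

Lemma contX f n : continuous f -> continuous (fun x => f x ^+ n).
Proof.
move=> cf; elim: n => [|n IH]; first exact: contC.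
by under eq_fun do rewrite exprS; exact: contM.
Qed.

Lemma cont_norm f : continuous f -> continuous (fun x => `|f x|).
Proof. by move=> cf x; apply: cvg_norm; exact: cf. Qed.

Lemma cont_comp (h : R -> R) f : continuous h -> continuous f -> continuous (fun x => h (f x)).
Proof. by move=> ch cf x; apply: continuous_comp; [exact: cf|exact: ch]. Qed.

Lemma cont_sum I (r : seq I) (P : pred I) (F : I -> T -> R) :
  (forall i, continuous (F i)) -> continuous (fun x => \sum_(i <- r | P i) F i x).
Proof.
move=> cF; elim: r => [|i r IH].
  by under eq_fun do rewrite big_nil; exact: contC.
under eq_fun do rewrite big_cons.
by case: (P i) => //; exact: contD.
Qed.

Lemma cont_max f g : continuous f -> continuous g -> continuous (fun x => Num.max (f x) (g x)).
Proof. by move=> cf cg x; apply: continuous_max; [exact: cf|exact: cg]. Qed.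

Lemma cont_sqrt f : continuous f -> continuous (fun x => Num.sqrt (f x)).
Proof. by move=> cf; apply: cont_comp => //; exact: sqrt_continuous. Qed.
End RealContinuity.

Section RowVectors.
Variables (R : realType) (l : nat).
Notation V := 'rV[R]_l.
Implicit Types x y : V.

Lemma le_rV_norm x (c : R) : 0 <= c -> (`|x| <= c) = [forall i, `|x ord0 i| <= c].
Proof.
move=> c0; rewrite [`|x|]mx_normrE; apply/bigmax_leP/forallP => [[_ h] i|h].
  exact: (h (ord0, i)).
by split=> // -[i j] _ /=; rewrite (ord1 i).
Qed.

Lemma coord_le_norm x i : `|x ord0 i| <= `|x|.
Proof. by move: (lexx `|x|); rewrite le_rV_norm // => /forallP/(_ i). Qed.

Lemma cont_coord i : continuous (fun x => x ord0 i).
Proof. exact: coord_continuous. Qed.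

Lemma cont_rV (T : topologicalType) (f : T -> V) :
  (forall i, continuous (fun t => f t ord0 i)) -> continuous f.
Proof.
move=> cf t; apply/cvgrPdist_lt => e e0.
have /filter_forall H : forall i, \forall t' \near t, `|f t ord0 i - f t' ord0 i| < e.
  by move=> i; have /cvgrPdist_lt/(_ _ e0) := cf i t.
near=> t'.
have Ht' : forall i, `|f t ord0 i - f t' ord0 i| < e by near: t'; exact: H.
have : `|f t - f t'| \in [seq `|(f t - f t') ij.1 ij.2| | ij : 'I_1 * 'I_l] ++ [:: 0].
  rewrite mem_cat inE; have [->|] := eqVneq (`|f t - f t'|) 0; rewrite ?orbT ?orbF //.
  move=> /mx_norm_neq0[ij hij]; apply/mapP; exists ij; rewrite ?mem_enum //.
rewrite mem_cat inE => /orP[/mapP[[i j] _ ->]|/eqP-> //] /=.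
by rewrite (ord1 i) !mxE.
Unshelve. all: end_near. Qed.

Definition cube : set V := [set x | `|x| <= 1].

Lemma compact_cube : compact cube.
Proof.
apply: bounded_closed_compact.
  exists 1; split; first exact: num_real.
  by move=> M M1 x /= x1; apply: le_trans x1 (ltW M1).
apply: (@preimage_closed _ _ (fun x : V => `|x|) [set t : R | t <= 1]); last exact: closed_le.
by move=> x _; exact: norm_continuous.
Qed.

Lemma compact_unif_cont (K : set V) (f : V -> R) (e : R) :
  compact K -> continuous f -> 0 < e ->
  exists2 d : R, 0 < d & forall x y, K x -> `|x - y| < d -> `|f x - f y| < e.
Proof.
move=> /compact_near_coveringP cK cf e0.
have H : \forall d \near 0^'+, K `<=` (fun x => forall y, `|x - y| < d -> `|f x - f y| < e).
  apply: cK => x Kx.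
  have e20 : 0 < e / 2 by rewrite divr_gt0.
  have /cvgrPdist_lt/(_ _ e20)/nbhs_ballP[r /= r0 hr] := cf x.
  have hball (z : V) : `|x - z| < r -> `|f x - f z| < e / 2.
    by move=> h; apply: hr; rewrite -ball_normE /=.
  have r20 : 0 < r / 2 by rewrite divr_gt0.
  exists (ball x (r / 2), [set d | d < r / 2]); first split => /=.
  + exact: nbhsx_ballx.
  + exact: nbhs_right_lt.
  move=> [x' d] /= []; rewrite -ball_normE /= => xx' dr y x'y.
  have r1 : `|x - x'| < r by apply: lt_trans xx' _; rewrite ltr_pdivrMr // ltr_pMr // ltr1n.
  have r2 : `|x - y| < r.
    rewrite -(subrKA x') (splitr r); apply: le_lt_trans (ler_normD _ _) _.
    by apply: ltrD => //; exact: lt_trans dr.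
  rewrite -(subrKA (f x)) (splitr e); apply: le_lt_trans (ler_normD _ _) _.
  by rewrite distrC ltrD ?hball.
near (0 : R)^'+ => d; exists d; first by near: d; exact: nbhs_right_gt.
by near: d; apply: filterS H => d Hd x y Kx; exact: Hd.
Unshelve. all: end_near. Qed.
End RowVectors.

Arguments cube {R} l.

Section PoincareMiranda.
Variables (R : realType) (l : nat).
Notation V := 'rV[R]_l.

(** Truncation by [N] keeps every lattice point in the cube, because [cubical_sperner] speaks of
    colourings of the whole lattice. *)
Let gridpt N (q : {ffun 'I_l -> nat}) : V :=
  \row_i (-1 + 2 * (minn (q i) N)%:R / N%:R).

Let gridpt_coord N q i : (0 < N)%N ->
  [/\ gridpt N q ord0 i <= 1, -1 <= gridpt N q ord0 i,
   q i = 0%N -> gridpt N q ord0 i = -1 & q i = N -> gridpt N q ord0 i = 1].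
Proof.
move=> N0; rewrite mxE; have N0' : (0 : R) < N%:R by rewrite ltr0n.
have h : (minn (q i) N)%:R <= N%:R :> R by rewrite ler_nat geq_minr.
have h0 : 0 <= (minn (q i) N)%:R :> R by rewrite ler0n.
split.
- by rewrite -lerBrDl ler_pdivrMr //; lra.
- by rewrite lerDl divr_ge0 ?mulr_ge0.
- by move=> ->; rewrite min0n mulr0 mul0r addr0.
- by move=> ->; rewrite minnn mulfK ?gt_eqF //; lra.
Qed.

Let gridpt_cube N q : (0 < N)%N -> cube l (gridpt N q).
Proof.
move=> N0; rewrite /cube /= le_rV_norm //; apply/forallP => i.
by have [h1 h2 _ _] := gridpt_coord q i N0; rewrite ler_norml h1 h2.
Qed.

Let gridpt_close N (p q : {ffun 'I_l -> nat}) : (0 < N)%N -> (forall i, (p i <= q i <= (p i).+1)%N) ->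
  `|gridpt N p - gridpt N q| <= 2 / N%:R.
Proof.
move=> N0 pq; rewrite le_rV_norm ?divr_ge0 //; apply/forallP => i; rewrite !mxE.
have -> (a b c : R) : -1 + 2 * a / c - (-1 + 2 * b / c) = (a - b) * (2 / c) by lra.
have N0' : (0 : R) < N%:R by rewrite ltr0n.
rewrite normrM (@ger0_norm _ (2 / _)) ?divr_ge0 // ler_piMl ?divr_ge0 //.
have h1 : (minn (p i) N <= minn (q i) N)%N.
  by rewrite leq_min geq_minr andbT (leq_trans (geq_minl _ _)) //; case/andP: (pq i).
have h2 : (minn (q i) N <= (minn (p i) N).+1)%N.
  have /andP[_ h] := pq i; rewrite -(addn1 (minn (p i) N)) addn_minl addn1 leq_min.
  by rewrite (leq_trans (geq_minl _ _) h) (leq_trans (geq_minr _ _)) // leq_addr.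
rewrite distrC -natrB // normr_nat -[leRHS]/(1%:R) ler_nat leq_subLR addn1.
exact: h2.
Qed.

(** If the minimum [m] of the sum of the [|F j|] were positive, a grid on which each [F j] varies by
    less than [m / (l + 1)] would contain a cell where every [F j] changes sign. There the sum is at
    most [m l / (l + 1)], below the minimum. *)
Theorem poincare_miranda (F : 'I_l -> V -> R) :
  (forall j, continuous (F j)) ->
  (forall j (x : V), `|x| <= 1 -> x ord0 j = -1 -> F j x < 0) ->
  (forall j (x : V), `|x| <= 1 -> x ord0 j = 1 -> 0 < F j x) ->
  exists2 x, `|x| <= 1 & forall j, F j x = 0.
Proof.
move=> cF F0 F1.
pose m x := \sum_j `|F j x|.
have cm : continuous m by apply: cont_sum => j; exact: cont_norm.
have cube0 : @cube R l !=set0 by exists 0; rewrite /cube /= normr0.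
have [x0 x0K x0min] := EVT_min_rV cube0 (@compact_cube R l) (continuous_subspaceT cm).
have x01 : `|x0| <= 1 by move: x0K; rewrite inE.
have [m0|m0] := eqVneq (m x0) 0.
  exists x0 => // j; move/eqP: m0; rewrite psumr_eq0 //= => /allP/(_ j).
  by rewrite mem_index_enum normr_eq0 => /(_ isT)/eqP.
have {m0}mpos : 0 < m x0 by rewrite lt_def m0 sumr_ge0.
pose eta := m x0 / l.+1%:R.
have eta0 : 0 < eta by rewrite divr_gt0 // ltr0n.
have [d d0 Hd] : exists2 d : R, 0 < d & forall j x y,
    `|x| <= 1 -> `|x - y| < d -> `|F j x - F j y| < eta.
  have /boolp.choice[dd Hdd] : forall j, exists d : R, 0 < d /\ forall x y,
    `|x| <= 1 -> `|x - y| < d -> `|F j x - F j y| < eta.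
    move=> j; have [d d0 Hd] := compact_unif_cont (@compact_cube R l) (cF j) eta0.
    by exists d; split.
  exists (\big[Num.min/1]_j dd j).
    by elim/big_ind: _ => // [a b a0 b0|j _]; [rewrite lt_min a0 b0|have [] := Hdd j].
  move=> j x y x1 xy; have [_ h] := Hdd j; apply: h => //.
  by apply: lt_le_trans xy _; rewrite (bigD1 j) //= ge_min lexx.
pose N := (Num.trunc (2 / d)).+1.
have N0 : (0 < N)%N by [].
have Nd : 2 / N%:R < d.
  rewrite ltr_pdivrMr ?ltr0n // mulrC -ltr_pdivrMr //.
  exact: truncnS_gt.
pose c j (q : {ffun 'I_l -> nat}) := (0 <= F j (gridpt N q)).
have [||p [_ Hp]] := @cubical_sperner l N c.
- move=> j q q0; apply/negbTE; rewrite -ltNge; apply: F0; first exact: gridpt_cube.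
  by have [_ _ + _] := gridpt_coord q j N0; apply.
- move=> j q qN; apply/ltW/F1; first exact: gridpt_cube.
  by have [_ _ _ +] := gridpt_coord q j N0; apply.
have small j : `|F j (gridpt N p)| <= eta.
  have [q [q' [pq pq' cqq]]] := Hp j.
  have h1 := Hd j _ _ (gridpt_cube p N0) (le_lt_trans (gridpt_close N0 pq) Nd).
  have h2 := Hd j _ _ (gridpt_cube p N0) (le_lt_trans (gridpt_close N0 pq') Nd).
  move: h1 h2 cqq; rewrite /c !ltr_norml ler_norml => /andP[h1 h1'] /andP[h2 h2'].
  by case: (leP 0 (F j (gridpt N q))); case: (leP 0 (F j (gridpt N q'))) => //= h3 h4 _;
    apply/andP; split; lra.
have /x0min : gridpt N p \in @cube R l by rewrite inE; exact: gridpt_cube.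
rewrite leNgt => /negP[]; apply: (@le_lt_trans _ _ (eta *+ l)).
  rewrite -[X in _ *+ X]card_ord -sumr_const.
  by apply: ler_sum => j _; exact: small.
rewrite -mulr_natr /eta mulrAC ltr_pdivrMr ?ltr0n //.
by rewrite ltr_pM2l // ltr_nat.
Qed.
End PoincareMiranda.

(** * Angles along the boundary of a cube *)

Section Angles.
Variable R : realType.
Implicit Types x t c s : R.

Lemma cos_2piz x (k : int) : cos (x + 2 * pi * k%:~R) = cos x.
Proof.
have H y n : cos (y + 2 * pi * n%:R) = cos y :> R.
  have := periodicn (@cosD2pi R) n y; rewrite -mulr_natr => <-; congr cos.
  by rewrite -(mulr_natr pi); ring.
case: k => n; first exact: H.
by rewrite NegzE mulrNz mulrN -(H _ n.+1) subrK.
Qed.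

Lemma sin_2piz x (k : int) : sin (x + 2 * pi * k%:~R) = sin x.
Proof. by rewrite -cosBpihalf -(cosBpihalf x) addrAC cos_2piz. Qed.

Lemma unit_angle c s : c ^+ 2 + s ^+ 2 = 1 -> exists t, cos t = c /\ sin t = s.
Proof.
move=> cs1.
have c1 : -1 <= c <= 1.
  rewrite -ler_norml -[leRHS]sqrtr1 -sqrtr_sqr ler_sqrt // -cs1 lerDl.
  exact: sqr_ge0.
have hs : Num.sqrt (1 - c ^+ 2) = `|s| by rewrite -cs1 addrC addKr sqrtr_sqr.
have [s0|s0] := leP 0 s.
  by exists (acos c); rewrite acosK ?in_itv //= sin_acos // hs ger0_norm.
exists (- acos c); rewrite cosN sinN acosK ?in_itv //= sin_acos // hs ltr0_norm //.
by rewrite opprK.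
Qed.

Lemma atan_unit c s : 0 < c -> c ^+ 2 + s ^+ 2 = 1 ->
  cos (atan (s / c)) = c /\ sin (atan (s / c)) = s.
Proof.
move=> c0 cs1.
have hc : cos (atan (s / c)) = c.
  rewrite cos_atan; have -> : 1 + (s / c) ^+ 2 = (c^-1) ^+ 2.
    have c20 : c ^+ 2 != 0 by rewrite expf_neq0 // gt_eqF.
    by apply: (mulIf c20); rewrite mulrDl expr_div_n mulfVK // mul1r cs1 -exprMn mulVf ?expr1n ?gt_eqF.
  by rewrite sqrtr_sqr gtr0_norm ?invr_gt0 // invrK.
split=> //.
have := atanK (s / c); rewrite /tan hc => /(congr1 ( *%R^~ c)).
by rewrite !mulfVK // gt_eqF.
Qed.
End Angles.

(** * Continuous angles on the cube *)

Section Lifting.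
Variables (R : realType) (l : nat).
Notation V := 'rV[R]_l.

(** The radial retraction onto the cube; composing with it gives functions continuous on the whole
    space. *)
Definition clamp (x : V) : V := (Num.max 1 `|x|)^-1 *: x.

Lemma clamp_max_gt0 (x : V) : 0 < Num.max 1 `|x|.
Proof. by rewrite lt_max ltr01. Qed.

Lemma cont_clamp : continuous clamp.
Proof.
apply: cont_rV => i.
under eq_fun do rewrite mxE.
apply: contM; last exact: cont_coord.
apply: contV; first by move=> x; rewrite gt_eqF // clamp_max_gt0.
apply: cont_max; first exact: contC.
exact: norm_continuous.
Qed.

Lemma clamp_cube x : `|clamp x| <= 1.
Proof.
rewrite normrZ ger0_norm ?invr_ge0 ?(ltW (clamp_max_gt0 _)) //.
by rewrite mulrC ler_pdivrMr ?clamp_max_gt0 // mul1r le_max lexx orbT.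
Qed.

Lemma clamp_id x : `|x| <= 1 -> clamp x = x.
Proof. by move=> x1; rewrite /clamp max_l // invr1 scale1r. Qed.

(* The angle is accumulated along the ray from the origin, in steps so short
   that each quotient of consecutive values has positive real part. *)
Lemma angle_lift (u v : V -> R) : continuous u -> continuous v ->
  (forall x, u x ^+ 2 + v x ^+ 2 != 0) ->
  exists2 th : V -> R, continuous th & forall x, `|x| <= 1 ->
    u x = Num.sqrt (u x ^+ 2 + v x ^+ 2) * cos (th x) /\
    v x = Num.sqrt (u x ^+ 2 + v x ^+ 2) * sin (th x).
Proof.
move=> cu cv uv0.
pose rho x := Num.sqrt (u x ^+ 2 + v x ^+ 2).
have rho0 x : 0 < rho x.
  by rewrite sqrtr_gt0 lt_def uv0 /= addr_ge0 // sqr_ge0.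
have rhoN0 x : rho x != 0 by rewrite gt_eqF.
have crho : continuous rho by apply: cont_sqrt; apply: contD; exact: contX.
pose U x := u x / rho x; pose W x := v x / rho x.
have cU : continuous U by apply: contM => //; exact: contV.
have cW : continuous W by apply: contM => //; exact: contV.
have UW x : U x ^+ 2 + W x ^+ 2 = 1.
  rewrite /U /W !expr_div_n -mulrDl /rho sqr_sqrtr ?mulfV //.
  by rewrite addr_ge0 // sqr_ge0.
have [d1 d10 Hd1] := compact_unif_cont (@compact_cube R l) cU ltr01.
have [d2 d20 Hd2] := compact_unif_cont (@compact_cube R l) cW ltr01.
pose M := (Num.trunc (Num.max d1^-1 d2^-1)).+1.
have M0 : (0 : R) < M%:R by rewrite ltr0n.
have HM : Num.max d1^-1 d2^-1 < M%:R by exact: truncnS_gt.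
pose pt m x : V := (m%:R / M%:R) *: clamp x.
pose re m x := U (pt m x) * U (pt m.+1 x) + W (pt m x) * W (pt m.+1 x).
pose im m x := U (pt m x) * W (pt m.+1 x) - W (pt m x) * U (pt m.+1 x).
have cpt m : continuous (pt m).
  apply: cont_rV => i; under eq_fun do rewrite mxE.
  apply: contM; first exact: contC.
  exact: (cont_comp_top (g := fun y : V => y ord0 i) cont_clamp (@cont_coord R l i)).
have compc f m : continuous f -> continuous (fun x => f (pt m x) : R).
  by move=> cf; exact: (cont_comp_top (@cpt m)).
have ptM x : pt M x = clamp x by rewrite /pt mulfV ?scale1r // gt_eqF.
have reim m x : re m x ^+ 2 + im m x ^+ 2 = 1.
  rewrite /re /im -[RHS]mulr1 -{1}(UW (pt m x)) -(UW (pt m.+1 x)); ring.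
(* Consecutive unit vectors differ by less than 1 in each coordinate. The square of their distance,
   [2 - 2 re], is thus less than 2. *)
have re0 m x : (m < M)%N -> 0 < re m x.
  move=> mM.
  have ptc : cube l (pt m x).
    rewrite /cube /= normrZ ger0_norm ?divr_ge0 // mulr_ile1 ?clamp_cube ?divr_ge0 //.
    by rewrite ler_pdivrMr // mul1r ler_nat ltnW.
  have dist : `|pt m x - pt m.+1 x| <= M%:R^-1.
    rewrite -scalerBl normrZ -mulrBl normrM.
    have -> : m%:R - m.+1%:R = -1 :> R by rewrite -natr1; ring.
    rewrite normrN1 mul1r ger0_norm ?invr_ge0 // ler_piMr ?invr_ge0 //.
    exact: clamp_cube.
  move: HM; rewrite gt_max => /andP[HM1 HM2].
  have /Hd1-/(_ ptc) : `|pt m x - pt m.+1 x| < d1.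
    by apply: le_lt_trans dist _; rewrite invf_plt ?posrE.
  have /Hd2-/(_ ptc) : `|pt m x - pt m.+1 x| < d2.
    by apply: le_lt_trans dist _; rewrite invf_plt ?posrE.
  have := UW (pt m x); have := UW (pt m.+1 x); rewrite /re !ltr_norml.
  move: (U _) (W _) (U _) (W _) => a b c e h1 h2 /andP[h3 h4] /andP[h5 h6].
  have : (c - a) ^+ 2 < 1 by nra.
  have : (e - b) ^+ 2 < 1 by nra.
  nra.
have [t0 [ct0 st0]] := unit_angle (UW 0).
pose th x := t0 + \sum_(m < M) atan (im m x / re m x).
exists th.
  apply: contD; first exact: contC.
  apply: cont_sum => m; apply: cont_comp; first by move=> ?; exact: continuous_atan.
  apply: contM; last apply: contV.
  - by apply: contB; apply: contM; exact: compc.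
  - by move=> x; rewrite gt_eqF // re0.
  - by apply: contD; apply: contM; exact: compc.
move=> x x1.
have H k : (k <= M)%N -> cos (t0 + \sum_(m < k) atan (im m x / re m x)) = U (pt k x) /\
    sin (t0 + \sum_(m < k) atan (im m x / re m x)) = W (pt k x).
  elim: k => [_|k IH kM]; first by rewrite big_ord0 addr0 /pt mul0r scale0r.
  rewrite big_ord_recr /= addrA trigo.sinD trigo.cosD.
  have [-> ->] := IH (ltnW kM).
  have [-> ->] := atan_unit (re0 k x kM) (reim k x).
  have := UW (pt k x); rewrite /re /im.
  move: (U _) (W _) (U _) (W _) => a b c e h.
  by split; [rewrite -[RHS]mul1r -h; ring | rewrite -[RHS]mul1r -h; ring].
have [] := H M (leqnn _); rewrite ptM clamp_id // /th => -> ->.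
by rewrite /U /W !mulrA !(mulrC (rho x)) !mulfK ?rhoN0 //; split; rewrite mulrC divfK.
Qed.
End Lifting.

(** * Angles on the boundary of the cube and the obstruction to a filling *)

Section CubeBoundary.
Variables (R : realType) (l : nat).
Hypothesis l1 : (1 < l)%N.
Notation V := 'rV[R]_l.

Section HalfIntegerFree.
Variable phi : V -> R.
Hypothesis cphi : continuous phi.
Hypothesis phi_half : forall (x : V) (k : int), `|x| = 1 -> phi x != k%:~R + 2^-1.

Let lev x : int := Num.floor (phi x + 2^-1).

Let lev_bound x : `|x| = 1 -> (lev x)%:~R - 2^-1 < phi x /\ phi x < (lev x)%:~R + 2^-1.
Proof.
move=> x1; have := floorD1_gt (phi x + 2^-1); have := floor_le_tmp (phi x + 2^-1).
rewrite -/(lev x) intrD => h1 h2; have := phi_half (lev x - 1) x1.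
rewrite intrD => /eqP h3; split; last by lra.
by rewrite lt_def; apply/andP; split; [apply/eqP => h; apply: h3; lra|lra].
Qed.

Let lev_le_face (i : 'I_l) (x y : V) : `|x| <= 1 -> `|y| <= 1 ->
  `|x ord0 i| = 1 -> x ord0 i = y ord0 i -> lev x <= lev y.
Proof.
move=> x1 y1 xi xy; rewrite leNgt; apply/negP => yx.
pose g (t : R) : V := x + t *: (y - x).
have g1 t : 0 <= t <= 1 -> `|g t| = 1.
  move=> /andP[t0 t1]; apply/eqP; rewrite eq_le; apply/andP; split.
    have -> : g t = (1 - t) *: x + t *: y by rewrite /g scalerBr scalerBl scale1r addrCA addrA [in RHS]addrC addrA; congr (_ + _); rewrite addrC.
    apply: le_trans (ler_normD _ _) _; rewrite !normrZ !ger0_norm ?subr_ge0 //.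
    have : (1 - t) * `|x| <= (1 - t) by rewrite ler_piMr ?subr_ge0.
    have : t * `|y| <= t by rewrite ler_piMr.
    by lra.
  by rewrite -xi; apply: le_trans (coord_le_norm (g t) i); rewrite !mxE -xy subrr mulr0 addr0.
have cg : continuous g.
  apply: cont_rV => j; under eq_fun do rewrite !mxE.
  by apply: contD; [exact: contC|apply: contM; [move=> ?; exact: cvg_id|exact: contC]].
have g00 : g 0 = x by rewrite /g scale0r addr0.
have g11 : g 1 = y by rewrite /g scale1r addrC subrK.
have x1' : `|x| = 1 by rewrite -g00 g1 // lexx ler01.
have y1' : `|y| = 1 by rewrite -g11 g1 // lexx ler01.
have [a1 a2] := lev_bound x1'; have [b1 b2] := lev_bound y1'.
have hlev : (lev y)%:~R + 1 <= (lev x)%:~R :> R.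
  by rewrite -[1]/(1%:~R) -intrD ler_int lezD1.
have c1 : {within `[0, 1], continuous (phi \o g)}.
  by apply: continuous_subspaceT; exact: (cont_comp_top cg cphi).
have [|t] := @IVT _ _ 0 1 ((lev y)%:~R + 2^-1) ler01 c1.
  rewrite /= g00 g11 ge_min le_max; apply/andP; split; apply/orP; first by right; lra.
  by left; lra.
rewrite in_itv /= => t01 /eqP; apply/negP; exact: phi_half (g1 t t01).
Qed.

Let lev_face (i : 'I_l) (x y : V) : `|x| <= 1 -> `|y| <= 1 ->
  `|x ord0 i| = 1 -> x ord0 i = y ord0 i -> lev x = lev y.
Proof.
move=> x1 y1 xi xy; apply/eqP; rewrite eq_le (lev_le_face x1 y1 xi xy).
by rewrite (lev_le_face y1 x1 (i := i)) // -xy.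
Qed.

Let norm_face (x : V) : `|x| = 1 -> exists i, `|x ord0 i| = 1.
Proof.
move=> x1; have /mx_norm_neq0[[j i] /= h] : mx_norm x != 0.
  by rewrite -[mx_norm x]/(`|x|) x1 oner_eq0.
by exists i; rewrite -x1 [RHS]h (ord1 j).
Qed.

Let corner (i j : 'I_l) (a b : R) : V := \row_k (if k == i then a else if k == j then b else 0).

Let corner_norm i j a b : `|a| = 1 -> `|b| = 1 -> `|corner i j a b| <= 1.
Proof.
move=> a1 b1; rewrite le_rV_norm //; apply/forallP => k; rewrite mxE.
by case: ifP => _; [rewrite a1|case: ifP => _; [rewrite b1|rewrite normr0]].
Qed.

Let lev_two_faces i j (x y : V) : i != j -> `|x| <= 1 -> `|y| <= 1 ->
  `|x ord0 i| = 1 -> `|y ord0 j| = 1 -> lev x = lev y.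
Proof.
move=> ij x1 y1 xi yj.
pose z := corner i j (x ord0 i) (y ord0 j).
have z1 : `|z| <= 1 by exact: corner_norm.
rewrite (@lev_face i x z) //; last by rewrite mxE eqxx.
by rewrite (@lev_face j z y) // mxE eq_sym (negbTE ij) eqxx.
Qed.

(** The boundary of a cube of dimension at least two is connected, so the nearest integer to [phi]
    is constant on it. Points of one face are joined by a segment; faces in different directions
    share a [corner], and opposite faces are linked through a third one. *)
Lemma boundary_level : exists n : int, forall x : V, `|x| = 1 -> `|phi x - n%:~R| < 2^-1.
Proof.
pose i0 : 'I_l := Ordinal (ltnW l1); pose i1 : 'I_l := Ordinal l1.
have i01 : i0 != i1 by [].
pose x0 := corner i0 i1 1 1.
have x01 : `|x0| <= 1 by apply: corner_norm; exact: normr1.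
have x0i0 : `|x0 ord0 i0| = 1 by rewrite mxE eqxx normr1.
have x0i1 : `|x0 ord0 i1| = 1 by rewrite mxE eq_sym (negbTE i01) eqxx normr1.
exists (lev x0) => x x1; have [i xi] := norm_face x1.
suff -> : lev x0 = lev x.
  by have [h1 h2] := lev_bound x1; rewrite ltr_norml; apply/andP; split; lra.
have [ii0|ii0] := eqVneq i i0.
  by apply: (@lev_two_faces i1 i) => //; rewrite ?x1 // ii0 eq_sym.
by apply: (@lev_two_faces i0 i) => //; rewrite ?x1 // eq_sym.
Qed.
End HalfIntegerFree.

(* On the boundary of the cube the j-th angle stays within pi of
   pi (x_j + 1), up to a constant multiple of 2 pi; Poincare-Miranda then
   yields a point where every (u_j, v_j) is a negative real. *)
Theorem no_cube_filling (u v : 'I_l -> V -> R) :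
  (forall j, continuous (u j)) -> (forall j, continuous (v j)) ->
  (forall j x, u j x ^+ 2 + v j x ^+ 2 != 0) ->
  (forall (x : V) j, `|x| = 1 ->
     u j x * cos (pi * x ord0 j) + v j x * sin (pi * x ord0 j) < 0) ->
  exists x, forall j, u j x < 0 /\ v j x = 0.
Proof.
move=> cu cv uv0 bd.
have /boolp.choice[th Hth] : forall j, exists th : V -> R, continuous th /\
    forall x, `|x| <= 1 ->
    u j x = Num.sqrt (u j x ^+ 2 + v j x ^+ 2) * cos (th x) /\
    v j x = Num.sqrt (u j x ^+ 2 + v j x ^+ 2) * sin (th x).
  by move=> j; have [th h1 h2] := angle_lift (cu j) (cv j) (uv0 j); exists th.
have pi0 : (0 : R) < pi := pi_gt0 R.
have tpi0 : 2 * pi != 0 :> R by rewrite mulf_neq0 ?gt_eqF.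
have rho0 j x : 0 < Num.sqrt (u j x ^+ 2 + v j x ^+ 2).
  by rewrite sqrtr_gt0 lt_def uv0 /= addr_ge0 // sqr_ge0.
pose phi j x := (th j x - pi * (x ord0 j + 1)) / (2 * pi).
have cphi j : continuous (phi j).
  apply: contM; last exact: contC.
  apply: contB; first by have [] := Hth j.
  apply: contM; first exact: contC.
  by apply: contD; [exact: cont_coord|exact: contC].
(* At a half-integer the angle would be [pi x_j] modulo [2 pi], and the expression in [bd] would
   equal the positive radius. *)
have half j (x : V) (k : int) : `|x| = 1 -> phi j x != k%:~R + 2^-1.
  move=> x1; apply/eqP => h.
  have hth : th j x = pi * x ord0 j + pi + pi + 2 * pi * k%:~R.
    move: h; rewrite /phi => /(congr1 ( *%R^~ (2 * pi))).
    rewrite divfK // => /eqP; rewrite subr_eq => /eqP ->.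
    by field.
  have [_ /(_ x)[|hu hv]] := Hth j; first by rewrite x1.
  have := bd x j x1; have := rho0 j x; move: (Num.sqrt _) hu hv => r -> -> r0.
  rewrite hth cos_2piz sin_2piz !(cosDpi, sinDpi) !opprK.
  by rewrite -!mulrA -mulrDr -!expr2 cos2Dsin2 mulr1 ltNge (ltW r0).
have /boolp.choice[n Hn] : forall j, exists n : int, forall x : V, `|x| = 1 ->
    `|phi j x - n%:~R| < 2^-1.
  by move=> j; exact: (boundary_level (cphi j) (half j)).
have Hn' j (x : V) : `|x| = 1 ->
    pi * x ord0 j + 2 * pi * (n j)%:~R < th j x < pi * x ord0 j + 2 * pi * (n j)%:~R + 2 * pi.
  move=> /(Hn j); rewrite ltr_norml /phi => /andP[].
  set a := _ / _; set b := (n j)%:~R; move=> h1 h2.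
  have -> : th j x = a * (2 * pi) + pi * (x ord0 j + 1) by rewrite divfK // subrK.
  have h3 : 0 < pi * (a - b + 2^-1) by rewrite mulr_gt0 //; lra.
  have h4 : 0 < pi * (2^-1 - (a - b)) by rewrite mulr_gt0 //; lra.
  by apply/andP; split; lra.
(* A zero of [F j] is a point where the angle is [pi] modulo [2 pi]. The bounds on the boundary give
   [F j] opposite signs on the two faces in direction [j]. *)
pose F j x := th j x - pi - 2 * pi * (n j)%:~R.
have face1 j (x : V) : `|x| <= 1 -> `|x ord0 j| = 1 -> `|x| = 1.
  by move=> x1 xj; apply/eqP; rewrite eq_le x1 -xj coord_le_norm.
have [||| x x1 Hx] := @poincare_miranda R l F.
- move=> j; apply: contB; last exact: contC.
  by apply: contB; last exact: contC; have [] := Hth j.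
- move=> j x x1 xj; have /Hn'-/(_ j) : `|x| = 1 by apply: (face1 j); rewrite // xj normrN1.
  by rewrite /F xj => /andP[h1 h2]; lra.
- move=> j x x1 xj; have /Hn'-/(_ j) : `|x| = 1 by apply: (face1 j); rewrite // xj normr1.
  by rewrite /F xj => /andP[h1 h2]; lra.
exists x => j; have [_ /(_ x x1)[hu hv]] := Hth j.
have hth : th j x = 0 + pi + 2 * pi * (n j)%:~R by move: (Hx j); rewrite /F => h; lra.
have := rho0 j x; move: (Num.sqrt _) hu hv => r -> -> r0.
by rewrite hth cos_2piz sin_2piz cosDpi sinDpi cos0 sin0 oppr0 mulr0 mulrN1 oppr_lt0.
Qed.
End CubeBoundary.

(** * Spheres in complements of hyperplanes *)

(** The bound on the image is what localization works with: it determines how far the sphere has to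
    be translated along a flat. *)
Definition pi_trivial_bounded n (X : set (Cn n)) (k : nat) : Prop :=
  forall f : 'rV[Rl]_(k.+1) -> Cn n,
    {within (usphere k), continuous f} -> f @` (usphere k) `<=` X ->
    (exists C : Rl, forall v, usphere k v -> `|(f v).1| <= C /\ `|(f v).2| <= C) ->
    exists g : 'rV[Rl]_(k.+1) -> Cn n,
      [/\ {within (udisk k), continuous g}, g @` (udisk k) `<=` X &
          forall v, usphere k v -> g v = f v].

Lemma pi_trivial_boundedW n (X : set (Cn n)) k : pi_trivial X k -> pi_trivial_bounded X k.
Proof. by move=> h f cf fX _; exact: h. Qed.

Section CubeFilling.
Variables (k n : nat).
Notation V := 'rV[Rl]_(k.+1).

Lemma cont_within_comp (T U W : topologicalType) (A : set U) (r : T -> U) (g : U -> W) :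
  continuous r -> (forall x, A (r x)) -> {within A, continuous g} ->
  continuous (fun x => g (r x)).
Proof.
move=> cr rA /subspace_continuousP cg x U0 HU.
have H : nbhs x (r @^-1` [set y | A y -> U0 (g y)]) := cr x _ (cg _ (rA x) U0 HU).
by apply: filterS H => y; apply; exact: rA.
Qed.

Let eucl (x : V) : Rl := Num.sqrt (\sum_i x ord0 i ^+ 2).

Let eucl_sq (x : V) : eucl x ^+ 2 = \sum_i x ord0 i ^+ 2.
Proof. by rewrite sqr_sqrtr // sumr_ge0 // => i _; exact: sqr_ge0. Qed.

Let cont_eucl : continuous eucl.
Proof. by apply: cont_sqrt; apply: (@cont_sum Rl V _ _ _ (fun i (x : V) => x ord0 i ^+ 2)) => i; apply: contX; exact: cont_coord. Qed.

Let norm_le_eucl (x : V) : `|x| <= eucl x.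
Proof.
rewrite le_rV_norm ?sqrtr_ge0 //; apply/forallP => i.
rewrite -sqrtr_sqr ler_sqrt; last by rewrite sumr_ge0 // => j _; exact: sqr_ge0.
by rewrite (bigD1 i) //= lerDl sumr_ge0 // => j _; exact: sqr_ge0.
Qed.

(** Radial projection carries the Euclidean sphere to the boundary of the cube and back; both
    projections are made globally continuous by truncating the denominator. *)
Lemma cube_filling (X : set (Cn n)) (h : V -> Cn n) :
  pi_trivial_bounded X k -> continuous h ->
  (forall x : V, `|x| = 1 -> X (h x)) ->
  (exists C : Rl, forall x : V, `|x| = 1 -> `|(h x).1| <= C /\ `|(h x).2| <= C) ->
  exists G : V -> Cn n, [/\ continuous G, forall x, X (G x) &
    forall x : V, `|x| = 1 -> G x = h x].
Proof.
move=> piX ch hX [C hC].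
(* A vector of sup norm below [c] has Euclidean square below [(k + 1) c^2 = c <= 1], so the
   truncation at [c] has no effect on the unit sphere. *)
pose c : Rl := k.+1%:R^-1.
have c0 : 0 < c by rewrite invr_gt0 ltr0n.
pose nrm (x : V) : V := (Num.max c `|x|)^-1 *: x.
have cnrm : continuous nrm.
  apply: cont_rV => i; under eq_fun do rewrite mxE.
  apply: contM; last exact: cont_coord.
  apply: contV; first by move=> x; rewrite gt_eqF // lt_max c0.
  by apply: cont_max; [exact: contC|exact: norm_continuous].
have sph (v : V) : usphere k v -> c <= `|v|.
  rewrite /usphere /= leNgt => v1; apply/negP => vc.
  have : \sum_i v ord0 i ^+ 2 < \sum_(i < k.+1) c ^+ 2.
    apply: ltr_sum => [|i _]; first by apply/hasP; exists ord0; rewrite ?mem_index_enum.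
    rewrite -real_normK ?num_real // ltr_pXn2r ?nnegrE ?normr_ge0 ?(ltW c0) //.
    exact: le_lt_trans (coord_le_norm v i) vc.
  rewrite v1 sumr_const card_ord -mulr_natr expr2 -mulrA /c mulVf ?pnatr_eq0 // mulr1.
  by rewrite ltNge invf_le1 ?ltr0n // ler1n.
have nrm1 (v : V) : usphere k v -> `|nrm v| = 1.
  move=> /sph cv; rewrite /nrm max_r // normrZ ger0_norm ?invr_ge0 // mulVf //.
  by rewrite gt_eqF // (lt_le_trans c0).
have [|||g [cg gX gh]] := piX (fun v => h (nrm v)).
- by apply: continuous_subspaceT; exact: (cont_comp_top cnrm ch).
- by move=> _ [v /nrm1 v1 <-]; exact: hX.
- by exists C => v /nrm1; exact: hC.
pose r (x : V) : V := (Num.max 1 (eucl x))^-1 *: x.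
have m0 x : 0 < Num.max 1 (eucl x) by rewrite lt_max ltr01.
have cr : continuous r.
  apply: cont_rV => i; under eq_fun do rewrite mxE.
  apply: contM; last exact: cont_coord.
  apply: contV; first by move=> x; rewrite gt_eqF.
  by apply: cont_max; [exact: contC|exact: cont_eucl].
have rsum x : \sum_i (r x) ord0 i ^+ 2 = (eucl x / Num.max 1 (eucl x)) ^+ 2.
  rewrite exprMn eucl_sq mulr_suml; apply: eq_bigr => i _.
  by rewrite mxE exprMn mulrC.
have rD x : udisk k (r x).
  rewrite /udisk /= rsum expr_le1 ?divr_ge0 ?sqrtr_ge0 ?(ltW (m0 _)) //.
  by rewrite ler_pdivrMr // mul1r le_max lexx orbT.
exists (fun x => g (r x)); split.
- exact: cont_within_comp cg.
- by move=> x; apply: gX; exists (r x).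
move=> x x1; have e1 : 1 <= eucl x by rewrite -x1 norm_le_eucl.
have e0 : 0 < eucl x by exact: lt_le_trans e1.
have rS : usphere k (r x).
  by rewrite /usphere /= rsum max_r // mulfV ?expr1n // gt_eqF.
rewrite gh //; congr h.
have := sph _ rS; rewrite /nrm /r max_r // => ce.
rewrite (max_r ce) normrZ x1 mulr1 scalerA ger0_norm ?invr_ge0 ?(ltW e0) //.
by rewrite invrK mulfV ?scale1r // gt_eqF.
Qed.
End CubeFilling.

Section Loop.
Variables (R : realType) (L : R).
Hypothesis L1 : 1 <= L.
Implicit Types s : R.

(* A loop around the origin, based at the large number L, which never goes
   further left than -1. *)
Definition loop_rad s : R := 1 + (L - 1) * Num.max 0 (2 * `|s| - 1).
Definition loop_re s : R := - (loop_rad s * cos (pi * s)).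
Definition loop_im s : R := - (loop_rad s * sin (pi * s)).

Lemma loop_rad_ge1 s : 1 <= loop_rad s.
Proof. by rewrite lerDl mulr_ge0 ?subr_ge0 // le_max lexx. Qed.

Lemma loop_rad_le s : `|s| <= 1 -> loop_rad s <= L.
Proof.
move=> s1; rewrite -lerBrDl ler_piMr ?subr_ge0 // ge_max ler01 /=; lra.
Qed.

Lemma loop_sq s : loop_re s ^+ 2 + loop_im s ^+ 2 = loop_rad s ^+ 2.
Proof. by rewrite !sqrrN !exprMn -mulrDr cos2Dsin2 mulr1. Qed.

Lemma loop_re_geN1 s : `|s| <= 1 -> -1 <= loop_re s.
Proof.
move=> s1; have r1 := loop_rad_ge1 s; rewrite /loop_re lerN2.
have -> : cos (pi * s) = cos (pi * `|s|).
  by rewrite -[in RHS](ger0_norm (pi_ge0 R)) -normrM cos_norm.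
have [h|h] := leP `|s| 2^-1.
  have -> : loop_rad s = 1 by rewrite /loop_rad max_l ?mulr0 ?addr0 //; lra.
  by rewrite mul1r cos_le1.
have h0 : 0 <= cos (pi - pi * `|s|).
  apply: cos_ge0_pihalf; have p0 := pi_gt0 R.
  have q1 : 0 <= pi * (1 - `|s|) by rewrite mulr_ge0 ?pi_ge0 ?subr_ge0.
  have q2 : 0 < pi * (`|s| - 2^-1) by rewrite mulr_gt0 // subr_gt0.
  by apply/andP; split; lra.
move: h0; rewrite trigo.cosB cospi sinpi mul0r addr0 mulN1r oppr_ge0 => h0.
apply: (@le_trans _ _ 0) => //; rewrite pmulr_rle0 //; exact: lt_le_trans r1.
Qed.

Lemma loop_end s : `|s| = 1 -> loop_re s = L.
Proof.
move=> s1; rewrite /loop_re.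
have -> : cos (pi * s) = -1.
  by rewrite -cos_norm normrM s1 mulr1 ger0_norm ?pi_ge0 // cospi.
rewrite mulrN1 opprK /loop_rad s1 max_r; lra.
Qed.

Lemma cont_loop_rad : continuous loop_rad.
Proof.
apply: contD; first exact: contC.
apply: contM; first exact: contC.
apply: cont_max; first exact: contC.
apply: contB; last exact: contC.
by apply: contM; [exact: contC|exact: norm_continuous].
Qed.

Lemma cont_loop_re : continuous loop_re.
Proof.
apply: contN; apply: contM; first exact: cont_loop_rad.
apply: cont_comp; first exact: continuous_cos.
by apply: contM; [exact: contC|move=> ?; exact: cvg_id].
Qed.

Lemma cont_loop_im : continuous loop_im.
Proof.
apply: contN; apply: contM; first exact: cont_loop_rad.
apply: cont_comp; first exact: continuous_sin.
by apply: contM; [exact: contC|move=> ?; exact: cvg_id].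
Qed.

(** On the boundary some coordinate is 1 or -1 and contributes [L]; each of the other [l]
    contributes at least -1. *)
Lemma loop_sum_re l (x : 'rV[R]_l.+1) : `|x| = 1 -> L - l%:R <= \sum_i loop_re (x ord0 i).
Proof.
move=> x1; have /mx_norm_neq0[[j i] /= h] : mx_norm x != 0.
  by rewrite -[mx_norm x]/(`|x|) x1 oner_eq0.
have xi : `|x ord0 i| = 1 by rewrite -x1 [RHS]h (ord1 j).
rewrite (bigD1 i) //= loop_end // lerD2l.
have -> : - l%:R = \sum_(i0 < l.+1 | i0 != i) (-1 : R).
  rewrite sumr_const mulNrn; congr (- _%:R).
  transitivity #|predC1 i|; first by rewrite cardC1 card_ord.
  by apply: eq_card => z; rewrite !inE.
apply: ler_sum => k _; apply: loop_re_geN1; rewrite -x1; exact: coord_le_norm.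
Qed.
End Loop.

Definition generic_compl l : set (Cn l) :=
  [set w : Cn l | (forall i, ~ (w.1 ord0 i = 0 /\ w.2 ord0 i = 0)) /\
     ~ (\sum_i w.1 ord0 i = 0 /\ \sum_i w.2 ord0 i = 0)].
Arguments generic_compl l : clear implicits.

Lemma sq_sum_neq0 (a b : Rl) : ~ (a = 0 /\ b = 0) -> a ^+ 2 + b ^+ 2 != 0.
Proof.
move=> ab; rewrite paddr_eq0 ?sqr_ge0 // !sqrf_eq0.
by apply/negP => /andP[/eqP a0 /eqP b0]; exact: ab.
Qed.

Lemma cont_pair (T U W : topologicalType) (f : T -> U) (g : T -> W) :
  continuous f -> continuous g -> continuous (fun x => (f x, g x)).
Proof. by move=> cf cg x; apply: cvg_pair; [exact: cf|exact: cg]. Qed.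

Lemma cont_fst_coord (T : topologicalType) n (G : T -> Cn n) i :
  continuous G -> continuous (fun x => (G x).1 ord0 i).
Proof.
move=> cG; apply: (cont_comp_top (g := fun z : Cn n => z.1 ord0 i) cG).
apply: (cont_comp_top (f := fun z : Cn n => z.1) (g := fun v => v ord0 i)); last exact: cont_coord.
by move=> z; exact: cvg_fst.
Qed.

Lemma cont_snd_coord (T : topologicalType) n (G : T -> Cn n) i :
  continuous G -> continuous (fun x => (G x).2 ord0 i).
Proof.
move=> cG; apply: (cont_comp_top (g := fun z : Cn n => z.2 ord0 i) cG).
apply: (cont_comp_top (f := fun z : Cn n => z.2) (g := fun v => v ord0 i)); last exact: cont_coord.
by move=> z; exact: cvg_snd.
Qed.

(** With [s = A + i B] the sum of the coordinates [w_j] of a filling, no [w_j] times the conjugate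
    of [s] vanishes. On the boundary, multiplying it by [e^(- i pi x_j)] gives real part
    [- rho(x_j) A], which is negative, so [no_cube_filling] finds a point where all these products
    are negative reals; their sum is the square of the modulus of [s]. *)
Theorem generic_not_pi_trivial k : (0 < k)%N ->
  ~ pi_trivial_bounded (generic_compl k.+1) k.
Proof.
move=> k0 piX.
(* The smallest integer for which the lower bound [L - k] of the real part of the sum is
   positive. *)
pose L : Rl := k.+1%:R.
have L1 : 1 <= L by rewrite ler1n.
pose h (x : 'rV[Rl]_k.+1) : Cn k.+1 :=
  (\row_i loop_re L (x ord0 i), \row_i loop_im L (x ord0 i)).
have ch : continuous h.
  apply: cont_pair; apply: cont_rV => i; under eq_fun do rewrite mxE.
    by apply: cont_comp; [exact: cont_loop_re|exact: cont_coord].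
  by apply: cont_comp; [exact: cont_loop_im|exact: cont_coord].
have hsum (x : 'rV[Rl]_k.+1) : `|x| = 1 -> 0 < \sum_i loop_re L (x ord0 i).
  move=> x1; apply: lt_le_trans (loop_sum_re L1 x1).
  by rewrite /L -natr1; lra.
have bnd (a b c : Rl) : 0 <= c -> c <= L -> a ^+ 2 + b ^+ 2 = c ^+ 2 -> `|a| <= L.
  move=> c0 cL e; rewrite (le_trans _ cL) // -(ger0_norm c0) -!sqrtr_sqr ler_sqrt ?sqr_ge0 //.
  by rewrite -e lerDl sqr_ge0.
have [G [cG GX Gh]] : exists G : 'rV[Rl]_k.+1 -> Cn k.+1,
    [/\ continuous G, forall x, generic_compl k.+1 (G x) &
    forall x : 'rV[Rl]_k.+1, `|x| = 1 -> G x = h x].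
  apply: cube_filling piX ch _ _.
  - move=> x x1; split=> [i /= []|/= [] + _].
      rewrite !mxE => a0 b0; have := loop_sq L (x ord0 i).
      rewrite a0 b0 expr0n addr0 => /esym/eqP; rewrite sqrf_eq0.
      by rewrite gt_eqF // (lt_le_trans ltr01 (loop_rad_ge1 L1 _)).
    under eq_bigr do rewrite mxE.
    by move/eqP; rewrite gt_eqF // hsum.
  - exists L => x x1; have L0 : 0 <= L by lra.
    have r0 i : 0 <= loop_rad L (x ord0 i) by apply: le_trans (loop_rad_ge1 L1 _).
    have rL i : loop_rad L (x ord0 i) <= L.
      by apply: loop_rad_le => //; rewrite -x1; exact: coord_le_norm.
    rewrite !le_rV_norm //; split; apply/forallP => i; rewrite mxE.
      by apply: bnd (r0 i) (rL i) (loop_sq _ _).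
    by apply: (bnd _ (loop_re L (x ord0 i)) _ (r0 i) (rL i)); rewrite addrC loop_sq.
pose A x := \sum_i (G x).1 ord0 i; pose B x := \sum_i (G x).2 ord0 i.
have cA : continuous A by apply: cont_sum => i; exact: cont_fst_coord.
have cB : continuous B by apply: cont_sum => i; exact: cont_snd_coord.
have [||||x Hx] := @no_cube_filling Rl k.+1 k0
  (fun j x => (G x).1 ord0 j * A x + (G x).2 ord0 j * B x)
  (fun j x => (G x).2 ord0 j * A x - (G x).1 ord0 j * B x).
- move=> j; apply: contD; apply: contM => //; [exact: cont_fst_coord|exact: cont_snd_coord].
- move=> j; apply: contB; apply: contM => //; [exact: cont_snd_coord|exact: cont_fst_coord].
- move=> j x; have [/(_ j)/sq_sum_neq0 h1 /sq_sum_neq0 h2] := GX x.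
  have -> : forall a b c d : Rl, (a * c + b * d) ^+ 2 + (b * c - a * d) ^+ 2 =
     (a ^+ 2 + b ^+ 2) * (c ^+ 2 + d ^+ 2) by move=> *; ring.
  by rewrite mulf_neq0.
- move=> x j x1; have A0 : 0 < A x.
    rewrite /A Gh //=; under eq_bigr do rewrite mxE; exact: hsum.
  rewrite Gh //= !mxE /loop_re /loop_im; have := cos2Dsin2 (pi * x ord0 j).
  have : 1 <= loop_rad L (x ord0 j) by exact: loop_rad_ge1.
  move: (cos _) (sin _) (loop_rad _ _) A0 (B x); move: (A x) => a c s r a0 b r1 cs.
  have -> : (- (r * c) * a + - (r * s) * b) * c + (- (r * s) * a - - (r * c) * b) * s =
    - (r * a * (c ^+ 2 + s ^+ 2)) by ring.
  by rewrite cs mulr1 oppr_lt0 mulr_gt0 // (lt_le_trans ltr01).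
have : \sum_j ((G x).1 ord0 j * A x + (G x).2 ord0 j * B x) = A x ^+ 2 + B x ^+ 2.
  by rewrite big_split /= -!mulr_suml !expr2.
have : \sum_j ((G x).1 ord0 j * A x + (G x).2 ord0 j * B x) < \sum_(j < k.+1) 0.
  apply: ltr_sum; first by apply/hasP; exists ord0; rewrite ?mem_index_enum.
  by move=> j _; have [] := Hx j.
by rewrite [X in _ < X]big1 // => + e; rewrite e ltNge addr_ge0 ?sqr_ge0.
Qed.

(** * The arrangement X_3 *)

Section ExpLift.
Variable R : realType.

Lemma cos_pi_eq1 (x : R) : `|x| < 2 -> cos (pi * x) = 1 -> x = 0.
Proof.
move=> x2 cx; have p0 := pi_gt0 R.
have s0 : sin (pi * `|x| / 2) = 0.
  have : cos (pi * `|x|) = 1 by rewrite -{1}(ger0_norm (pi_ge0 R)) -normrM cos_norm.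
  have e : pi * `|x| = (pi * `|x| / 2) *+ 2 by rewrite mulr2n -splitr.
  rewrite {1}e cos_mulr2n cos2sin2 !mulr2n => h; apply/eqP; rewrite -sqrf_eq0.
  by apply/eqP; lra.
have [//|xN0] := eqVneq x 0.
have : 0 < sin (pi * `|x| / 2).
  apply: sin_gt0_pi; rewrite divr_gt0 ?mulr_gt0 ?normr_gt0 //=.
  by rewrite ltr_pdivrMr // ltr_pM2l.
by rewrite s0 ltxx.
Qed.

(* The complex exponential exp (i pi (x + i y)). *)
Definition expi_re (x y : R) : R := expR (- (pi * y)) * cos (pi * x).
Definition expi_im (x y : R) : R := expR (- (pi * y)) * sin (pi * x).

Lemma expi_sq (x y : R) : expi_re x y ^+ 2 + expi_im x y ^+ 2 = expR (- (pi * y)) ^+ 2.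
Proof. by rewrite !exprMn -mulrDr cos2Dsin2 mulr1. Qed.

(** The moduli determine [y], and the exponential has period 2 in [x]. *)
Lemma expi_inj0 (x y x' y' : R) : `|x - x'| < 2 -> expi_re x y = expi_re x' y' ->
  expi_im x y = expi_im x' y' -> x = x' /\ y = y'.
Proof.
move=> xx hr hi; have p0 := pi_gt0 R.
have e : expR (- (pi * y)) = expR (- (pi * y')).
  apply/eqP; rewrite -(eqrXn2 (n := 2)) ?expR_ge0 //.
  by rewrite -(expi_sq x) -(expi_sq x') hr hi.
have ey : y = y'.
  by move/expR_inj/oppr_inj: e; apply: mulfI; rewrite gt_eqF.
split=> //; move: hr hi; rewrite /expi_re /expi_im e.
have e0 : expR (- (pi * y')) != 0 by rewrite gt_eqF // expR_gt0.
move=> /(mulfI e0) c1 /(mulfI e0) s1.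
apply/eqP; rewrite -subr_eq0; apply/eqP; apply: cos_pi_eq1 => //.
by rewrite mulrBr trigo.cosB c1 s1 -!expr2 cos2Dsin2.
Qed.

(** Any logarithm given by [angle_lift] differs from the prescribed boundary values by an even
    integer, which [boundary_level] shows to be the same on the whole boundary; it is subtracted. *)
Lemma expi_lift l (u v X0 Y0 : 'rV[R]_l -> R) : (1 < l)%N ->
  continuous u -> continuous v -> continuous X0 ->
  (forall x, u x ^+ 2 + v x ^+ 2 != 0) ->
  (forall x : 'rV[R]_l, `|x| = 1 -> u x = expi_re (X0 x) (Y0 x) /\ v x = expi_im (X0 x) (Y0 x)) ->
  exists X Y : 'rV[R]_l -> R, [/\ continuous X, continuous Y,
    forall x : 'rV[R]_l, `|x| <= 1 -> u x = expi_re (X x) (Y x) /\ v x = expi_im (X x) (Y x) &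
    forall x : 'rV[R]_l, `|x| = 1 -> X x = X0 x /\ Y x = Y0 x].
Proof.
move=> l1 cu cv cX0 uv0 bd; have p0 := pi_gt0 R; have pN0 : pi != 0 :> R by rewrite gt_eqF.
have [th cth Hth] := angle_lift cu cv uv0.
pose r x := Num.sqrt (u x ^+ 2 + v x ^+ 2).
have r0 x : 0 < r x by rewrite sqrtr_gt0 lt_def uv0 addr_ge0 // sqr_ge0.
have cr : continuous r by apply: cont_sqrt; apply: contD; exact: contX.
pose Y x := - (ln (r x) / pi).
have eY x : expR (- (pi * Y x)) = r x.
  by rewrite /Y mulrN opprK mulrC divfK // lnK // posrE.
have cY : continuous Y.
  apply: contN; apply: contM; last exact: contC.
  by move=> x; apply: continuous_comp; [exact: cr|exact: continuous_ln].
pose phi x := (th x / pi - X0 x) / 2.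
have cphi : continuous phi.
  apply: contM; last exact: contC.
  by apply: contB => //; apply: contM => //; exact: contC.
have rbd (x : 'rV[R]_l) : `|x| = 1 -> r x = expR (- (pi * Y0 x)).
  by move=> /bd[hu hv]; rewrite /r hu hv expi_sq sqrtr_sqr ger0_norm ?expR_ge0.
have csbd (x : 'rV[R]_l) : `|x| = 1 -> cos (th x) = cos (pi * X0 x) /\ sin (th x) = sin (pi * X0 x).
  move=> x1; have [|hu hv] := Hth x; first by rewrite x1.
  have [hu' hv'] := bd x x1; have rN0 : r x != 0 by rewrite gt_eqF.
  split; apply: (mulfI rN0); first by rewrite -hu hu' /expi_re rbd.
  by rewrite -hv hv' /expi_im rbd.
have half (x : 'rV[R]_l) (k : int) : `|x| = 1 -> phi x != k%:~R + 2^-1.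
  move=> x1; apply/eqP => h; have [hc hs] := csbd x x1.
  have e : th x = pi * X0 x + pi + 2 * pi * k%:~R.
    have : th x / pi = X0 x + 1 + 2 * k%:~R by move: h; rewrite /phi; lra.
    by move=> /(congr1 ( *%R^~ pi)); rewrite divfK // => ->; ring.
  move: hc hs; rewrite e cos_2piz sin_2piz cosDpi sinDpi => hc hs.
  have := cos2Dsin2 (pi * X0 x).
  have -> : cos (pi * X0 x) = 0 by lra.
  have -> : sin (pi * X0 x) = 0 by lra.
  by rewrite expr0n addr0 => /eqP; rewrite eq_sym oner_eq0.
have [n Hn] := boundary_level l1 cphi half.
pose X x := th x / pi - 2 * n%:~R.
have piX x : pi * X x = th x + 2 * pi * (- n)%:~R.
  by rewrite /X mulrBr mulrC divfK // rmorphN /=; ring.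
exists X, Y; split=> //.
- by apply: contB; [apply: contM => //; exact: contC|exact: contC].
- move=> x x1; have [hu hv] := Hth x x1.
  by rewrite /expi_re /expi_im eY piX cos_2piz sin_2piz -hu -hv.
- move=> x x1; have [hc hs] := csbd x x1; apply: expi_inj0.
  + have := Hn x x1; rewrite /phi /X !ltr_norml => /andP[h1 h2]; apply/andP; split; lra.
  + by rewrite /expi_re eY piX cos_2piz rbd // hc.
  + by rewrite /expi_im eY piX sin_2piz rbd // hs.
Qed.

Lemma cont_expi_re (T : topologicalType) (f g : T -> R) :
  continuous f -> continuous g -> continuous (fun x => expi_re (f x) (g x)).
Proof.
move=> cf cg; apply: contM; (apply: cont_comp;
  [exact: continuous_expR || exact: continuous_cos|]).
  by apply: contN; apply: contM => //; exact: contC.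
by apply: contM => //; exact: contC.
Qed.

Lemma cont_expi_im (T : topologicalType) (f g : T -> R) :
  continuous f -> continuous g -> continuous (fun x => expi_im (f x) (g x)).
Proof.
move=> cf cg; apply: contM; (apply: cont_comp;
  [exact: continuous_expR || exact: continuous_sin|]).
  by apply: contN; apply: contM => //; exact: contC.
by apply: contM => //; exact: contC.
Qed.
End ExpLift.

Lemma expi_compl (R : realType) (x y : R) :
  expi_re (1 - x) y = - expi_re x y /\ expi_im (1 - x) y = expi_im x y.
Proof.
rewrite /expi_re /expi_im mulrBr mulr1 trigo.cosB trigo.sinB cospi sinpi.
by rewrite !mul0r !mulN1r addr0 mulrN sub0r opprK.
Qed.

Lemma expi00 (R : realType) : expi_re 0 0 = 1 :> R /\ expi_im 0 0 = 0 :> R.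
Proof. by rewrite /expi_re /expi_im !mulr0 oppr0 exp.expR0 trigo.cos0 trigo.sin0 mulr1 mulr0. Qed.

Definition o0 : 'I_3 := @Ordinal 3 0 isT.
Definition o1 : 'I_3 := @Ordinal 3 1 isT.
Definition o2 : 'I_3 := @Ordinal 3 2 isT.

Lemma ord3P (P : 'I_3 -> Prop) : P o0 -> P o1 -> P o2 -> forall i, P i.
Proof.
move=> p0 p1 p2 i.
have [->|[->|->]] // : i = o0 \/ i = o1 \/ i = o2.
case: i => [[|[|[|?]]] hi] //; [left|right; left|right; right]; exact: val_inj.
Qed.

Definition X3_compl : set (Cn 3) :=
  [set w : Cn 3 | let p i := w.1 ord0 i in let q i := w.2 ord0 i in
   [/\ forall i, ~ (p i = 0 /\ q i = 0),
       ~ (p o0 + p o1 = 0 /\ q o0 + q o1 = 0),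
       ~ (p o2 - p o0 = 0 /\ q o2 - q o0 = 0) &
       ~ (p o2 - p o1 = 0 /\ q o2 - q o1 = 0)]].

Lemma cdiv_spec (R : realType) (a b c d : R) : c ^+ 2 + d ^+ 2 != 0 ->
  let s1 := (a * c + b * d) / (c ^+ 2 + d ^+ 2) in
  let s2 := (b * c - a * d) / (c ^+ 2 + d ^+ 2) in
  [/\ a = s1 * c - s2 * d, b = s1 * d + s2 * c &
    (s1 ^+ 2 + s2 ^+ 2) * (c ^+ 2 + d ^+ 2) = a ^+ 2 + b ^+ 2].
Proof. by move=> h /=; split; field. Qed.

(* Away from the coordinate hyperplanes put s = b/w and t = c/w and write
   s = exp(i pi z_0), t = exp(-i pi z_1), z_2 = 1 - z_0 - z_1.  The six lines say
   that no z_j is an even integer, so a filling would give one of the cube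
   boundary in the complement of three generic lines in C^2. *)
Theorem X3_not_pi_trivial : ~ pi_trivial_bounded X3_compl 2.
Proof.
move=> piX.
pose V := 'rV[Rl]_3.
(* With [L = 6] the real part of the sum is at least [L - 2 = 4] on the boundary while each radius
   is at most 6. The quotients [z_j] then have modulus at most [3/2], less than 2, so 0 is the only
   even integer they have to avoid there. *)
pose L : Rl := 6.
have L1 : 1 <= L by rewrite /L; lra.
pose a j (x : V) := loop_re L (x ord0 j).
pose b j (x : V) := loop_im L (x ord0 j).
have ca j : continuous (a j).
  by apply: cont_comp; [exact: cont_loop_re|exact: cont_coord].
have cb j : continuous (b j).
  by apply: cont_comp; [exact: cont_loop_im|exact: cont_coord].
(* [X j + i Y j] is the [j]-th loop divided by the sum of the three, so these quotients add up to 1.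
   The maximum with 1 keeps the denominator nonzero everywhere and changes nothing on the
   boundary. *)
pose sr x := Num.max (\sum_j a j x) 1; pose si x := \sum_j b j x.
pose D x := sr x ^+ 2 + si x ^+ 2.
have sr1 x : 1 <= sr x by rewrite le_max lexx orbT.
have D0 x : 0 < D x.
  by rewrite ltr_wpDr ?sqr_ge0 // exprn_gt0 // (lt_le_trans ltr01).
have DN0 x : D x != 0 by rewrite gt_eqF.
have csr : continuous sr.
  by apply: cont_max; [exact: cont_sum|exact: contC].
have csi : continuous si by exact: cont_sum.
have cD : continuous D by apply: contD; exact: contX.
pose X j x := (a j x * sr x + b j x * si x) / D x.
pose Y j x := (b j x * sr x - a j x * si x) / D x.
have cX j : continuous (X j).
  by apply: contM; [apply: contD; exact: contM|exact: contV].
have cY j : continuous (Y j).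
  by apply: contM; [apply: contB; exact: contM|exact: contV].
have srE (x : V) : `|x| = 1 -> 4 <= \sum_j a j x /\ sr x = \sum_j a j x.
  move=> x1; have h := loop_sum_re L1 x1.
  have h4 : 4 <= \sum_j a j x by apply: le_trans h; rewrite /L; lra.
  by split=> //; rewrite /sr max_l //; lra.
have XY2 j (x : V) : `|x| = 1 -> 0 < X j x ^+ 2 + Y j x ^+ 2 /\ X j x ^+ 2 + Y j x ^+ 2 < 4.
  move=> x1; have [_ _] := cdiv_spec (a j x) (b j x) (DN0 x).
  rewrite -/(D x) -/(X j x) -/(Y j x) loop_sq => e.
  have xj1 : `|x ord0 j| <= 1 by rewrite -x1 coord_le_norm.
  have := loop_rad_le L1 xj1; have := loop_rad_ge1 L1 (x ord0 j).
  move: (loop_rad _ _) e => r e r1 r6.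
  have D16 : 16 <= D x.
    have [h4 es] := srE x x1; rewrite /D es; have := sqr_ge0 (si x); nra.
  have e' : X j x ^+ 2 + Y j x ^+ 2 = r ^+ 2 / D x by rewrite -e mulfK.
  rewrite e' divr_gt0 ?D0 ?exprn_gt0 ?(lt_le_trans ltr01) //; split=> //.
  by rewrite ltr_pdivrMr //; move: r6; rewrite /L => r6; nra.
have Xlt j (x : V) : `|x| = 1 -> `|X j x| < 2.
  move=> /(XY2 j)[_ h]; rewrite -(ltr_pXn2r (n := 2)) ?nnegrE //.
  by rewrite real_normK ?num_real //; have := sqr_ge0 (Y j x); lra.
have Ylt j (x : V) : `|x| = 1 -> `|Y j x| < 2.
  move=> /(XY2 j)[_ h]; rewrite -(ltr_pXn2r (n := 2)) ?nnegrE //.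
  by rewrite real_normK ?num_real //; have := sqr_ge0 (X j x); lra.
have ZN0 j (x : V) : `|x| = 1 -> ~ (X j x = 0 /\ Y j x = 0).
  by move=> /(XY2 j)[h _] [hx hy]; move: h; rewrite hx hy expr0n addr0 ltxx.
have sum3 (F : 'I_3 -> Rl) : \sum_j F j = F o0 + F o1 + F o2.
  by rewrite !big_ord_recl big_ord0 addr0 addrA; congr (F _ + F _ + F _); exact: val_inj.
have XYsum (x : V) : `|x| = 1 -> X o0 x + X o1 x + X o2 x = 1 /\ Y o0 x + Y o1 x + Y o2 x = 0.
  move=> x1; have [_ es] := srE x x1.
  rewrite -!(sum3 (fun j => _ j x)) -!mulr_suml big_split sumrB /= -!mulr_suml -es -/(si x).
  by split; [rewrite -!expr2 -/(D x) mulfV|rewrite (mulrC (si x)) subrr mul0r].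
(* [exp(- i pi z_1)] is written as the conjugate of [exp(i pi z)] at the conjugate [z] of [z_1];
   hence the signs in the second coordinate. *)
pose h (x : V) : Cn 3 :=
  (\row_(i < 3) nth 0 [:: expi_re (X o0 x) (Y o0 x); expi_re (X o1 x) (- Y o1 x); 1] i,
   \row_(i < 3) nth 0 [:: expi_im (X o0 x) (Y o0 x); - expi_im (X o1 x) (- Y o1 x); 0] i).
have cNY : continuous (fun x => - Y o1 x) by exact: contN.
have ch : continuous h.
  apply: cont_pair; apply: cont_rV; apply: ord3P; under eq_fun do rewrite mxE /=.
  - exact: cont_expi_re.
  - exact: cont_expi_re.
  - exact: contC.
  - exact: cont_expi_im.
  - by apply: contN; exact: cont_expi_im.
  - exact: contC.
have [e1 e0] := expi00 Rl.
have esqN0 (x y : Rl) : expi_re x y ^+ 2 + expi_im x y ^+ 2 != 0.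
  by rewrite expi_sq expf_neq0 // gt_eqF // expR_gt0.
have [G [cG GX Gh]] : exists G : V -> Cn 3,
    [/\ continuous G, forall x, X3_compl (G x) &
    forall x : V, `|x| = 1 -> G x = h x].
  apply: cube_filling piX ch _ _.
  - move=> x x1; split.
    + apply: ord3P; rewrite /= !mxE /= => -[r0 i0].
      * by have := esqN0 (X o0 x) (Y o0 x); rewrite r0 i0 expr0n addr0 eqxx.
      * by have := esqN0 (X o1 x) (- Y o1 x); rewrite r0 -(sqrrN (expi_im _ _)) i0 expr0n addr0 eqxx.
      * by move/eqP: r0; rewrite oner_eq0.
    + rewrite /= !mxE /= => -[r0 i0].
      have [c1 c2] := expi_compl (X o1 x) (- Y o1 x).
      have [xs ys] := XYsum x x1.
      have [||| hx hy] := @expi_inj0 Rl (X o0 x) (Y o0 x) (1 - X o1 x) (- Y o1 x).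
      * have -> : X o0 x - (1 - X o1 x) = - X o2 x by lra.
        by rewrite normrN Xlt.
      * by rewrite c1; lra.
      * by rewrite c2; lra.
      by apply: (@ZN0 o2 x x1); split; lra.
    + rewrite /= !mxE /= => -[r0 i0]; apply: (@ZN0 o0 x x1).
      apply: expi_inj0; rewrite ?subr0 ?Xlt ?e1 ?e0 //; lra.
    + rewrite /= !mxE /= => -[r0 i0].
      have [||| hx hy] := @expi_inj0 Rl (X o1 x) (- Y o1 x) 0 0.
      * by rewrite subr0 Xlt.
      * by rewrite e1; lra.
      * by rewrite e0; lra.
      by apply: (@ZN0 o1 x x1); split=> //; lra.
  - pose C : Rl := expR (pi * 2).
    have C1 : 1 <= C by rewrite /C -exp.expR0 ler_expR mulr_ge0 ?pi_ge0.
    have bndr (x y : Rl) : `|y| < 2 -> `|expi_re x y| <= C /\ `|expi_im x y| <= C.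
      move=> y2; have eC : expR (- (pi * y)) <= C.
        rewrite ler_expR -mulrN ler_pM2l ?pi_gt0 //.
        by move: y2; rewrite ltr_norml => /andP[? ?]; lra.
      rewrite /expi_re /expi_im !normrM !(ger0_norm (expR_ge0 _)).
      by split; apply: le_trans eC; rewrite ler_piMr ?expR_ge0 ?cos_max ?sin_max.
    exists C => x x1; have C0 : 0 <= C by lra.
    have [h1 h2] := bndr (X o0 x) (Y o0 x) (Ylt o0 x x1).
    have [|h3 h4] := bndr (X o1 x) (- Y o1 x); first by rewrite normrN Ylt.
    rewrite !le_rV_norm //; split; apply/forallP; apply: ord3P; rewrite mxE //=.
      by rewrite normr1.
    by rewrite normrN.
    by rewrite normr0.
pose p i x := (G x).1 ord0 i; pose q i x := (G x).2 ord0 i.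
have cp i : continuous (p i) by exact: cont_fst_coord.
have cq i : continuous (q i) by exact: cont_snd_coord.
have pqN0 i x : p i x ^+ 2 + q i x ^+ 2 != 0.
  by have [/(_ i)/sq_sum_neq0] := GX x.
pose W x := p o2 x ^+ 2 + q o2 x ^+ 2.
have cW : continuous W by apply: contD; exact: contX.
(* [s i + i t i] is the quotient of the [i]-th coordinate of the filling by the last one. *)
pose s i x := (p i x * p o2 x + q i x * q o2 x) / W x.
pose t i x := (q i x * p o2 x - p i x * q o2 x) / W x.
have cs i : continuous (s i).
  by apply: contM; [apply: contD; exact: contM|apply: contV => // x; exact: pqN0].
have ct i : continuous (t i).
  by apply: contM; [apply: contB; exact: contM|apply: contV => // x; exact: pqN0].
have st i x : [/\ p i x = s i x * p o2 x - t i x * q o2 x,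
    q i x = s i x * q o2 x + t i x * p o2 x & s i x ^+ 2 + t i x ^+ 2 != 0].
  have [h1 h2 h3] := cdiv_spec (p i x) (q i x) (pqN0 o2 x); split=> //.
  apply: contraNneq (pqN0 i x); rewrite -h3 -/(s i x) -/(t i x) => ->.
  by rewrite mul0r.
have stbd i (x : V) : `|x| = 1 -> s i x = (h x).1 ord0 i /\ t i x = (h x).2 ord0 i.
  move=> x1; rewrite /s /t /W /p /q (Gh x x1) /= ![in X in _ / X]mxE.
  rewrite ![(\row_i _) ord0 o2]mxE /= expr1n expr0n addr0 !divr1 !mulr1 !mulr0.
  by rewrite addr0 subr0.
have [|||||X0 [Y0 [cX0 cY0 XY0 XYbd0]]] := @expi_lift Rl 3 (s o0) (t o0) (X o0) (Y o0) isT.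
- exact: cs.
- exact: ct.
- exact: cX.
- by move=> x; have [] := st o0 x.
- by move=> x x1; have [-> ->] := stbd o0 x x1; rewrite !mxE.
have [|||||X1 [Y1 [cX1 cY1 XY1 XYbd1]]] :=
  @expi_lift Rl 3 (s o1) (fun x => - t o1 x) (X o1) (fun x => - Y o1 x) isT.
- exact: cs.
- by apply: contN; exact: ct.
- exact: cX.
- by move=> x; rewrite sqrrN; have [] := st o1 x.
- by move=> x x1; have [-> ->] := stbd o1 x x1; rewrite !mxE /= opprK.
pose u (j : 'I_3) x := nth 0 [:: X0 x; X1 x; 1 - X0 x - X1 x] j.
pose v (j : 'I_3) x := nth 0 [:: Y0 x; - Y1 x; - Y0 x + Y1 x] j.
have uvN0 j x : `|x| <= 1 -> u j x ^+ 2 + v j x ^+ 2 != 0.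
  move=> x1; apply: sq_sum_neq0; have [hs0 ht0] := XY0 x x1; have [hs1 ht1] := XY1 x x1.
  have [p0 q0 _] := st o0 x; have [p1 q1 _] := st o1 x; have [_ g1 g2 g3] := GX x.
  move: j; apply: ord3P; rewrite /u /v /= => -[xe ye].
  - move: hs0 ht0; rewrite xe ye e1 e0 => hs0 ht0; apply: g2.
    by rewrite -!/(p _ x) -!/(q _ x) p0 q0 hs0 ht0; split; ring.
  - have {}ye : Y1 x = 0 by lra.
    move: hs1 ht1; rewrite xe ye e1 e0 => hs1 ht1; apply: g3.
    have {}ht1 : t o1 x = 0 by lra.
    by rewrite -!/(p _ x) -!/(q _ x) p1 q1 hs1 ht1; split; ring.
  - have [c1 c2] := expi_compl (X1 x) (Y1 x).
    have xe' : X0 x = 1 - X1 x by lra.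
    have ye' : Y0 x = Y1 x by lra.
    move: hs0 ht0; rewrite xe' ye' c1 c2 -hs1 -ht1 => hs0 ht0; apply: g1.
    by rewrite -!/(p _ x) -!/(q _ x) p0 q0 p1 q1 hs0 ht0; split; ring.
have cu j : continuous (u j).
  move: j; apply: ord3P => //; rewrite /u /=.
  by apply: contB => //; apply: contB => //; exact: contC.
have cv j : continuous (v j).
  move: j; apply: ord3P => //; rewrite /v /=; first exact: contN.
  by apply: contD => //; exact: contN.
have [||||x Hx] := @no_cube_filling Rl 3 isT
  (fun j x => u j (clamp x)) (fun j x => v j (clamp x)).
- by move=> j; exact: cont_comp_top (@cont_clamp _ _) (cu j).
- by move=> j; exact: cont_comp_top (@cont_clamp _ _) (cv j).
- by move=> j x; apply: uvN0; exact: clamp_cube.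
- move=> x j x1; rewrite clamp_id ?x1 //.
  have [xs ys] := XYsum x x1.
  have [-> ->] : u j x = X j x /\ v j x = Y j x.
    have [h1 h2] := XYbd0 x x1; have [h3 h4] := XYbd1 x x1.
    by move: j; apply: ord3P; rewrite /u /v /=; split; lra.
  have [h4 es] := srE x x1; have sr0 : 0 < sr x by rewrite (lt_le_trans ltr01).
  rewrite /X /Y /a /b /loop_re /loop_im; have := cos2Dsin2 (pi * x ord0 j).
  have : 1 <= loop_rad L (x ord0 j) by exact: loop_rad_ge1.
  move: (cos _) (sin _) (loop_rad _ _) (si x) (D x) (D0 x) sr0; move: (sr x) => r c s1 rr d D' D'0 r0 rr1 cs1.
  have -> : (- (rr * c) * r + - (rr * s1) * d) / D' * c + (- (rr * s1) * r - - (rr * c) * d) / D' * s1 =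
    - (rr * r / D' * (c ^+ 2 + s1 ^+ 2)) by ring.
  by rewrite cs1 mulr1 oppr_lt0 divr_gt0 // mulr_gt0 // (lt_le_trans ltr01).
(* The real parts of the three lifted logarithms add up to 1 and cannot all be negative. *)
have [] := (Hx o0, Hx o1, Hx o2); rewrite /u /=.
by case=> -[[h1 _] [h2 _]] [h3 _]; lra.
Qed.

(** * Localization *)

Definition family_compl n (F : {set 'I_n} -> Prop) : set (Cn n) :=
  [set z | forall I, F I -> ~ cplx_hyperplane I z].

Section Localization.
Variable R : realFieldType.

(** A generic point of the flat: when the next form vanishes at [p], a point [q] where it does not
    is added to a multiple of [p] so large that [q] cannot cancel any of the earlier forms. *)
Lemma common_nonvanishing n l (A : 'M[R]_(n, l)) (s : seq {set 'I_n}) :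
  exists p : 'rV[R]_n, p *m A = 0 /\ forall I, I \in s ->
    (exists q : 'rV[R]_n, q *m A = 0 /\ \sum_(i in I) q ord0 i != 0) ->
    \sum_(i in I) p ord0 i != 0.
Proof.
pose al (I : {set 'I_n}) (p : 'rV[R]_n) := \sum_(i in I) p ord0 i.
have alD (I : {set 'I_n}) t (p q : 'rV[R]_n) : al I (t *: p + q) = t * al I p + al I q.
  by rewrite /al mulr_sumr -big_split; apply: eq_bigr => i _; rewrite !mxE.
elim: s => [|I s [p [pA Hp]]]; first by exists 0; rewrite mul0mx.
have [h|h] := eqVneq (al I p) 0; last first.
  by exists p; split=> // J; rewrite inE => /orP[/eqP-> _ //|]; exact: Hp.
have [[q [qA Hq]]|hq] := pselect (exists q : 'rV[R]_n, q *m A = 0 /\ al I q != 0); last first.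
  by exists p; split=> // J; rewrite inE => /orP[/eqP->|] //; exact: Hp.
pose t := 1 + \sum_(J <- s) `|al J q / al J p|.
exists (t *: p + q); split; first by rewrite mulmxDl -scalemxAl pA qA scaler0 addr0.
move=> J; rewrite inE -/(al J _) alD => /orP[/eqP-> _|Js hJ]; first by rewrite h mulr0 add0r.
have Jp : al J p != 0 by exact: Hp.
apply/eqP => e.
have : t = - (al J q / al J p).
  by apply: (mulIf Jp); rewrite mulNr divfK //; apply/eqP; rewrite -addr_eq0 e.
have : `|al J q / al J p| < t.
  rewrite /t (big_rem J) //= ltr_pwDl // lerDl sumr_ge0 // => *; exact: normr_ge0.
by move=> /[swap] ->; rewrite -normrN => /lt_le_trans/(_ (ler_norm _)); rewrite ltxx.
Qed.
End Localization.

Lemma cont_mulmx m n (B : 'M[Rl]_(m, n)) : continuous (fun v : 'rV[Rl]_m => v *m B).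
Proof.
apply: cont_rV => i; under eq_fun do rewrite mxE.
apply: (@cont_sum Rl _ _ _ _ (fun j (v : 'rV[Rl]_m) => v ord0 j * B j i)) => j.
by apply: contM; [exact: cont_coord|exact: contC].
Qed.

Lemma cont_mulmx_fst m n (B : 'M[Rl]_(m, n)) : continuous (fun w : Cn m => w.1 *m B).
Proof.
apply: (cont_comp_top (f := fun w : Cn m => w.1) (g := fun v => v *m B)); last exact: cont_mulmx.
by move=> z; exact: cvg_fst.
Qed.

Lemma cont_mulmx_snd m n (B : 'M[Rl]_(m, n)) : continuous (fun w : Cn m => w.2 *m B).
Proof.
apply: (cont_comp_top (f := fun w : Cn m => w.2) (g := fun v => v *m B)); last exact: cont_mulmx.
by move=> z; exact: cvg_snd.
Qed.

(* Near a generic real point p of the flat {z | z A = 0} only the hyperplanes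
   containing the flat are visible. *)
Lemma pi_trivial_localize n l (F : {set 'I_n} -> Prop) (A : 'M[Rl]_(n, l))
    (B : 'M[Rl]_(l, n)) (X : set (Cn l)) k :
  B *m A = 1%:M ->
  (forall z, family_compl F z -> X (z.1 *m A, z.2 *m A)) ->
  (forall I, F I -> (forall q : 'rV[Rl]_n, q *m A = 0 -> \sum_(i in I) q ord0 i = 0) ->
     forall w, X w -> ~ cplx_hyperplane I (w.1 *m B, w.2 *m B)) ->
  pi_trivial_bounded (family_compl F) k -> pi_trivial_bounded X k.
Proof.
move=> BA FX FI piF f cf fX [C hC].
have [p0 [p0A Hp0]] := common_nonvanishing A (enum {set 'I_n}).
have {}Hp0 (I : {set 'I_n}) : \sum_(i in I) p0 ord0 i = 0 ->
    forall q : 'rV[Rl]_n, q *m A = 0 -> \sum_(i in I) q ord0 i = 0.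
  move=> h q qA; apply/eqP; apply: contraT => hq.
  by have := Hp0 I; rewrite mem_enum h eqxx => /(_ isT); apply; exists q.
pose K := \sum_i \sum_j `|C| * `|B j i|.
have K0 : 0 <= K by apply: sumr_ge0 => i _; apply: sumr_ge0 => j _; exact: mulr_ge0.
have bndi (w : 'rV[Rl]_l) i : `|w| <= C -> `|(w *m B) ord0 i| <= \sum_j `|C| * `|B j i|.
  move=> wC; rewrite mxE; apply: le_trans (ler_norm_sum _ _ _) _.
  apply: ler_sum => j _; rewrite normrM ler_wpM2r // (le_trans (coord_le_norm w j)) //.
  exact: le_trans wC (ler_norm _).
have bndI (w : 'rV[Rl]_l) (I : {set 'I_n}) : `|w| <= C -> `|\sum_(i in I) (w *m B) ord0 i| <= K.
  move=> wC; apply: le_trans (ler_norm_sum _ _ _) _.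
  rewrite /K [leRHS](bigID (fun i => i \in I)) /=.
  apply: ler_wpDr; last by apply: ler_sum => i _; exact: bndi.
  by apply: sumr_ge0 => i _; apply: sumr_ge0 => j _; exact: mulr_ge0.
(* [K] bounds all forms on the embedded sphere. The sum of inverses makes every form that does not
   vanish at [p0] larger than [K] at [p = r p0], so the sphere translated by [p] misses its
   hyperplane. *)
pose r := (K + 1) * \sum_(I : {set 'I_n}) `|\sum_(i in I) p0 ord0 i|^-1.
pose p := r *: p0.
have pA : p *m A = 0 by rewrite -scalemxAl p0A scaler0.
have alp (I : {set 'I_n}) : \sum_(i in I) p ord0 i = r * \sum_(i in I) p0 ord0 i.
  by rewrite mulr_sumr; apply: eq_bigr => i _; rewrite mxE.
have big (I : {set 'I_n}) : \sum_(i in I) p0 ord0 i != 0 -> K < `|\sum_(i in I) p ord0 i|.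
  move=> h; rewrite alp normrM /r ger0_norm; last first.
    by rewrite mulr_ge0 ?addr_ge0 // sumr_ge0 // => J _; rewrite invr_ge0.
  apply: (@lt_le_trans _ _ (K + 1)); first by rewrite ltrDl.
  rewrite -mulrA ler_peMr ?addr_ge0 // (bigD1 I) //= mulrDl mulVf ?normr_eq0 //.
  by rewrite lerDl mulr_ge0 // sumr_ge0 // => J _; rewrite invr_ge0.
pose emb (w : Cn l) : Cn n := (p + w.1 *m B, w.2 *m B).
have cemb : continuous emb.
  apply: cont_pair; last exact: cont_mulmx_snd.
  by move=> w; apply: cvgD; [exact: cvg_cst|exact: cont_mulmx_fst].
have [|||g [cg gX gf]] := piF (fun v => emb (f v)).
- move=> v; apply: continuous_comp; [exact: cf|exact: cemb].
- move=> _ [v vS <-] I IF [/=].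
  have [h1 h2] := hC v vS.
  have e1 : \sum_(i in I) (p + (f v).1 *m B) ord0 i =
      \sum_(i in I) p ord0 i + \sum_(i in I) ((f v).1 *m B) ord0 i.
    by rewrite -big_split; apply: eq_bigr => i _; rewrite mxE.
  rewrite e1; have [h|h] := eqVneq (\sum_(i in I) p0 ord0 i) 0.
    rewrite alp h mulr0 add0r => e2 e3.
    by apply: (FI I IF (Hp0 I h) (f v)); [apply: fX; exists v|split].
  move=> e2 _; have := big I h; have := bndI _ I h1.
  by move/eqP: e2; rewrite addr_eq0 => /eqP ->; rewrite normrN => a b; have := le_lt_trans a b; rewrite ltxx.
- exists (`|p| + K) => v vS; have [h1 h2] := hC v vS.
  have Ki i : \sum_j `|C| * `|B j i| <= K.
    rewrite /K (bigD1 i) //= lerDl; apply: sumr_ge0 => a _.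
    by apply: sumr_ge0 => b _; exact: mulr_ge0.
  have nB (w : 'rV[Rl]_l) : `|w| <= C -> `|w *m B| <= K.
    move=> wC; rewrite le_rV_norm //; apply/forallP => i.
    exact: le_trans (bndi w i wC) (Ki i).
  split=> /=; first by apply: le_trans (ler_normD _ _) _; rewrite lerD2l nB.
  by apply: le_trans (nB _ h2) _; rewrite lerDr.
exists (fun v => ((g v).1 *m A, (g v).2 *m A)); split.
- have cA : continuous (fun z : Cn n => (z.1 *m A, z.2 *m A)).
    by apply: cont_pair; [exact: cont_mulmx_fst|exact: cont_mulmx_snd].
  by move=> v; apply: (continuous_comp (g := fun z : Cn n => (z.1 *m A, z.2 *m A))); [exact: cg|exact: cA].
- by move=> _ [v vD <-]; apply: FX; apply: gX; exists v.
- move=> v vS; rewrite gf // /emb /= mulmxDl pA add0r -!mulmxA BA !mulmx1.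
  by case: (f v).
Qed.

(** * Localization to unions of disjoint vertex blocks *)

Section Blocks.
Variables (n m : nat) (blk : 'I_m -> {set 'I_n}).
Hypothesis blk0 : forall j, blk j != finset.set0.
Hypothesis blkD : forall j j' i, i \in blk j -> i \in blk j' -> j = j'.
Variable F : {set 'I_n} -> Prop.

Definition block_union (J : {set 'I_m}) : {set 'I_n} := [set i | [exists j in J, i \in blk j]]%SET.

(** [A] sums the coordinates over each block and [B] places a value at a representative. The kernel
    of [A] contains the unit vectors outside all blocks and the differences within a block; a set
    whose form vanishes on them is a union of blocks. *)
Lemma pi_trivial_blocks k : pi_trivial_bounded (family_compl F) k ->
  pi_trivial_bounded (family_compl (fun J => F (block_union J))) k.
Proof.
have /boolp.choice[rep Hrep] : forall j, exists i, i \in blk j.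
  by move=> j; apply/set0Pn; exact: blk0.
pose A : 'M[Rl]_(n, m) := \matrix_(i, j) (i \in blk j)%:R.
pose B : 'M[Rl]_(m, n) := \matrix_(j, i) (i == rep j)%:R.
have inU i j (J : {set 'I_m}) : i \in blk j -> (i \in block_union J) = (j \in J).
  move=> ij; rewrite inE; apply/exists_inP/idP => [[j' j'J ij']|jJ].
    by rewrite (blkD ij ij').
  by exists j.
have sumA (v : 'rV[Rl]_n) (J : {set 'I_m}) : \sum_(j in J) (v *m A) ord0 j = \sum_(i in block_union J) v ord0 i.
  under eq_bigr do rewrite mxE.
  rewrite exchange_big /= [RHS]big_mkcond /=; apply: eq_bigr => i _.
  under eq_bigr do rewrite mxE.
  rewrite -mulr_sumr -natr_sum; case: ifP => iU.
    move: (iU); rewrite inE => /exists_inP[j jJ ij].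
    rewrite (bigD1 j) //= ij big1 ?addn0 ?mulr1 // => j' /andP[_ jj].
    by case: (boolP (i \in blk j')) => // /(blkD ij) e; rewrite e eqxx in jj.
  rewrite big1 ?mulr0 // => j jJ; case: (boolP (i \in blk j)) => // ij.
  by rewrite (inU i j) // jJ in iU.
have sumB (v : 'rV[Rl]_m) (I : {set 'I_n}) : \sum_(i in I) (v *m B) ord0 i =
    \sum_(j in [set j | rep j \in I]%SET) v ord0 j.
  under eq_bigr do rewrite mxE.
  rewrite exchange_big /= [RHS]big_mkcond /=; apply: eq_bigr => j _.
  under eq_bigr do rewrite mxE.
  rewrite -mulr_sumr inE; case: ifP => jI.
    by rewrite (bigD1 (rep j)) //= eqxx big1 ?addr0 ?mulr1 // => i /andP[_ /negbTE->].
  by rewrite big1 ?mulr0 // => i iI; case: eqP => // e; rewrite e jI in iI.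
apply: (@pi_trivial_localize n m F A B).
- apply/matrixP => j j'; rewrite !mxE (bigD1 (rep j)) //= !mxE eqxx mul1r big1 ?addr0.
    case: eqP => [<-|jj]; first by rewrite Hrep.
    by case: (boolP (rep j \in blk j')) => // /(blkD (Hrep j)) /jj.
  by move=> i /negbTE ij; rewrite !mxE ij mul0r.
- by move=> z zF J FJ [/= h1 h2]; apply: (zF _ FJ); rewrite /cplx_hyperplane /= -!sumA.
move=> I FI Iker w wX; rewrite /cplx_hyperplane /= !sumB.
have delta (i : 'I_n) : \sum_(i0 in I) (delta_mx 0 i : 'rV[Rl]_n) ord0 i0 = (i \in I)%:R.
  rewrite (eq_bigr (fun i0 => (i0 == i)%:R)); last by move=> i0 _; rewrite mxE eqxx.
  case: (boolP (i \in I)) => iI.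
    by rewrite (bigD1 i) //= eqxx big1 ?addr0 // => i0 /andP[_ /negbTE->].
  by rewrite big1 // => i0 i0I; case: eqP => // e; rewrite -e i0I in iI.
have rowA (i : 'I_n) j : ((delta_mx 0 i : 'rV[Rl]_n) *m A) ord0 j = (i \in blk j)%:R.
  by rewrite -rowE !mxE.
have hU : I = block_union [set j | rep j \in I]%SET.
  apply/setP => i; have [[j ij]|ni] := pselect (exists j, i \in blk j).
    have e0 : ((delta_mx 0 i - delta_mx 0 (rep j)) : 'rV[Rl]_n) *m A = 0.
      apply/rowP => j'; rewrite mulmxBl mxE [in X in _ + X]mxE !rowA mxE.
      case: (boolP (i \in blk j')) => [/(blkD ij) <-|/negP ij'].
        by rewrite Hrep subrr.
      case: (boolP (rep j \in blk j')) => [/(blkD (Hrep j)) e|_]; last by rewrite subrr.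
      by rewrite -e in ij'.
    rewrite (inU i j) // inE; have := Iker _ e0.
    under eq_bigr do rewrite mxE [in X in _ + X]mxE.
    rewrite sumrB !delta => /eqP; rewrite subr_eq0.
    by case: (i \in I); case: (rep j \in I) => //; rewrite ?oner_eq0 // eq_sym oner_eq0.
  have -> : (i \in block_union [set j | rep j \in I]%SET) = false.
    by apply/negbTE; rewrite inE; apply/exists_inP => -[j _ ij]; apply: ni; exists j.
  have := Iker (delta_mx 0 i); rewrite delta => /(_ _)/eqP.
  rewrite pnatr_eq0 eqb0 => h; apply/negbTE/h; apply/rowP => j; rewrite rowA mxE.
  by case: (boolP (i \in blk j)) => // ij; case: ni; exists j.
by apply: wX; rewrite -hU.
Qed.
End Blocks.

(** * Localizations given by integer matrices and checked by computation *)

Definition dotz (u v : seq int) : int := foldr (fun p acc => p.1 * p.2 + acc) 0 (zip u v).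
Definition indz (s : seq bool) : seq int := [seq (nat_of_bool b)%:Z | b <- s].
Fixpoint bits (m : nat) : seq (seq bool) :=
  if m is m'.+1 then [seq b :: s | b <- [:: true; false], s <- bits m'] else [:: [::]].
Definition set_of_bits m (s : seq bool) : {set 'I_m} := [set k : 'I_m | nth false s k]%SET.
Definition bits_of_set m (J : {set 'I_m}) : seq bool := [seq k \in J | k <- enum 'I_m].

Lemma dotzE m (u v : seq int) : size u = m -> size v = m ->
  dotz u v = \sum_(i < m) u`_i * v`_i.
Proof.
elim: m u v => [|m IH] [|x u] [|y v] //=; first by rewrite big_ord0.
by move=> [su] [sv]; rewrite big_ord_recl /= -IH.
Qed.

Lemma mem_bits m s : size s = m -> s \in bits m.
Proof.
elim: m s => [|m IH] [|b s] //= [/IH sm].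
by rewrite mem_cat cats0; case: b; rewrite map_f ?orbT.
Qed.

Lemma size_bits_of_set m (J : {set 'I_m}) : size (bits_of_set J) = m.
Proof. by rewrite size_map size_enum_ord. Qed.

Lemma nth_bits_of_set m (J : {set 'I_m}) (k : 'I_m) : nth false (bits_of_set J) k = (k \in J).
Proof. by rewrite (nth_map k) ?size_enum_ord // nth_ord_enum. Qed.

Lemma bits_of_setK m (J : {set 'I_m}) : set_of_bits m (bits_of_set J) = J.
Proof. by apply/setP => k; rewrite inE nth_bits_of_set. Qed.

Lemma nth_indz s k : (indz s)`_k = (nat_of_bool (nth false s k))%:Z.
Proof.
have [ks|ks] := ltnP k (size s); first by rewrite (nth_map false).
by rewrite !nth_default // size_map.
Qed.

Lemma sum_set_dotz (R : nzRingType) m (J : {set 'I_m}) (v : seq int) : size v = m ->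
  \sum_(k in J) (v`_k)%:~R = (dotz (indz (bits_of_set J)) v)%:~R :> R.
Proof.
move=> sv; have sb : size (indz (bits_of_set J)) = m by rewrite size_map size_bits_of_set.
rewrite (dotzE sb sv) rmorph_sum /= big_mkcond /=.
apply: eq_bigr => k _; rewrite nth_indz nth_bits_of_set.
by case: ifP => _; rewrite ?mul1r ?mul0r.
Qed.

Definition form_compl (l : nat) (T : seq (seq int)) : set (Cn l) :=
  [set w : Cn l | forall c, c \in T ->
     ~ (\sum_(j < l) (c`_j)%:~R * w.1 ord0 j = 0 /\ \sum_(j < l) (c`_j)%:~R * w.2 ord0 j = 0)].

Arguments form_compl l T : clear implicits.

(* cols are the columns of the linear map C^m -> C^l, rows those of a
   section, Q spans part of its kernel; the forms in T pull back to the
   members Cs of the family, and no other 0/1-vector outside E kills Q. *)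
Definition localize_check (m l : nat) (cols rows Q T : seq (seq int)) (Cs E : seq (seq bool)) : bool :=
  [&& size cols == l, size rows == l, all (fun c => size c == m) cols,
      all (fun c => size c == m) rows, all (fun c => size c == m) Q,
      all (fun i => all (fun j => dotz (nth [::] rows i) (nth [::] cols j) == (i == j)%:Z) (iota 0 l)) (iota 0 l),
      all (fun q => all (fun c => dotz q c == 0) cols) Q,
      all (fun c => (size c == l) && has (fun C =>
        let v := [seq dotz c [seq col`_k | col <- cols] | k <- iota 0 m] in
        (size C == m) && ((v == indz C) || (v == [seq - x | x <- indz C]))) Cs) T &
      all (fun s => let v := [seq dotz (indz s) r | r <- rows] in
        [|| all negb s, s \in E, has (fun q => dotz (indz s) q != 0) Q |
            has (fun c => (v == c) || (v == [seq - x | x <- c])) T]) (bits m)].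

(** The certificate is decided by evaluation over all subsets of the [m] blocks and then read over
    the reals. A nonempty subset whose form vanishes on [Q] either gives a form of [T] up to sign or
    is listed in [E], so it is not in the family. *)
Lemma pi_trivial_check (m l : nat) cols rows Q T Cs E (F : {set 'I_m} -> Prop) k :
  localize_check m l cols rows Q T Cs E ->
  ~ F finset.set0 -> (forall s, s \in E -> ~ F (set_of_bits m s)) ->
  (forall C, C \in Cs -> F (set_of_bits m C)) ->
  pi_trivial_bounded (family_compl F) k -> pi_trivial_bounded (form_compl l T) k.
Proof.
case/and5P=> /eqP scols /eqP srows /allP hcols /allP hrows /and5P[/allP hQ /allP hBA /allP hQA /allP hT /allP hs] F0 FE FC.
have szc j : (j < l)%N -> size (nth [::] cols j) = m.
  by move=> jl; apply/eqP/hcols; rewrite mem_nth ?scols.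
have szr j : (j < l)%N -> size (nth [::] rows j) = m.
  by move=> jl; apply/eqP/hrows; rewrite mem_nth ?srows.
pose A : 'M[Rl]_(m, l) := \matrix_(i, j) ((nth [::] cols j)`_i)%:~R.
pose B : 'M[Rl]_(l, m) := \matrix_(j, i) ((nth [::] rows j)`_i)%:~R.
have sumN (v : seq int) (w : 'rV[Rl]_l) : \sum_(j < l) ([seq - x | x <- v]`_j)%:~R * w ord0 j =
   - \sum_(j < l) (v`_j)%:~R * w ord0 j.
  rewrite -sumrN; apply: eq_bigr => j _; rewrite -mulNr -rmorphN /=; congr (_%:~R * _).
  by have [jv|jv] := ltnP j (size v); [rewrite (nth_map 0)|rewrite !nth_default ?oppr0 ?size_map].
apply: (@pi_trivial_localize m l F A B).
- apply/matrixP => i j; rewrite !mxE.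
  transitivity ((dotz (nth [::] rows i) (nth [::] cols j))%:~R : Rl).
    rewrite (@dotzE m) ?szc ?szr // rmorph_sum /=.
    by apply: eq_bigr => h _; rewrite !mxE rmorphM.
  have /hBA/allP/(_ (nat_of_ord j)) : nat_of_ord i \in iota 0 l by rewrite mem_iota /=.
  by rewrite mem_iota /= => /(_ (ltn_ord j))/eqP ->.
- move=> z zF c cT [/= h1 h2].
  have /andP[/eqP sc /hasP[C CC /andP[/eqP sC hC]]] := hT c cT.
  have coef (x : 'rV[Rl]_m) : \sum_(j < l) (c`_j)%:~R * (x *m A) ord0 j =
      \sum_(h < m) (dotz c [seq col`_h | col <- cols])%:~R * x ord0 h.
    under eq_bigr do rewrite mxE mulr_sumr.
    rewrite exchange_big /=; apply: eq_bigr => h _.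
    rewrite (@dotzE l) ?size_map // rmorph_sum mulr_suml /=; apply: eq_bigr => j _.
    by rewrite mxE (nth_map [::]) ?scols // rmorphM /= mulrCA mulrC.
  have nthv (v : seq int) (h : 'I_m) :
      [seq dotz c [seq col`_k | col <- cols] | k <- iota 0 m] = v ->
      dotz c [seq col`_h | col <- cols] = v`_h.
    by move=> <-; rewrite (nth_map 0%N) ?size_iota // nth_iota.
  have key (x : 'rV[Rl]_m) : \sum_(j < l) (c`_j)%:~R * (x *m A) ord0 j = 0 ->
      \sum_(i in set_of_bits m C) x ord0 i = 0.
    rewrite coef => e; rewrite big_mkcond /=.
    case/orP: hC => /eqP hC.
      rewrite -[RHS]e; apply: eq_bigr => h _; rewrite (nthv _ h hC) nth_indz inE.
      by case: (nth _ _ _); rewrite ?mul1r ?mul0r.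
    apply/eqP; rewrite -oppr_eq0 -sumrN -[X in _ == X]e; apply/eqP; apply: eq_bigr => h _.
    rewrite (nthv _ h hC) (nth_map 0) ?size_map ?sC // nth_indz inE.
    by case: (nth _ _ _); rewrite ?mulN1r ?oppr0 ?mul0r.
  by apply: (zF _ (FC C CC)); split; exact: key.
move=> I FI Iker w wX; have := hs _ (mem_bits (size_bits_of_set I)).
case/or4P.
- move=> /allP h; case: F0; suff -> : finset.set0 = I by [].
  apply/setP => i; rewrite inE; apply/esym/negbTE.
  by have := h (nth false (bits_of_set I) i); rewrite mem_nth ?size_bits_of_set // nth_bits_of_set => /(_ isT).
- by move/FE; rewrite bits_of_setK => /(_ FI).
- case/hasP => q qQ /eqP hq.
  have sq : size q = m by apply/eqP/hQ.
  have e0 : (\row_i (q`_i)%:~R : 'rV[Rl]_m) *m A = 0.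
    apply/rowP => j; rewrite !mxE.
    transitivity ((dotz q (nth [::] cols j))%:~R : Rl).
      rewrite (@dotzE m) ?szc // rmorph_sum /=.
      by apply: eq_bigr => h _; rewrite !mxE rmorphM.
    by have /allP/(_ (nth [::] cols j)) := hQA q qQ; rewrite mem_nth ?scols // => /(_ isT)/eqP->.
  have := Iker _ e0; under eq_bigr do rewrite mxE.
  by rewrite (sum_set_dotz _ I) // => /eqP; rewrite intr_eq0 => /eqP.
- case/hasP => c cT hc; rewrite /cplx_hyperplane /=.
  set v := [seq _ | _ <- rows] in hc.
  have coef (x : 'rV[Rl]_l) : \sum_(i in I) (x *m B) ord0 i = \sum_(j < l) (v`_j)%:~R * x ord0 j.
    under eq_bigr do rewrite mxE.
    rewrite exchange_big /=; apply: eq_bigr => j _.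
    rewrite -mulr_sumr mulrC (nth_map [::]) ?srows // -sum_set_dotz ?szr //.
    by congr (_ * _); apply: eq_bigr => i _; rewrite mxE.
  rewrite !coef; case/orP: hc => /eqP ->; first exact: wX.
  rewrite !sumN => -[/eqP + /eqP]; rewrite !oppr_eq0 => /eqP h1 /eqP h2.
  exact: (wX c cT).
Qed.

Definition generic_forms l : seq (seq int) :=
  nseq l 1 :: [seq [seq (i == j)%:Z | j <- iota 0 l] | i <- iota 0 l].

Lemma form_compl_generic l : form_compl l (generic_forms l) = generic_compl l.
Proof.
have unit (i : 'I_l) (x : 'rV[Rl]_l) :
    \sum_(j < l) ([seq (nat_of_ord i == j)%:Z | j <- iota 0 l]`_j)%:~R * x ord0 j = x ord0 i.
  rewrite (bigD1 i) //= (nth_map 0%N) ?size_iota // nth_iota // eqxx mul1r big1 ?addr0 // => j ji.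
  rewrite (nth_map 0%N) ?size_iota // nth_iota // add0n (_ : _ == _ = false) ?mul0r //.
  by apply/negbTE; rewrite eq_sym.
have ones (x : 'rV[Rl]_l) : \sum_(j < l) ((nseq l (1 : int))`_j)%:~R * x ord0 j = \sum_j x ord0 j.
  by apply: eq_bigr => j _; rewrite nth_nseq ltn_ord mul1r.
apply/seteqP; split=> w.
  move=> H; split=> [i|].
    have := H [seq (nat_of_ord i == j)%:Z | j <- iota 0 l]; rewrite !unit; apply.
    by rewrite inE; apply/orP; right; apply: map_f; rewrite mem_iota /=.
  by have := H (nseq l 1); rewrite !ones; apply; rewrite inE eqxx.
move=> [H1 H2] c; rewrite inE => /orP[/eqP->|/mapP[i]]; first by rewrite !ones.
rewrite mem_iota /= => il ->; have := H1 (Ordinal il).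
by rewrite -!(unit (Ordinal il)).
Qed.

Definition X3_forms : seq (seq int) :=
  [:: [:: 1; 0; 0]; [:: 0; 1; 0]; [:: 0; 0; 1]; [:: 1; 1; 0]; [:: -1; 0; 1]; [:: 0; -1; 1]].

Lemma form_compl_X3 : form_compl 3 X3_forms = X3_compl.
Proof.
have sum3 (F : 'I_3 -> Rl) : \sum_j F j = F o0 + F o1 + F o2.
  by rewrite !big_ord_recl big_ord0 addr0 addrA; congr (F _ + F _ + F _); exact: val_inj.
apply/seteqP; split=> w.
  move=> H; split.
  - apply: ord3P.
    + by have := H [:: 1; 0; 0] isT; rewrite !sum3 /= !mul1r !mul0r !addr0.
    + by have := H [:: 0; 1; 0] isT; rewrite !sum3 /= !mul1r !mul0r !addr0 !add0r.
    + by have := H [:: 0; 0; 1] isT; rewrite !sum3 /= !mul1r !mul0r !addr0 !add0r.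
  - by have := H [:: 1; 1; 0] isT; rewrite !sum3 /= !mul1r !mul0r !addr0.
  - by have := H [:: -1; 0; 1] isT; rewrite !sum3 /= !mulN1r !mul1r !mul0r !addr0 ![- _ + _]addrC.
  - by have := H [:: 0; -1; 1] isT; rewrite !sum3 /= !mulN1r !mul1r !mul0r !add0r ![- _ + _]addrC.
move=> [H1 H2 H3 H4] c; rewrite !inE !sum3.
case/orP=> [/eqP->|/orP[/eqP->|/orP[/eqP->|/orP[/eqP->|/orP[/eqP->|/eqP->]]]]];
  rewrite /= ?mulN1r ?mul1r ?mul0r ?addr0 ?add0r ?[- _ + _]addrC //.
Qed.

Lemma generic_obstruction m k cols rows Q Cs E (F : {set 'I_m} -> Prop) : (0 < k)%N ->
  localize_check m k.+1 cols rows Q (generic_forms k.+1) Cs E ->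
  ~ F finset.set0 -> (forall s, s \in E -> ~ F (set_of_bits m s)) ->
  (forall C, C \in Cs -> F (set_of_bits m C)) ->
  ~ pi_trivial_bounded (family_compl F) k.
Proof.
move=> k0 chk F0 FE FC /(pi_trivial_check chk F0 FE FC).
by rewrite form_compl_generic; exact: generic_not_pi_trivial.
Qed.

Lemma X3_obstruction m cols rows Q Cs E (F : {set 'I_m} -> Prop) :
  localize_check m 3 cols rows Q X3_forms Cs E ->
  ~ F finset.set0 -> (forall s, s \in E -> ~ F (set_of_bits m s)) ->
  (forall C, C \in Cs -> F (set_of_bits m C)) ->
  ~ pi_trivial_bounded (family_compl F) 2.
Proof.
move=> chk F0 FE FC /(pi_trivial_check chk F0 FE FC).
by rewrite form_compl_X3; exact: X3_not_pi_trivial.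
Qed.

Close Scope classical_set_scope.

(** * Obstructions to asphericity *)

Definition bits_cover n (s : seq bool) (L : seq {set 'I_n}) : {set 'I_n} :=
  foldr (fun p acc => (if p.1 then p.2 else finset.set0) :|: acc) finset.set0 (zip s L).

Lemma bits_coverP n (s : seq bool) (L : seq {set 'I_n}) i : size s = size L ->
  reflect (exists2 k, (k < size L)%N & nth false s k && (i \in nth finset.set0 L k))
    (i \in bits_cover s L).
Proof.
move=> sL; apply: (iffP idP).
  elim: s L sL => [|b s IH] [|X L] //= => [_|[sL]]; first by rewrite /bits_cover inE.
  rewrite /bits_cover /= inE => /orP[|/(IH L sL)[k kL h]]; last by exists k.+1.
  by case: b => iX; [exists 0%N | rewrite inE in iX].
elim: s L sL => [|b s IH] [|X L] //= => [_ [k //]|[sL] [[|k] kL /= /andP[h1 h2]]].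
  by rewrite /bits_cover /= inE h1 h2.
by rewrite /bits_cover /= inE (IH L sL) ?orbT //; exists k => //; rewrite h1.
Qed.

Lemma block_union_bits n m (L : seq {set 'I_n}) s : size L = m -> size s = m ->
  block_union (block_of L (m := m)) (set_of_bits m s) = bits_cover s L.
Proof.
move=> sL ss; apply/setP => i; rewrite inE; apply/exists_inP/bits_coverP; rewrite ?ss //.
  by case=> j; rewrite inE => sj ij; exists j; rewrite ?sL // sj.
by case=> k; rewrite sL => km /andP[h1 h2]; exists (Ordinal km); rewrite ?inE.
Qed.

Section Obstructions.
Variables (n : nat) (e : rel 'I_n).
Notation conn := (induced_connected e).
Implicit Types (L : seq {set 'I_n}).

Lemma blocks_obstruction L m k :
  size L = m -> disjoint_blocks L -> (2 <= k)%N ->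
  (forall F : {set 'I_m} -> Prop, ~ F finset.set0 ->
     (forall s, size s = m -> (has id s /\ conn (bits_cover s L)) <-> F (set_of_bits m s)) ->
     ~ pi_trivial_bounded (family_compl F) k) ->
  ~ KPi1 e.
Proof.
move=> sL /andP[L0 Ld] k2 H /(_ k k2)/pi_trivial_boundedW piX.
have b0 (j : 'I_m) : block_of L j != finset.set0 by exact: block_of_neq0.
have bD (j j' : 'I_m) i : i \in block_of L j -> i \in block_of L j' -> j = j'.
  exact: block_of_inj.
have := pi_trivial_blocks b0 bD (F := arr_index e) piX; apply: H.
- case=> /eqP[]; apply/setP => i; rewrite !inE; apply/exists_inP => -[j].
  by rewrite inE.
move=> s ss; rewrite /arr_index block_union_bits //; split=> -[h1 h2]; split=> //.
  case/(has_nthP false): h1 => i si hi; rewrite ss in si.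
  have /set0Pn[x xi] := b0 (Ordinal si).
  by apply/set0Pn; exists x; apply/bits_coverP; rewrite ?ss ?sL //; exists i; rewrite ?sL // hi.
case/set0Pn: h1 => x /bits_coverP; rewrite ss sL => /(_ erefl)[i im /andP[hi _]].
by apply/(has_nthP false); exists i; rewrite ?ss.
Qed.

Lemma generic_graph_obstruction L m k cols rows Q Cs E :
  size L = m -> disjoint_blocks L -> (1 < k)%N ->
  localize_check m k.+1 cols rows Q (generic_forms k.+1) Cs E ->
  all (fun s => (size s == m) && has id s) Cs -> all (fun s => size s == m) E ->
  (forall s, s \in E -> ~ conn (bits_cover s L)) ->
  (forall s, s \in Cs -> conn (bits_cover s L)) -> ~ KPi1 e.
Proof.
move=> sL dL k1 chk /allP hCs /allP hE cE cCs.
apply: (blocks_obstruction sL dL k1) => F F0 HF.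
apply: (generic_obstruction (ltnW k1) chk F0).
  by move=> s sE /(HF _ (eqP (hE s sE)))[_]; exact: cE.
by move=> s sC; have /andP[/eqP ss hs] := hCs s sC; apply/(HF _ ss); split=> //; exact: cCs.
Qed.

(* The relation (a b m) + (c d m) = (a c m) + (b d m). *)
Lemma star_obstruction (a b c d m : {set 'I_n}) : disjoint_blocks [:: a; b; c; d; m] ->
  conn (a :|: (b :|: m)) -> conn (a :|: (c :|: m)) ->
  conn (b :|: (d :|: m)) -> conn (c :|: (d :|: m)) -> ~ KPi1 e.
Proof.
move=> dL c1 c2 c3 c4.
apply: (@generic_graph_obstruction _ 5 2
 [:: [:: 1; 1; 0; 0; 1]; [:: -1; 0; -1; 0; -1]; [:: 0; -1; 0; -1; -1]]
 [:: [:: 0; 1; 0; -1; 0]; [:: 0; 0; -1; 0; 0]; [:: 0; 0; 0; -1; 0]]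
 [:: [:: 1; -1; -1; 1; 0]; [:: 0; -1; -1; 0; 1]]
 [:: [:: true; true; false; false; true]; [:: true; false; true; false; true]; [:: false; true; false; true; true]; [:: false; false; true; true; true]]
 [::] _ dL) => //.
move=> s; rewrite !inE; case/or4P => /eqP ->; by rewrite /bits_cover /= ?finset.set0U ?finset.setU0.
Qed.

(* The relation (b m) + (c d m) = (c m) + (b d m); since d is also in the span
   of these vectors it must not be connected. *)
Lemma square_obstruction (b c d m : {set 'I_n}) : disjoint_blocks [:: b; c; d; m] ->
  conn (b :|: m) -> conn (c :|: m) ->
  conn (b :|: (d :|: m)) -> conn (c :|: (d :|: m)) -> ~ conn d -> ~ KPi1 e.
Proof.
move=> dL c1 c2 c3 c4 cd.
apply: (@generic_graph_obstruction _ 4 2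
 [:: [:: 1; 0; 0; 1]; [:: 0; -1; 0; -1]; [:: -1; 0; -1; -1]]
 [:: [:: 1; 0; -1; 0]; [:: 0; -1; 0; 0]; [:: 0; 0; -1; 0]]
 [:: [:: -1; -1; 0; 1]]
 [:: [:: true; false; false; true]; [:: false; true; false; true]; [:: true; false; true; true]; [:: false; true; true; true]]
 [:: [:: false; false; true; false]] _ dL) => //.
  by move=> s; rewrite inE => /eqP ->; rewrite /bits_cover /= !finset.set0U !finset.setU0.
move=> s; rewrite !inE; case/or4P => /eqP ->; by rewrite /bits_cover /= ?finset.set0U ?finset.setU0.
Qed.

(** In the coordinates [x = b], [y = c], [w = a + b + c + d] the connected unions are [x], [y],
    [x + y], [w], [w - x] and [w - y]. The vector in [Q] keeps [a] and [d] together, and the only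
    other nonempty union of this kind, [a + d = w - x - y], must be absent. *)
Lemma diamond_obstruction (a b c d : {set 'I_n}) : disjoint_blocks [:: a; b; c; d] ->
  conn b -> conn c -> conn (b :|: c) -> conn (a :|: (c :|: d)) -> conn (a :|: (b :|: d)) ->
  conn (a :|: (b :|: (c :|: d))) -> ~ conn (a :|: d) -> ~ KPi1 e.
Proof.
move=> dL c1 c2 c3 c4 c5 c6 cad.
pose Cs := [:: [:: false; true; false; false]; [:: false; false; true; false]; [:: false; true; true; false];
   [:: true; false; true; true]; [:: true; true; false; true]; [:: true; true; true; true]].
apply: (@blocks_obstruction _ 4 2 _ dL) => // F F0 HF.
apply: (@X3_obstruction 4 [:: [:: 0; 1; 0; 0]; [:: 0; 0; 1; 0]; [:: 1; 1; 1; 1]]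
  [:: [:: -1; 1; 0; 0]; [:: -1; 0; 1; 0]; [:: 1; 0; 0; 0]] [:: [:: 1; 0; 0; -1]]
  Cs [:: [:: true; false; false; true]]) => //.
  move=> s; rewrite inE => /eqP -> /(HF [:: true; false; false; true] erefl)[_].
  by rewrite /bits_cover /= !finset.set0U !finset.setU0.
move=> s; rewrite !inE => sC; apply/HF; last split.
- by move: sC; repeat (case/orP => [/eqP->//|]); move/eqP->.
- by move: sC; repeat (case/orP => [/eqP->//|]); move/eqP->.
by move: sC; repeat (case/orP => [/eqP->|]); (try move/eqP->);
  rewrite /bits_cover /= ?finset.set0U ?finset.setU0.
Qed.

Hypothesis e_sym : ssrbool.symmetric e.
Hypothesis e_irr : ssrbool.irreflexive e.

Lemma conn_addr I x y : conn I -> y \in I -> e y x -> conn ([set x]%SET :|: I).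
Proof. by move=> cI yI eyx; apply: (conn_add e_sym cI yI); rewrite e_sym. Qed.

Lemma last_neq (s : seq 'I_n) x y : uniq (rcons s y) -> x \in s -> y != x.
Proof. by rewrite rcons_uniq => /andP[ys _] xs; apply: contraNneq ys => ->. Qed.

(** Connected sets are built by adding points from the end of the list of blocks. The lists put the
    tips of legs first and the centre last, so each added point has a neighbour among the later
    ones. *)
Ltac conn_points := solve [done | match goal with
  H : is_true (e ?y ?x) |- induced_connected e (finset.setU (finset.set1 ?x) ?I) =>
    apply: (@conn_addr I x y _ _ H); [conn_points | by rewrite ?inE ?eqxx ?orbT] end].

(* With m the centre, the even and the odd permutation matrices of order 3
   have the same sum. *)
Lemma spider_obstruction m a1 a2 b1 b2 c1 c2 : uniq [:: a2; a1; b2; b1; c2; c1; m] ->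
  e m a1 -> e a1 a2 -> e m b1 -> e b1 b2 -> e m c1 -> e c1 c2 ->
  e a2 m = false -> e a2 b1 = false -> e a2 c1 = false ->
  e b2 m = false -> e b2 a1 = false -> e b2 c1 = false ->
  e c2 m = false -> e c2 a1 = false -> e c2 b1 = false -> ~ KPi1 e.
Proof.
move=> us ma aa mb bb mc cc am ab ac bm ba bc cm ca cb.
have cm1 := @conn1 _ e m.
have ne x := @last_neq [:: a2; a1; b2; b1; c2; c1] x m us.
pose Cs := [:: [:: false; false; false; true; true; true; true]; [:: false; true; true; true; false; false; true]; [:: true; true; false; false; false; true; true]; [:: false; false; true; true; false; true; true]; [:: true; true; false; true; false; false; true]; [:: false; true; false; false; true; true; true]].
apply: (@generic_graph_obstruction _ 7 4
 [:: [:: 0; 0; 0; 1; 1; 1; 1]; [:: 0; 1; 1; 1; 0; 0; 1]; [:: 1; 1; 0; 0; 0; 1; 1]; [:: 0; 0; -1; -1; 0; -1; -1]; [:: -1; -1; 0; -1; 0; 0; -1]]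
 [:: [:: 0; 0; 0; 0; 1; 0; 0]; [:: -1; 1; 0; 0; 0; 0; 0]; [:: 0; 0; 0; -1; 0; 0; 1]; [:: 0; 1; 0; 0; 1; 0; -1]; [:: 0; 0; 1; -1; 1; 0; 0]]
 [:: [:: -2; 1; -2; 1; -2; 1; 0]; [:: -1; 0; -1; 0; -1; 0; 1]]
 Cs [:: [:: false; true; false; true; true; false; true];
        [:: false; true; true; false; false; true; true];
        [:: true; false; false; true; false; true; true]] _ (disjoint_points us)) => //.
- move=> s; rewrite !inE; case/or3P => /eqP->; rewrite /bits_cover /= ?finset.set0U ?finset.setU0.
  + apply: (@disconn_isolated _ e _ c2 m); rewrite ?inE ?eqxx ?orbT ?ne ?inE ?eqxx ?orbT //.
    by move=> u; rewrite !inE => /or4P[] /eqP->; rewrite ?e_irr.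
  + apply: (@disconn_isolated _ e _ b2 m); rewrite ?inE ?eqxx ?orbT ?ne ?inE ?eqxx ?orbT //.
    by move=> u; rewrite !inE => /or4P[] /eqP->; rewrite ?e_irr.
  + apply: (@disconn_isolated _ e _ a2 m); rewrite ?inE ?eqxx ?orbT ?ne ?inE ?eqxx ?orbT //.
    by move=> u; rewrite !inE => /or4P[] /eqP->; rewrite ?e_irr.
by move=> s; rewrite !inE; repeat (case/orP => [/eqP->|]); (try move/eqP->);
  rewrite /bits_cover /= ?finset.set0U ?finset.setU0; conn_points.
Qed.

(** The relation (y' x y z) + (x' z' x y z) = (x y) + (x' x z) + (y' z' y z) gives five generic
    hyperplanes in [C^4]. The other sets in the span are (z' y), (y' z) and (x' z' z), which the
    non-edges disconnect. *)
Lemma net_obstruction x y z x' y' z' : uniq [:: x'; y'; z'; x; y; z] ->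
  e x y -> e y z -> e x z -> e x x' -> e y y' -> e z z' ->
  e z' y = false -> e y' z = false -> e x' z' = false -> e x' z = false -> ~ KPi1 e.
Proof.
move=> us xy yz xz xx yy zz zy yz' xz' xz''.
have ne u := @last_neq [:: x'; y'; z'; x; y] u z us.
have cm1 := @conn1 _ e z; have cy := @conn1 _ e y.
have zx : e z x by rewrite e_sym.
have zy1 : e z y by rewrite e_sym.
have yx : e y x by rewrite e_sym.
pose Cs := [:: [:: false; true; false; true; true; true]; [:: true; false; true; true; true; true]; [:: false; false; false; true; true; false]; [:: true; false; false; true; false; true]; [:: false; true; true; false; true; true]].
apply: (@generic_graph_obstruction _ 6 3
 [:: [:: 0; 1; 0; 1; 1; 1]; [:: 1; 0; 1; 1; 1; 1]; [:: 0; 0; 0; -1; -1; 0]; [:: -1; 0; 0; -1; 0; -1]]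
 [:: [:: 0; 1; 0; 0; 0; 0]; [:: 0; 0; 1; 0; 0; 0]; [:: 0; 0; 0; -1; 0; 1]; [:: 0; 0; 0; -1; 1; 0]]
 [:: [:: 1; 0; -1; -1; 1; 0]; [:: -1; -1; 0; 0; 0; 1]]
 Cs [:: [:: false; false; true; false; true; false];
        [:: false; true; false; false; false; true];
        [:: true; false; true; false; false; true]] _ (disjoint_points us)) => //.
- move=> s; rewrite !inE; case/or3P => /eqP->; rewrite /bits_cover /= ?finset.set0U ?finset.setU0.
  + apply: (@disconn_isolated _ e _ z' y); rewrite ?inE ?eqxx ?orbT //.
      by case/and5P: us => _ _ + _ _; rewrite !inE !negb_or eq_sym => /and3P[_ + _]; rewrite eq_sym.
    by move=> u; rewrite !inE => /orP[] /eqP->; rewrite ?e_irr.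
  + apply: (@disconn_isolated _ e _ y' z); rewrite ?inE ?eqxx ?orbT ?ne ?inE ?eqxx ?orbT //.
    by move=> u; rewrite !inE => /orP[] /eqP->; rewrite ?e_irr.
  + apply: (@disconn_isolated _ e _ x' z); rewrite ?inE ?eqxx ?orbT ?ne ?inE ?eqxx ?orbT //.
    by move=> u; rewrite !inE => /or3P[] /eqP->; rewrite ?e_irr.
by move=> s; rewrite !inE; repeat (case/orP => [/eqP->|]); (try move/eqP->);
  rewrite /bits_cover /= ?finset.set0U ?finset.setU0; conn_points.
Qed.
End Obstructions.

Theorem mainTheorem8 (n : nat) (e : rel 'I_n) :
  simple_graph e -> graph_connected e ->
  KPi1 e -> ~ is_K4 e -> arr_free e.
Proof.
move=> [e_sym e_irr] [n0 e_conn] ek eK4.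
apply: (path_plus_vertex_free e_sym e_irr).
apply: (classification e_sym e_irr n0 e_conn) => //.
- by move=> a b c d m dL h1 h2 h3 h4; exact: (star_obstruction dL h1 h2 h3 h4 ek).
- by move=> b c d m dL h1 h2 h3 h4 h5; exact: (square_obstruction dL h1 h2 h3 h4 h5 ek).
- by move=> a b c d dL h1 h2 h3 h4 h5 h6 h7; exact: (diamond_obstruction dL h1 h2 h3 h4 h5 h6 h7 ek).
- move=> m a1 a2 b1 b2 c1 c2 us h1 h2 h3 h4 h5 h6 h7 h8 h9 h10 h11 h12 h13 h14 h15.
  exact: (spider_obstruction e_sym e_irr us h1 h2 h3 h4 h5 h6 h7 h8 h9 h10 h11 h12 h13 h14 h15 ek).
- move=> x y z x' y' z' us h1 h2 h3 h4 h5 h6 h7 h8 h9 h10.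
  exact: (net_obstruction e_sym e_irr us h1 h2 h3 h4 h5 h6 h7 h8 h9 h10 ek).
Qed.
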